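(* In each of the five settings (A)–(E) described in the context, all the germs at the boundary curve ($\gamma$ in setting (A), $J$ in settings (B)–(E)) of foliations of the corresponding kind are flatly close to each other near the boundary. That is, for any two such foliations (for the same fixed data), and for every $n\in\mathbb N$, they have the same $n$-jet at each point of the boundary curve.
   Context: Conventions. A smooth (possibly immersed) planar curve is strictly convex if its curvature vanishes nowhere; its convex side is the side towards which it curves. A domain $U$ is adjacent to a curve $\gamma$ from the convex side (resp. $U\subset\mathbb R\times\mathbb R_+$ is adjacent to an interval $J\subset\mathbb R\times\{0\}$) if it is disjoint from the curve, has it in its boundary, and together with the curve contains a one-sided neighborhood, on the convex side (resp. in $\mathbb R\times\mathbb R_{\ge0}$), of each point of the curve. The $n$-jet of a foliation at a point is the $n$-jet of its tangent line field. (A) $\gamma\subset\mathbb R^2$ is a strictly convex $C^\infty$-smooth curve parametrized by an interval, which is either a one-dimensional submanifold going to infinity in both directions and bounding a convex domain, or an arc each of whose points has a neighborhood $V$ such that $\gamma\cap V$ is a submanifold of $V$. The foliations are: foliations by caustics of the billiard on $\gamma$, on domains $U$ adjacent to $\gamma$ from the convex side, extending $C^\infty$-smoothly to $U\cup\gamma$ with $\gamma$ being a leaf. Here a foliation $\mathcal F$ by strictly convex curves, with leaf $\gamma$, is assumed to be the foliation by connected components of level curves of a continuous function $h$ on $U\cup\gamma$, $h|_\gamma=0$, $h|_U>0$, strictly increasing in the transversal parameter. In the submanifold case it is also assumed that through every $x\in\gamma$ there are at most two tangent lines to each leaf $\mathcal L$, and $\mathcal F$ is a foliation by caustics if, whenever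 there are two tangent lines to $\mathcal L$ through $x\in\gamma$, they are symmetric with respect to $T_x\gamma$. In the arc case: let $\mathcal H$ be the space of triples $(x,y,z)$ with $x\in\gamma$, $y\ne z$ in the same leaf $\mathcal L$, such that the lines $xy$, $xz$ are tangent to $\mathcal L$ at $y$, $z$ respectively; $\Delta=\{(x,x,x)\mid x\in\gamma\}$; $\mathcal H_0$ is the path-connected component of $\mathcal H\cup\Delta$ containing $\Delta$; $\mathcal F$ is a foliation by caustics if for every $(x,y,z)\in\mathcal H_0\setminus\Delta$ the lines $xy$ and $xz$ are symmetric with respect to $T_x\gamma$. (B) $\gamma$ is a strictly convex $C^\infty$-smooth curve, the image of an immersion $\psi:(0,1)\to\gamma$; $J=(0,1)\times\{0\}$, $V\subset(0,1)\times\mathbb R_+$ is a domain adjacent to $J$, $\Psi:V\cup J\to\mathbb R^2$ is a $C^\infty$ immersion extending $\psi$ (as a map $J\to\gamma$) and sending $V$ to the convex side. The foliations are: foliations by lifted caustics on domains $U\subset V$ adjacent to $J$, extending $C^\infty$-smoothly to $U\cup J$ with $J$ being a leaf. A foliation $\mathcal F$ by curves parametrized by intervals (level curves of a continuous function $h$, $h|_J=0$, $h|_U>0$, strictly increasing in the transversal parameter) with leaf $J$ is a foliation by lifted caustics if the following holds. Let $\mathcal H$ be the space of triples $(x,y,z)$ with $x\in J$, $y\neq z$ in the same leaf $\mathcal L$, such that the lines $\Psi(x)\Psi(y)$, $\Psi(x)\Psi(z)$ are tangent to $\Psi(\mathcal L)$ at $\Psi(y)$, $\Psi(z)$ respectively;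 $\Delta=\{(x,x,x)\mid x\in J\}$; $\mathcal H_0$ the path-connected component of $\mathcal H\cup\Delta$ containing $\Delta$. Then for every $(x,y,z)\in\mathcal H_0\setminus\Delta$ the lines $\Psi(x)\Psi(y)$ and $\Psi(x)\Psi(z)$ are symmetric with respect to the tangent line to $\gamma$ at $\Psi(x)$. (C) $\gamma$ is a $C^\infty$-smooth strictly convex closed curve bijectively parametrized by a circle, $\mathcal A$ is a topological annulus adjacent to $\gamma$ from the convex side (including $\gamma$), $\pi:\widetilde{\mathcal A}=\mathbb R\times[0,\varepsilon)\to\mathcal A$ is its (smooth) universal covering, $J=\mathbb R\times\{0\}$. The foliations are: foliations by lifted caustics (defined as in (B) with $\Psi$ replaced by $\pi$) on domains $U\subset\widetilde{\mathcal A}\setminus J$ adjacent to $J$, extending $C^\infty$-smoothly to $U\cup J$ with $J$ being a leaf. (D) $F:V\cup J\to\mathbb R\times\mathbb R_{\ge0}$ is a $C^\infty$-lifted strongly billiard-like map, $J=(a,b)\times\{0\}$ ($(a,b)$ possibly (semi-)infinite), $V\subset\mathbb R\times\mathbb R_+$ a domain adjacent to $J$. That is: $F$ is a homeomorphism onto its image fixing the points of $J$; $F|_V$ is a diffeomorphism preserving $ds\wedge dy$; $F(s,y)=(s+w(s)\sqrt y+O(y),y+O(y^{3/2}))$ as $y\to0$, $w(s)>0$, uniformly on compact subsets of $(a,b)$; and the variable change $(s,y)\mapsto(s,z)$, $z=\sqrt y$, conjugates $F$ to a map $\widetilde F$, $C^\infty$-smooth up to $J$, of the form $\widetilde F=I\circ\beta$,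 where $I(s,z)=(s,-z)$ and $\beta(s,z)=(s+w(s)z+O(z^2),-z+O(z^2))$ is a $C^\infty$-smooth involution near $J$. The foliations are: $\tilde h=const$, where $\tilde h$ is a $C^\infty$-smooth $F$-invariant function ($\tilde h\circ F=\tilde h$ where both sides are defined) on $U\cup J$, $U$ a domain adjacent to $J$, with $\tilde h|_J\equiv0$, $\partial\tilde h/\partial y>0$. (E) $\widetilde F:V\cup J\to\mathbb R_\tau\times(\mathbb R_{\ge0})_\phi$ is a $C^\infty$-smooth map of the type $\widetilde F(\tau,\phi)=(\tau+\phi+\mathrm{flat}(\phi),\phi+\mathrm{flat}(\phi))$, where $J=(a,b)\times\{0\}$, $V\subset\mathbb R\times\mathbb R_+$ is a domain adjacent to $J$. The foliations are: $\tilde\phi=const$, where $\tilde\phi(\tau,\phi)=\phi+\mathrm{flat}(\phi)$ is a $C^\infty$-smooth $\widetilde F$-invariant function on $W\cup J$, $W\subset V$ a domain adjacent to $J$, with $\partial\tilde\phi/\partial\phi>0$. Here $\mathrm{flat}(\phi)$ denotes a $\phi$-flat function: a $C^\infty$-smooth function vanishing on $J$ that tends to zero with each of its partial derivatives as $\phi\to0$, uniformly on compact subsets of the $\tau$-interval. *)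

(* Defs.v *)
From HB Require Import structures.
From mathcomp Require Import all_boot all_order all_algebra.
From mathcomp Require Import all_classical all_reals all_analysis.
Set Implicit Arguments.
Unset Strict Implicit.
Unset Printing Implicit Defensive.
Import Order.TTheory GRing.Theory Num.Theory numFieldNormedType.Exports.
Local Open Scope classical_set_scope.
Local Open Scope ring_scope.

Notation plane R := (R * R)%type.

Section Smoothness.
Variable R : realType.
Local Notation plane := (plane R).

Definition axis (b : bool) : plane := if b then (0, 1) else (1, 0).

(* [pderivs [:: b1; ...; bk] f] is d_b1 (d_b2 (... (d_bk f))), where
   d_false = d/dx and d_true = d/dy. *)
Definition pderivs (W : normedModType R) (w : seq bool) (f : plane -> W) :
    plane -> W :=
  foldr (fun b (g : plane -> W) p => 'D_(axis b) g p) f w.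

Definition smooth (W : normedModType R) (O : set plane) (f : plane -> W) :=
  forall (w : seq bool) (p : plane), O p ->
    {for p, continuous (pderivs w f)} /\
    (forall b, derivable (pderivs w f) p (axis b)).

(* A map on a non-open set A, such as a domain with a boundary curve, is
   C^oo if it extends to a C^oo map on an open neighbourhood of A. Maps being
   total functions, f itself is taken to be such an extension; where A is the
   closure of its interior, its derivatives on A depend on f|A only. *)
Definition smooth_on (W : normedModType R) (A : set plane) (f : plane -> W) :=
  exists O : set plane, [/\ open O, A `<=` O & smooth O f].

Definition det2 (u v : plane) : R := u.1 * v.2 - u.2 * v.1.

Definition dot (u v : plane) : R := u.1 * v.1 + u.2 * v.2.

Definition jac (f : plane -> plane) (p : plane) : R :=
  det2 ('D_(axis false) f p) ('D_(axis true) f p).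

Definition submersion (O : set plane) (f : plane -> R) :=
  smooth O f /\ forall p, O p -> exists v, 'D_v f p != 0.

Definition submanifold1 (M : set plane) :=
  forall p, M p -> exists (O : set plane) (f : plane -> R),
    [/\ open O, O p, submersion O f & M `&` O = O `&` [set q | f q = 0]].

End Smoothness.

Section Topology.

Definition homeo (T T' : topologicalType) (A : set T) (B : set T')
    (f : T -> T') :=
  exists g : T' -> T,
    [/\ {within A, continuous f}, {within B, continuous g},
        forall x, A x -> B (f x) /\ g (f x) = x
      & forall y, B y -> A (g y) /\ f (g y) = y].

Definition covering_map (T T' : topologicalType) (D : set T) (B : set T')
    (f : T -> T') :=
  f @` D = B /\
  forall b, B b -> exists (O : set T') (sheets : set (set T)),
    [/\ open O /\ O b,
        forall S, sheets S -> exists2 O', open O' & S = D `&` O',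
        forall S S', sheets S -> sheets S' -> S `&` S' !=set0 -> S = S',
        \bigcup_(S in sheets) S = D `&` f @^-1` O
      & forall S, sheets S -> homeo S (B `&` O) f].

Definition joined (R : realType) (T : topologicalType) (S : set T) (p q : T) :=
  exists f : R -> T,
    [/\ {within `[0, 1], continuous f}, f 0 = p, f 1 = q
      & forall t, 0 <= t <= 1 -> S (f t)].

End Topology.

Section Curves.
Variable R : realType.
Local Notation plane := (plane R).

Definition open_interval (I : set R) := [/\ open I, is_interval I & I !=set0].

Definition smooth_curve (I : set R) (c : R -> plane) :=
  forall n t, I t -> derivable (derive1n n c) t 1.

Definition regular_curve (I : set R) (c : R -> plane) :=
  smooth_curve I c /\ forall t, I t -> derive1 c t != 0.

(* det2 c' c'' / |c'|^3 is the curvature. *)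
Definition strictly_convex (I : set R) (c : R -> plane) :=
  regular_curve I c /\
  forall t, I t -> det2 (derive1 c t) (derive1n 2 c t) != 0.

(* A normal vector to c at c t, pointing to the side of c''. *)
Definition inward (c : R -> plane) (t : R) : plane :=
  det2 (derive1 c t) (derive1n 2 c t) *: (- (derive1 c t).2, (derive1 c t).1).

(* The part near c t0 of the side of c to which the transversal vector field
   nu points, c itself excluded. *)
Definition side (I : set R) (c nu : R -> plane) (t0 delta : R) : set plane :=
  [set p | exists t r, [/\ I t, `|t - t0| < delta, 0 < r < delta
                         & p = c t + r *: nu t]].

Definition adjacent (I : set R) (c nu : R -> plane) (U : set plane) :=
  [/\ open U, connected U, U `&` c @` I = set0, c @` I `<=` closure U
    & forall t0, I t0 ->
        exists2 delta, 0 < delta & side I c nu t0 delta `<=` U].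

Definition adjacent_convex (I : set R) (c : R -> plane) (U : set plane) :=
  adjacent I c (inward c) U.

Definition hor (t : R) : plane := (t, 0).

Definition adjacent_hor (I : set R) (U : set plane) :=
  U `<=` [set p | 0 < p.2] /\ adjacent I hor (fun=> (0, 1)) U.

Definition sends_to_convex_side (I : set R) (psi : R -> plane)
    (V : set plane) (Psi : plane -> plane) :=
  forall t0 delta, I t0 -> 0 < delta ->
    \forall q \near hor t0, V q -> side I psi (inward psi) t0 delta (Psi q).

Definition planar_arc (I : set R) (c : R -> plane) :=
  [/\ open_interval I, strictly_convex I c, {in I &, injective c}
    & submanifold1 (c @` I)].

Definition goes_to_infinity (I : set R) (c : R -> plane) :=
  forall M : R, exists a b, [/\ I a, I b
    & forall t, I t -> t < a \/ b < t -> M < `|c t|].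

Definition bounds_convex_domain (I : set R) (c : R -> plane) :=
  exists D : set plane, [/\ open D, D !=set0,
    (forall p q (k : R), D p -> D q -> 0 <= k <= 1 ->
       D (k *: p + (1 - k) *: q))
    & closure D `\` D = c @` I].

Definition closed_curve (P : R) (c : R -> plane) :=
  [/\ 0 < P, strictly_convex setT c, forall t, c (t + P) = c t
    & forall s t, c s = c t -> exists k : int, s = t + k%:~R * P].

Definition euclidean_annulus : set plane :=
  [set p | 1 <= p.1 ^+ 2 + p.2 ^+ 2 < 4].

Definition unit_circle : set plane := [set p | p.1 ^+ 2 + p.2 ^+ 2 = 1].

(* An annulus with the closed curve c as the boundary component it
   contains. *)
Definition adjacent_annulus (c : R -> plane) (A : set plane) :=
  [/\ range c `<=` A, adjacent_convex setT c (A `\` range c)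
    & exists f : plane -> plane,
        homeo euclidean_annulus A f /\ f @` unit_circle = range c].

Definition strip (eps : R) : set plane := [set p | 0 <= p.2 < eps].

(* The strip is simply connected, so the covering is universal. *)
Definition universal_covering (c : R -> plane) (A : set plane) (eps : R)
    (cov : plane -> plane) :=
  [/\ 0 < eps, smooth_on (strip eps) cov,
      forall q, strip eps q -> jac cov q != 0,
      covering_map (strip eps) A cov
    & forall t, range c (cov (hor t))].

End Curves.

(* In this section A is the domain U of a foliation together with its boundary
   curve, h is the function whose level curves make up the leaves, and T q is
   the tangent line at q to the leaf through q, as a set of vectors. *)
Section Foliations.
Variable R : realType.
Local Notation plane := (plane R).
Implicit Types (I : set R) (bd c : R -> plane) (U A : set plane).
Implicit Types (h : plane -> R) (T : plane -> set plane).
Implicit Types (Psi : plane -> plane).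

Definition with_boundary I bd U : set plane := U `|` bd @` I.

Definition leaf A h (q : plane) : set plane :=
  connected_component (A `&` [set p | h p = h q]) q.

Definition kernel_field (f : plane -> R) (q : plane) : set plane :=
  [set v | 'D_v f q = 0].

(* f is a transversal parameter of the foliation in A `&` O, and h is there
   a strictly increasing function of f. *)
Definition transversal_parameter A h T (O : set plane) (f : plane -> R) :=
  [/\ submersion O f,
      forall p q, (A `&` O) p -> (A `&` O) q -> (h p <= h q) = (f p <= f q)
    & forall p, (A `&` O) p -> T p = kernel_field f p].

(* Transversal parameters at the boundary points are smooth across the
   boundary: this is the smooth extension of the foliation to it. *)
Definition level_foliation I bd U h T :=
  let A := with_boundary I bd U in
  [/\ {within A, continuous h}, forall t, I t -> h (bd t) = 0,
      forall q, U q -> 0 < h q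
    & forall p, A p -> exists (O : set plane) (f : plane -> R),
        [/\ open O, O p & transversal_parameter A h T O f]].

Definition leaves_strictly_convex A h :=
  forall p, A p -> exists (I : set R) (c : R -> plane),
    [/\ open_interval I, strictly_convex I c, (c @` I) p
      & c @` I `<=` leaf A h p].

Definition leaves_intervals A h :=
  forall p, A p -> exists (I : set R) (c : R -> plane),
    [/\ open_interval I, regular_curve I c, {in I &, injective c}
      & c @` I = leaf A h p].

Definition parallel (u v : plane) := det2 u v = 0.

Definition reflection (t u : plane) : plane :=
  (2 * dot u t / dot t t) *: t - u.

(* The lines through a point with directions u and v are symmetric with
   respect to the line through it with direction t. *)
Definition symmetric_lines (t u v : plane) := parallel (reflection t u) v.

Definition tangent_line A h T (q x d : plane) :=
  d != 0 /\ exists y, [/\ leaf A h q y, T y d & parallel (y - x) d].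

Definition caustics_global I c U h T :=
  let A := with_boundary I c U in
  [/\ level_foliation I c U h T, leaves_strictly_convex A h,
      forall t q d1 d2 d3, I t -> A q ->
        tangent_line A h T q (c t) d1 -> tangent_line A h T q (c t) d2 ->
        tangent_line A h T q (c t) d3 ->
        [\/ parallel d1 d2, parallel d1 d3 | parallel d2 d3]
    & forall t q d1 d2, I t -> A q ->
        tangent_line A h T q (c t) d1 -> tangent_line A h T q (c t) d2 ->
        ~ parallel d1 d2 -> symmetric_lines (derive1 c t) d1 d2].

(* The line through Psi x and Psi y is tangent at Psi y to the image of the
   leaf through y. *)
Definition tangent_at Psi T (x y : plane) :=
  Psi y != Psi x /\ exists2 v, T y v & 'D_v Psi y = Psi y - Psi x.

Definition triples I bd U h T Psi : set (plane * plane * plane) :=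
  let A := with_boundary I bd U in
  [set p | let: (x, y, z) := p in
    [/\ (bd @` I) x, A y /\ leaf A h y z, y != z,
        tangent_at Psi T x y & tangent_at Psi T x z]].

Definition diagonal I bd : set (plane * plane * plane) :=
  [set (x, x, x) | x in bd @` I].

Definition diagonal_component I bd U h T Psi : set (plane * plane * plane) :=
  [set p | exists2 q, diagonal I bd q
                    & joined R (triples I bd U h T Psi `|` diagonal I bd) q p].

Definition symmetric_triples I bd U h T Psi :=
  forall t y z, I t ->
    (diagonal_component I bd U h T Psi `\` diagonal I bd) (bd t, y, z) ->
    symmetric_lines (derive1 (Psi \o bd) t)
      (Psi y - Psi (bd t)) (Psi z - Psi (bd t)).

Definition caustics_arc I c U h T :=
  [/\ level_foliation I c U h T,
      leaves_strictly_convex (with_boundary I c U) h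
    & symmetric_triples I c U h T idfun].

Definition lifted_caustics I Psi U h T :=
  [/\ level_foliation I (@hor R) U h T,
      leaves_intervals (with_boundary I (@hor R) U) h
    & symmetric_triples I (@hor R) U h T Psi].

Definition spans (O A : set plane) (v : plane -> plane) T :=
  forall q, (O `&` A) q -> v q != 0 /\ T q = [set k *: v q | k in setT].

(* Jets of line fields, i.e. of maps to the projective line, are compared
   through lifts of these maps to nonzero vectors. *)
Definition same_jet (n : nat) (A1 : set plane) (T1 : plane -> set plane)
    (A2 : set plane) (T2 : plane -> set plane) (p : plane) :=
  exists (O : set plane) (v1 v2 : plane -> plane),
    [/\ open O /\ O p, smooth O v1 /\ smooth O v2,
        spans O A1 v1 T1, spans O A2 v2 T2
      & forall w, (size w <= n)%N -> pderivs w v1 p = pderivs w v2 p].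

Definition flatly_close I bd (U1 : set plane) (T1 : plane -> set plane)
    (U2 : set plane) (T2 : plane -> set plane) :=
  forall n t, I t ->
    same_jet n (with_boundary I bd U1) T1 (with_boundary I bd U2) T2 (bd t).

End Foliations.

Section BoundaryMaps.
Variable R : realType.
Local Notation plane := (plane R).
Implicit Types (I : set R) (U V : set plane) (F : plane -> plane).
Implicit Types (h : plane -> R).

Definition with_J I V : set plane := with_boundary I (@hor R) V.

Definition billiard_expansion I V F (w : R -> R) :=
  forall K : set R, compact K -> K `<=` I ->
    exists C delta, 0 < delta /\ forall s y, K s -> 0 < y < delta -> V (s, y) ->
      `|(F (s, y)).1 - (s + w s * Num.sqrt y)| <= C * y /\
      `|(F (s, y)).2 - y| <= C * (y * Num.sqrt y).

Definition smooth_involution I (O : set plane) (beta : plane -> plane)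
    (w : R -> R) :=
  [/\ open O /\ @hor R @` I `<=` O, smooth O beta,
      forall p, O p -> O (beta p) /\ beta (beta p) = p
    & forall K : set R, compact K -> K `<=` I ->
        exists C delta, 0 < delta /\
          forall s z, K s -> `|z| < delta -> O (s, z) ->
            `|(beta (s, z)).1 - (s + w s * z)| <= C * z ^+ 2 /\
            `|(beta (s, z)).2 + z| <= C * z ^+ 2].

Definition lifted_strongly_billiard_like I V F :=
  [/\ forall p, with_J I V p -> 0 <= (F p).2,
      homeo (with_J I V) (F @` with_J I V) F /\
        (forall s, I s -> F (s, 0) = (s, 0)),
      smooth V F /\ (forall p, V p -> jac F p = 1)
    & exists w : R -> R, [/\ forall s, I s -> 0 < w s, billiard_expansion I V F w
      & exists O beta, smooth_involution I O beta w /\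
          forall s z, O (s, z) -> 0 <= z -> with_J I V (s, z ^+ 2) ->
            ((F (s, z ^+ 2)).1, Num.sqrt (F (s, z ^+ 2)).2) =
            ((beta (s, z)).1, - (beta (s, z)).2)]].

Definition invariant_on I V F U h :=
  forall p, with_J I V p -> with_J I U p -> with_J I U (F p) -> h (F p) = h p.

Definition invariant_foliation I V F U h :=
  [/\ adjacent_hor I U, smooth_on (with_J I U) h, invariant_on I V F U h,
      forall s, I s -> h (s, 0) = 0
    & forall p, with_J I U p -> 0 < 'D_(axis R true) h p].

Definition flat I V (f : plane -> R) :=
  [/\ smooth_on (with_J I V) f, forall s, I s -> f (s, 0) = 0
    & forall (w : seq bool) (K : set R) eps,
        compact K -> K `<=` I -> 0 < eps ->
        exists2 delta, 0 < delta & forall s y, K s -> 0 < y < delta ->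
          V (s, y) -> `|pderivs w f (s, y)| < eps].

Definition flat_twist I V F :=
  exists f g : plane -> R, [/\ flat I V f, flat I V g
    & forall tau phi, with_J I V (tau, phi) ->
        F (tau, phi) = (tau + phi + f (tau, phi), phi + g (tau, phi)) /\
        0 <= phi + g (tau, phi)].

Definition flat_invariant_foliation I V F W h :=
  [/\ adjacent_hor I W /\ W `<=` V,
      smooth_on (with_J I W) h, invariant_on I V F W h,
      exists2 f, flat I W f
               & forall p, with_J I W p -> h p = p.2 + f p
    & forall p, with_J I W p -> 0 < 'D_(axis R true) h p].

End BoundaryMaps.

(* Main.v *)
Require Import Defs.
From HB Require Import structures.
From mathcomp Require Import all_boot all_order all_algebra.
From mathcomp Require Import all_classical all_reals all_analysis.
From mathcomp Require Import ring lra.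
Import Order.TTheory GRing.Theory Num.Theory numFieldNormedType.Exports.
Local Open Scope classical_set_scope.
Local Open Scope ring_scope.

(** Let f1 and f2 be transversal parameters of two foliations of one of the
    kinds considered, zero on the boundary curve and positive inside. Their
    Jacobian determinant D ([djac]) measures the angle between the leaves, and
    the difference of the slopes of the leaves is D times a smooth function. So
    the two foliations have the same jets at a boundary point as soon as D is
    flat there, i.e. O(f1 ^ n) for all n: flatness passes to all derivatives
    ([flat_pd], [same_jet_flat]).

    If D vanishes on the boundary without being flat, then by the Taylor formula
    there is a boundary point near which D has a constant sign and is
    comparable with f1 ^ k for some k > 0 ([order_induction], [chart_flat]). On
    the leaf f1 = u the function f2 is then strictly monotone, with derivative
    comparable with u ^ k ([leaf_variation]). The following contradicts this.

    - For a billiard-like map F, the points q and F q are different points of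
      one leaf of either foliation ([billiard_no_sign]).

    - For caustics, choose coordinates in which a point of the boundary curve is
      the origin and its tangent is the horizontal axis; the leaves curve
      upwards, the parameter F satisfying F_x = 0, F_y > 0, F_xx < 0 at
      the origin. Let M(th) be the maximum of F on the line of slope th
      through the origin. It is attained where the line is tangent to a leaf.
      The reflection law says that the two tangent lines from the origin to a
      leaf have opposite slopes; thus M is an even function ([maxline_even]).
      Now take the leaf F1 = u with u = M1(th) and its points of tangency
      q+ and q- with the lines of slopes th and -th. At these points the
      derivative of F2 along the line is O(u ^ k), so that F2(q+) and F2(q-)
      differ from M2(th) = M2(-th) by O(u ^ 2k). But the abscissas of q+ and q-
      are at distance at least a constant times the square root of u, and the
      monotonicity of F2 between them gives a difference of at least a constant
      times u ^ (k + 1/2). This is impossible for small u ([no_order]).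

    - For a flat twist, the parameter is phi + flat(phi); its horizontal
      derivative is flat, hence so is D ([flat_foliation_horizontal]).

    The three kinds of foliations by caustics are treated at once
    ([caustics_flatly_close]) as foliations near a curve bd, read in the plane
    through a local diffeomorphism Psi. Only two properties are checked for each
    of them: the reflection law for a pair of paths of tangency points starting
    at the boundary point ([caustic_at]), and a second order contact of the
    image of the boundary with the given strictly convex curve ([contact]), which
    for a covering of an annulus uses that the points of the curve covered by
    the boundary accumulate at each of them. The normalising coordinates come
    from an inverse function theorem ([inverse_function]). *)

Set Implicit Arguments.
Unset Strict Implicit.
Unset Printing Implicit Defensive.

(** * Partial derivatives and mean values *)

Section Calculus.
Variable R : realType.
Local Notation plane := (plane R).
Implicit Types (f g : plane -> R) (p q : plane) (O : set plane).

Definition pd (b : bool) f p : R := 'D_(axis R b) f p.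

Lemma near_square p (P : set plane) :
  nbhs p P <-> exists2 d, 0 < d &
    forall q, `|q.1 - p.1| < d -> `|q.2 - p.2| < d -> P q.
Proof.
split=> [/nbhs_ballP [d /= d0 H]|[d d0 H]].
  exists d => // q h1 h2; apply: H; split => /=.
    by rewrite -ball_normE/= distrC.
  by rewrite -ball_normE/= distrC.
apply/nbhs_ballP; exists d => //= q [].
by rewrite -!ball_normE /= => h1 h2; apply: H; rewrite distrC.
Qed.

Lemma near_interval (x : R) (P : set R) :
  nbhs x P <-> exists2 d, 0 < d & forall y, `|y - x| < d -> P y.
Proof.
split=> [/nbhs_ballP [d /= d0 H]|[d d0 H]].
  by exists d => // q h1; apply: H; rewrite -ball_normE/= distrC.
apply/nbhs_ballP; exists d => //= q.
by rewrite -!ball_normE /= => h1; apply: H; rewrite distrC.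
Qed.

Lemma near_and (T : topologicalType) (x : T) (A B : set T) :
  nbhs x A -> nbhs x B -> nbhs x [set y | A y /\ B y].
Proof. exact: filterI. Qed.

(** The endpoints are not ordered: leaves and lines are followed in both
    directions. *)
Lemma mvt (g dg : R -> R) (a b : R) :
  (forall x : R, Num.min a b <= x <= Num.max a b -> is_derive x 1 g (dg x)) ->
  exists2 c, Num.min a b <= c <= Num.max a b & g b - g a = dg c * (b - a).
Proof.
have key (a' b' : R) : a' <= b' -> (forall x : R, a' <= x <= b' -> is_derive x 1 g (dg x)) ->
    exists2 c, a' <= c <= b' & g b' - g a' = dg c * (b' - a').
  move=> ab H; have [||c] := @MVT_segment R g dg a' b' ab.
  - move=> x; rewrite in_itv/= => /andP[h1 h2]; apply: H.
    by rewrite !ltW.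
  - apply: derivable_within_continuous => x; rewrite in_itv/= => h.
    by have [] := H _ h.
  - by rewrite in_itv/= => h ->; exists c.
have [ab|ba] := leP a b => H; first exact: key.
have [c hc E] := key _ _ (ltW ba) H.
by exists c => //; rewrite -opprB E -mulrN opprB.
Qed.

Lemma is_derive_x f (x y : R) :
  derivable f (x, y) (axis R false) ->
  is_derive x 1 (fun s => f (s, y)) (pd false f (x, y)).
Proof.
move=> df; have E : (fun h : R => h^-1 *: ((f \o shift (x, y)) (h *: axis R false) - f (x, y))) =
   (fun h : R => h^-1 *: (((fun s => f (s, y)) \o shift x) (h *: (1 : R)) - f (x, y))).
  by apply/funext => h /=; rewrite /shift/=/GRing.add/= /add_pair /= scaler0 add0r.
by split; rewrite /derivable /pd /derive -E.
Qed.

Lemma is_derive_y f (x y : R) :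
  derivable f (x, y) (axis R true) ->
  is_derive y 1 (fun s => f (x, s)) (pd true f (x, y)).
Proof.
move=> df; have E : (fun h : R => h^-1 *: ((f \o shift (x, y)) (h *: axis R true) - f (x, y))) =
   (fun h : R => h^-1 *: (((fun s => f (x, s)) \o shift y) (h *: (1 : R)) - f (x, y))).
  by apply/funext => h /=; rewrite /shift/=/GRing.add/= /add_pair /= scaler0 add0r.
by split; rewrite /derivable /pd /derive -E.
Qed.

Definition rect p q : set plane :=
  [set r | Num.min p.1 q.1 <= r.1 <= Num.max p.1 q.1 /\
           Num.min p.2 q.2 <= r.2 <= Num.max p.2 q.2].

(** Go from [p] to the corner [(q.1, p.2)] and then to [q]. *)
Lemma mvt2 f p q :
  (forall r b, rect p q r -> derivable f r (axis R b)) ->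
  exists x y, [/\ rect p q x, rect p q y &
   f q - f p = pd false f x * (q.1 - p.1) + pd true f y * (q.2 - p.2)].
Proof.
case: p q => [p1 p2] [q1 q2] /= H.
have [|c hc E1] := @mvt (fun s => f (s, p2)) (fun s => pd false f (s, p2)) p1 q1.
  move=> x hx; apply/is_derive_x/H; split => //=.
  by rewrite ge_min le_max !lexx.
have [|d hd E2] := @mvt (fun s => f (q1, s)) (fun s => pd true f (q1, s)) p2 q2.
  move=> x hx; apply/is_derive_y/H; split => //=.
  by rewrite ge_min le_max !lexx !orbT.
exists (c, p2), (q1, d); split => //=.
- by split => //=; rewrite ge_min le_max !lexx.
- by split => //=; rewrite ge_min le_max !lexx !orbT.
- by rewrite -E1 -E2; ring.
Qed.

Lemma between_dist (x y r c d : R) : `|x - c| < d -> `|y - c| < d ->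
  Num.min x y <= r <= Num.max x y -> `|r - c| < d.
Proof.
rewrite !ltr_norml => /andP[a1 a2] /andP[a3 a4].
have [xy|yx] := leP x y => /andP[h1 h2]; apply/andP; split.
- by apply: (lt_le_trans a1); rewrite lerD2r.
- by apply: le_lt_trans a4; rewrite lerD2r.
- by apply: (lt_le_trans a3); rewrite lerD2r.
- by apply: le_lt_trans a2; rewrite lerD2r.
Qed.

Lemma rect_square p q r d (c : plane) :
  `|p.1 - c.1| < d -> `|p.2 - c.2| < d ->
  `|q.1 - c.1| < d -> `|q.2 - c.2| < d -> rect p q r ->
  `|r.1 - c.1| < d /\ `|r.2 - c.2| < d.
Proof.
by move=> a1 a2 a3 a4 [h1 h2]; split; [exact: between_dist a1 a3 h1|exact: between_dist a2 a4 h2].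
Qed.

(** By [mvt2] the error of the linear approximation is controlled by the
    oscillation of the partial derivatives on a small square. *)
Lemma C1_diff f p :
  (\forall q \near p, forall b, derivable f q (axis R b)) ->
  (forall b, {for p, continuous (pd b f)}) ->
  differentiable f p /\
  forall v, 'D_v f p = v.1 * pd false f p + v.2 * pd true f p.
Proof.
move=> dn dc.
pose L (v : plane) : R := v.1 * pd false f p + v.2 * pd true f p.
have linL : linear L.
  by move=> a u v; rewrite /L /= /GRing.scale /=; ring.
pose LM := GRing.isLinear.Build _ _ _ _ _ linL.
pose LL : {linear _ -> _} := HB.pack L LM.
have cL : continuous (LL : plane -> R).
  move=> v; rewrite /= /L.
  apply: cvgD; (apply: cvgM; last exact: cvg_cst).
    exact: cvg_fst.
  exact: cvg_snd.
have eq : (f : plane -> R^o) \o shift p = cst (f p : R^o) + (LL : plane -> R^o) +o_ (0 : plane) (id : plane -> plane).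
  apply/eqaddoP => _/posnumP[e].
  have /near_square[d d0 H] : \forall q \near p, (forall b, derivable f q (axis R b)) /\
    `|pd false f q - pd false f p| < e%:num / 2 /\
    `|pd true f q - pd true f p| < e%:num / 2.
    have e2 : 0 < e%:num / 2 :> R by rewrite divr_gt0.
    have nF b : \forall q \near p, `|pd b f p - pd b f q| < e%:num / 2.
      by move/cvgrPdist_lt : (dc b); exact.
    have := near_and dn (near_and (nF false) (nF true)).
    apply: filterS => q [h1 [h2 h3]]; rewrite distrC in h2; rewrite distrC in h3.
    exact: conj h1 (conj h2 h3).
  apply/near_square; exists d => // q.
  rewrite !subr0 => q1 q2.
  have [|x [y [hx hy E]]] := @mvt2 f p (q + p).
    move=> r b hr; have [] := @rect_square _ _ r d p _ _ _ _ hr; rewrite ?subrr ?normr0 //=.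
    - by rewrite addrK.
    - by rewrite addrK.
    - by move=> h1 h2; have [] := H r h1 h2.
  have sq z : rect p (q+p) z -> `|z.1 - p.1| < d /\ `|z.2 - p.2| < d.
    by move=> hz; apply: (@rect_square p (q+p) z d p) => //=; rewrite ?subrr ?normr0 ?addrK//.
  have [_ [X _]] := H x (sq _ hx).1 (sq _ hx).2.
  have [_ [_ Y]] := H y (sq _ hy).1 (sq _ hy).2.
  rewrite /= -![(_ - _ : _ -> _) _]/(_ - _) -![(_ + _ : _ -> _) _]/(_ + _) /=.
  rewrite /shift /= opprD addrA E /L /= !addrK.
  have -> : pd false f x * q.1 + pd true f y * q.2 - (q.1 * pd false f p + q.2 * pd true f p) =
    (pd false f x - pd false f p) * q.1 + (pd true f y - pd true f p) * q.2 by ring.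
  apply: (le_trans (ler_normD _ _)); rewrite !normrM.
  have n1 : `|q.1| <= `|q| by rewrite /Num.norm/= le_max lexx.
  have n2 : `|q.2| <= `|q| by rewrite /Num.norm/= le_max lexx orbT.
  have -> : e%:num * `|q| = e%:num / 2 * `|q| + e%:num / 2 * `|q| by field.
  apply: lerD; apply: ler_pM; [exact: normr_ge0|exact: normr_ge0|exact: ltW|exact: n1|
    exact: normr_ge0|exact: normr_ge0|exact: ltW|exact: n2].
have dE := diff_unique cL eq.
have df : differentiable f p.
  by apply/diff_locallyP; rewrite dE.
split => // v; by rewrite deriveE // dE.
Unshelve. all: by end_near. Qed.

End Calculus.

(** * Functions with continuous partial derivatives *)

Section Cn.
Variable R : realType.
Local Notation plane := (plane R).
Implicit Types (f g : plane -> R) (p q : plane) (O : set plane).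

(** The recursion along partial derivatives makes the closure properties below
    inductions on [n], in which only continuity and one derivative are
    handled; [smooth] is the conjunction of all levels. *)
Fixpoint Cn n O f : Prop :=
  (forall p, O p -> {for p, continuous f}) /\
  match n with
  | 0 => True
  | n'.+1 => forall b, (forall p, O p -> derivable f p (axis R b)) /\
                       Cn n' O (pd b f)
  end.

Lemma Cn_intro n O f : (forall p, O p -> {for p, continuous f}) ->
  (forall b p, (0 < n)%N -> O p -> derivable f p (axis R b)) ->
  (forall b, (0 < n)%N -> Cn n.-1 O (pd b f)) -> Cn n O f.
Proof.
move=> h1 h2 h3; case: n h2 h3 => [|n] h2 h3; first by split.
by split; [exact: h1|move=> b; split; [move=> p; exact: h2|exact: h3]].
Qed.

Lemma Cn_cont n O f p : Cn n O f -> O p -> {for p, continuous f}.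
Proof. by case: n => [|n] [h _]; exact: h. Qed.

Lemma Cn_derivable n O f p b : Cn n.+1 O f -> O p -> derivable f p (axis R b).
Proof. by move=> [_ h]; exact: (h b).1. Qed.

Lemma Cn_pd n O f b : Cn n.+1 O f -> Cn n O (pd b f).
Proof. by move=> [_ h]; exact: (h b).2. Qed.

Lemma CnS n O f : Cn n.+1 O f -> Cn n O f.
Proof.
elim: n f => [|n IH] f; first by case.
move=> [h1 h2]; split=> // b; have [h3 h4] := h2 b.
by split=> //; exact: IH.
Qed.

Lemma Cn_leq m n O f : (m <= n)%N -> Cn n O f -> Cn m O f.
Proof.
move=> /subnK <-; elim: (n - m)%N => // k IH; rewrite addSn => /CnS; exact: IH.
Qed.

Lemma Cn_sub n O O' f : O' `<=` O -> Cn n O f -> Cn n O' f.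
Proof.
move=> s; elim: n f => [|n IH] f [h1 h2]; split=> //.
- by move=> p /s; exact: h1.
- by move=> p /s; exact: h1.
- move=> b; have [h3 h4] := h2 b; split; last exact: IH.
  by move=> p /s; exact: h3.
Qed.

Lemma near_eq_for (T : topologicalType) (f g : T -> R) (p : T) :
  (\forall q \near p, f q = g q) -> {for p, continuous f} ->
  {for p, continuous g}.
Proof.
move=> fg cf; have /= e : f p = g p := nbhs_singleton fg; rewrite /prop_for /continuous_at -e.
apply: cvg_trans cf; apply: near_eq_cvg.
by apply: filterS fg.
Qed.

Lemma Cn_ext n O f g : open O -> (forall p, O p -> f p = g p) ->
  Cn n O f -> Cn n O g.
Proof.
move=> oO; have nO p : O p -> \forall q \near p, O q by move=> Op; apply: open_nbhs_nbhs.
elim: n f g => [|n IH] f g fg [h1 h2].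
  split=> // p Op; apply: (near_eq_for _ (h1 _ Op)).
  by apply: filterS (nO _ Op) => q; exact: fg.
split.
  move=> p Op; apply: (near_eq_for _ (h1 _ Op)).
  by apply: filterS (nO _ Op) => q; exact: fg.
move=> b; have [h3 h4] := h2 b.
have fgn p : O p -> {near p, f =1 g}.
  by move=> Op; apply: filterS (nO _ Op) => q; exact: fg.
split.
  by move=> p Op; exact: (near_eq_derivable (fgn _ Op) (h3 _ Op)).
apply: IH h4 => p Op; rewrite /pd; apply: near_eq_derive; exact: fgn.
Qed.

Lemma is_derive_line (f : plane -> R) p v l :
  is_derive p v f l <-> is_derive (0 : R) 1 (fun h => f (h *: v + p)) l.
Proof.
have E : (fun h : R => h^-1 *: ((f \o shift p) (h *: v) - f p)) =
   (fun h : R => h^-1 *: (((fun h => f (h *: v + p)) \o shift 0) (h *: (1 : R)) - f (0 *: v + p))).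
  by apply/funext => h /=; rewrite /shift/= scale0r add0r addr0 [_%:A]mulr1.
by split => -[]; rewrite /derivable /derive ?E => h1 h2; split; rewrite /derivable /derive ?E.
Qed.

(** Directional derivatives become linear in the direction, so that everything
    reduces to [pd false] and [pd true]. *)
Lemma C1_differentiable O f p : open O -> Cn 1 O f -> O p ->
  differentiable f p /\
  forall v, 'D_v f p = v.1 * pd false f p + v.2 * pd true f p.
Proof.
move=> oO h Op; apply: C1_diff.
  apply: filterS (open_nbhs_nbhs (conj oO Op)) => q Oq b.
  exact: Cn_derivable h Oq.
by move=> b; apply: (Cn_cont (Cn_pd b h)).
Qed.

Lemma chain_curve O f (g1 g2 : R -> R) t d1 d2 : open O -> Cn 1 O f ->
  O (g1 t, g2 t) -> is_derive t 1 g1 d1 -> is_derive t 1 g2 d2 ->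
  is_derive t 1 (fun s => f (g1 s, g2 s))
    (d1 * pd false f (g1 t, g2 t) + d2 * pd true f (g1 t, g2 t)).
Proof.
move=> oO hf Og [/derivable1_diffP dg1 e1] [/derivable1_diffP dg2 e2].
have [df dv] := C1_differentiable oO hf Og.
have dp : differentiable (fun s => (g1 s, g2 s)) t by exact: differentiable_pair.
have dc : differentiable (f \o (fun s => (g1 s, g2 s))) t.
  exact: differentiable_comp.
split; first by apply/derivable1_diffP.
rewrite deriveE // diff_comp //= diff_pair //= -!deriveE // e1 e2.
by rewrite dv.
Qed.

Lemma chain_plane O f (g1 g2 : plane -> R) p v d1 d2 : open O -> Cn 1 O f ->
  O (g1 p, g2 p) -> is_derive p v g1 d1 -> is_derive p v g2 d2 ->
  is_derive p v (fun s => f (g1 s, g2 s))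
    (d1 * pd false f (g1 p, g2 p) + d2 * pd true f (g1 p, g2 p)).
Proof.
move=> oO hf Og /is_derive_line h1 /is_derive_line h2; apply/is_derive_line.
have E : 0 *: v + p = p by rewrite scale0r add0r.
by have := @chain_curve O f _ _ (0:R) _ _ oO hf _ h1 h2; rewrite !E; apply.
Qed.

Lemma Cn_cst n O (c : R) : Cn n O (fun=> c).
Proof.
elim: n c => [|n IH] c; split=> //.
- by move=> p _; exact: cst_continuous.
- by move=> p _; exact: cst_continuous.
- move=> b; split; first by move=> p _; exact: derivable_cst.
  have -> : pd b (fun=> c) = fun=> 0; last exact: IH.
  by apply/funext => p; rewrite /pd derive_cst.
Qed.

Lemma pd_fst b p : pd b (@fst R R) p = (axis R b).1 /\ derivable (@fst R R) p (axis R b).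
Proof.
have h : is_derive p (axis R b) (@fst R R) (axis R b).1.
  apply/is_derive_line.
  have -> : (fun h : R => (h *: axis R b + p).1) = (fun h => h * (axis R b).1 + p.1) by [].
  by apply: is_derive_eq; rewrite /GRing.scale /=; ring.
by split; case: h.
Qed.

Lemma pd_snd b p : pd b (@snd R R) p = (axis R b).2 /\ derivable (@snd R R) p (axis R b).
Proof.
have h : is_derive p (axis R b) (@snd R R) (axis R b).2.
  apply/is_derive_line.
  have -> : (fun h : R => (h *: axis R b + p).2) = (fun h => h * (axis R b).2 + p.2) by [].
  by apply: is_derive_eq; rewrite /GRing.scale /=; ring.
by split; case: h.
Qed.

Lemma Cn_fst n O : Cn n O (@fst R R).
Proof.
apply: Cn_intro => [p _|b p _ _|b _]; [exact: cvg_fst|exact: (pd_fst b p).2|].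
have -> : pd b (@fst R R) = fun=> (axis R b).1; last exact: Cn_cst.
by apply/funext => p; exact: (pd_fst b p).1.
Qed.

Lemma Cn_snd n O : Cn n O (@snd R R).
Proof.
apply: Cn_intro => [p _|b p _ _|b _]; [exact: cvg_snd|exact: (pd_snd b p).2|].
have -> : pd b (@snd R R) = fun=> (axis R b).2; last exact: Cn_cst.
by apply/funext => p; exact: (pd_snd b p).1.
Qed.

Lemma CnD n O f g : open O -> Cn n O f -> Cn n O g -> Cn n O (fun p => f p + g p).
Proof.
move=> oO; elim: n f g => [|n IH] f g hf hg; split=> //;
  try by move=> p Op; apply: cvgD; [exact: (Cn_cont hf)|exact: (Cn_cont hg)].
move=> b; split.
  by move=> p Op; apply: derivableD; [exact: Cn_derivable hf _|exact: Cn_derivable hg _].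
apply: (@Cn_ext _ _ (fun p => pd b f p + pd b g p)) => //; last first.
  by apply: IH; exact: Cn_pd.
move=> p Op; rewrite /pd -deriveD //; [exact: Cn_derivable hf _|exact: Cn_derivable hg _].
Qed.

Lemma CnM n O f g : open O -> Cn n O f -> Cn n O g -> Cn n O (fun p => f p * g p).
Proof.
move=> oO; elim: n f g => [|n IH] f g hf hg; split=> //;
  try by move=> p Op; apply: cvgM; [exact: (Cn_cont hf)|exact: (Cn_cont hg)].
move=> b; split.
  by move=> p Op; apply: derivableM; [exact: Cn_derivable hf _|exact: Cn_derivable hg _].
apply: (@Cn_ext _ _ (fun p => f p * pd b g p + g p * pd b f p)) => //; last first.
  by apply: CnD => //; apply: IH; solve [exact: Cn_pd | exact: CnS].
move=> p Op; rewrite /pd -[LHS]/(f p *: _ + g p *: _) -deriveM //; [exact: Cn_derivable hf _|exact: Cn_derivable hg _].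
Qed.

Lemma CnZ n O (c : R) f : open O -> Cn n O f -> Cn n O (fun p => c * f p).
Proof. by move=> oO h; apply: CnM => //; exact: Cn_cst. Qed.

Lemma CnN n O f : open O -> Cn n O f -> Cn n O (fun p => - f p).
Proof.
move=> oO h; have -> : (fun p => - f p) = (fun p => -1 * f p).
  by apply/funext => p; rewrite mulN1r.
exact: CnZ.
Qed.

Lemma CnB n O f g : open O -> Cn n O f -> Cn n O g -> Cn n O (fun p => f p - g p).
Proof. by move=> oO hf hg; apply: CnD => //; exact: CnN. Qed.

Lemma CnV n O f : open O -> (forall p, O p -> f p != 0) -> Cn n O f ->
  Cn n O (fun p => (f p)^-1).
Proof.
move=> oO f0; elim: n => [|n IH] hf; split=> //;
  try by move=> p Op; apply: cvgV; [exact: f0|exact: (Cn_cont hf)].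
move=> b; split.
  by move=> p Op; apply: derivableV; [exact: f0|exact: Cn_derivable hf _].
apply: (@Cn_ext _ _ (fun p => - ((f p)^-1 * (f p)^-1 * pd b f p))) => //; last first.
  by apply: CnN => //; do 2?[apply: CnM => //]; solve [exact: Cn_pd | apply: IH; exact: CnS].
move=> p Op; rewrite /pd [RHS]deriveV; [|exact: f0|exact: Cn_derivable hf _].
by rewrite /GRing.scale/= -exprVn expr2; ring.
Qed.

Lemma Cn_comp n O O' f (g1 g2 : plane -> R) : open O -> open O' ->
  Cn n O f -> Cn n O' g1 -> Cn n O' g2 ->
  (forall p, O' p -> O (g1 p, g2 p)) -> Cn n O' (fun p => f (g1 p, g2 p)).
Proof.
move=> oO oO'; elim: n f g1 g2 => [|n IH] f g1 g2 hf h1 h2 hO; apply: Cn_intro.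
- move=> p Op; apply: (@continuous_comp _ _ _ (fun p => (g1 p, g2 p)) f).
    by apply: (@cvg_pair _ _ _ (nbhs p) (nbhs (g1 p)) (nbhs (g2 p))); [exact: (Cn_cont h1)|exact: (Cn_cont h2)].
  by apply: (Cn_cont hf); exact: hO.
- by [].
- by [].
- move=> p Op; apply: (@continuous_comp _ _ _ (fun p => (g1 p, g2 p)) f).
    by apply: (@cvg_pair _ _ _ (nbhs p) (nbhs (g1 p)) (nbhs (g2 p))); [exact: (Cn_cont h1)|exact: (Cn_cont h2)].
  by apply: (Cn_cont hf); exact: hO.
- move=> b p _ Op; have [] // := chain_plane oO (Cn_leq (isT : (1 <= n.+1)%N) hf) (hO p Op)
     (derivableP (Cn_derivable (b := b) h1 Op)) (derivableP (Cn_derivable (b := b) h2 Op)).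
- move=> b _; apply: (Cn_ext (f := fun p => pd b g1 p * pd false f (g1 p, g2 p) + pd b g2 p * pd true f (g1 p, g2 p))); first exact: oO'.
    move=> p Op; rewrite /pd; have [_ ->] := chain_plane oO (Cn_leq (isT : (1 <= n.+1)%N) hf) (hO p Op)
     (derivableP (Cn_derivable (b := b) h1 Op)) (derivableP (Cn_derivable (b := b) h2 Op)); by [].
  have k1 := Cn_pd b h1; have k2 := Cn_pd b h2.
  have k3 := IH _ _ _ (Cn_pd false hf) (CnS h1) (CnS h2) hO.
  have k4 := IH _ _ _ (Cn_pd true hf) (CnS h1) (CnS h2) hO.
  exact: (CnD oO' (CnM oO' k1 k3) (CnM oO' k2 k4)).
Qed.

End Cn.

(** * Smooth functions and maps *)

Section Smooth.
Variable R : realType.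
Local Notation plane := (plane R).
Implicit Types (f g : plane -> R) (p q : plane) (O : set plane).

Lemma is_derive_cvg (V W : normedModType R) (F : V -> W) (x v : V) (d : W) :
  is_derive x v F d <->
  (fun h : R => h^-1 *: ((F \o shift x) (h *: v) - F x)) @ 0^' --> d.
Proof.
split=> [[h1 <-]|h]; first exact: h1.
by split; [apply/cvg_ex; exists d|exact: cvg_lim].
Qed.

Lemma is_derive_pair (V : normedModType R) (F : V -> plane) (x v : V) (d : plane) :
  is_derive x v F d <->
  is_derive x v (fun y => (F y).1) d.1 /\ is_derive x v (fun y => (F y).2) d.2.
Proof.
rewrite !is_derive_cvg; split=> [h|[h1 h2]].
  split; [have /= := cvg_comp _ _ h (@cvg_fst _ _ (nbhs d.1) (nbhs d.2) _) |
    have /= := cvg_comp _ _ h (@cvg_snd _ _ (nbhs d.1) (nbhs d.2) _)]; exact.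
have := @cvg_pair _ _ _ _ (nbhs d.1) (nbhs d.2) _ _ _ _ _ h1 h2.
by rewrite /=; case: (d) => a b; apply.
Qed.

Definition Cinf O f := forall n, Cn n O f.

Lemma pderivs_rcons (W : normedModType R) w b (F : plane -> W) :
  pderivs (rcons w b) F = pderivs w (fun p => 'D_(axis R b) F p).
Proof. by rewrite /pderivs foldr_rcons. Qed.

Lemma smooth_D (W : normedModType R) O b (F : plane -> W) : smooth O F ->
  smooth O (fun p => 'D_(axis R b) F p).
Proof. by move=> h w p Op; rewrite -pderivs_rcons; exact: h. Qed.

Lemma smooth_Cinf O f : smooth O f <-> Cinf O f.
Proof.
split=> h.
  move=> n; elim: n f h => [|n IH] f h; split=> //;
    try by move=> p Op; exact: (h [::] p Op).1.
  move=> b; split; last by apply: IH; exact: smooth_D.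
  by move=> p Op; exact: (h [::] p Op).2.
move=> w; elim/last_ind: w f h => [|w b IH] f h p Op.
  by split; [exact: Cn_cont (h 0%N) Op|move=> b; exact: Cn_derivable (h 1%N) Op].
by rewrite pderivs_rcons; apply: IH => // n; exact: Cn_pd.
Qed.

Lemma Cinf_pd O f b : Cinf O f -> Cinf O (pd b f).
Proof. by move=> h n; exact: Cn_pd. Qed.

Lemma Cinf_pderivs O f w : Cinf O f -> Cinf O (pderivs w f).
Proof.
by elim: w f => [//|b w IH] f h; apply: (@Cinf_pd _ (pderivs w f)); exact: IH.
Qed.

Lemma pderivs_ext O f g w : open O -> (forall p, O p -> f p = g p) ->
  forall p, O p -> pderivs w f p = pderivs w g p.
Proof.
move=> oO fg; elim: w => [//|b w IH] p Op /=.
by apply: near_eq_derive; apply: filterS (open_nbhs_nbhs (conj oO Op)) => q; exact: IH.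
Qed.

Lemma smooth_fst O (F : plane -> plane) : open O -> smooth O F ->
  Cinf O (fun p => (F p).1) /\
  forall b p, O p -> pd b (fun p => (F p).1) p = ('D_(axis R b) F p).1.
Proof.
move=> oO h.
have der (G : plane -> plane) b p : smooth O G -> O p ->
    is_derive p (axis R b) (fun q => (G q).1) ('D_(axis R b) G p).1.
  move=> hG Op; have /derivableP/is_derive_pair[] // := (hG [::] p Op).2 b.
split; last by move=> b p Op; rewrite /pd; have [_ ->] := der F b p h Op.
move=> n; elim: n F h => [|n IH] F h; apply: Cn_intro.
- by move=> p Op; apply: (cvg_comp F); [exact: (h [::] p Op).1|exact: cvg_fst].
- by [].
- by [].
- by move=> p Op; apply: (cvg_comp F); [exact: (h [::] p Op).1|exact: cvg_fst].
- by move=> b p _ Op; have [] := der F b p h Op.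
move=> b _; apply: (Cn_ext (f := fun p => ('D_(axis R b) F p).1)); first exact: oO.
  by move=> p Op; rewrite /pd; have [_ ->] := der F b p h Op.
exact: (IH (fun p => 'D_(axis R b) F p) (smooth_D b h)).
Qed.

Lemma smooth_snd O (F : plane -> plane) : open O -> smooth O F ->
  Cinf O (fun p => (F p).2) /\
  forall b p, O p -> pd b (fun p => (F p).2) p = ('D_(axis R b) F p).2.
Proof.
move=> oO h.
have der (G : plane -> plane) b p : smooth O G -> O p ->
    is_derive p (axis R b) (fun q => (G q).2) ('D_(axis R b) G p).2.
  move=> hG Op; have /derivableP/is_derive_pair[] // := (hG [::] p Op).2 b.
split; last by move=> b p Op; rewrite /pd; have [_ ->] := der F b p h Op.
move=> n; elim: n F h => [|n IH] F h; apply: Cn_intro.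
- by move=> p Op; apply: (cvg_comp F); [exact: (h [::] p Op).1|exact: cvg_snd].
- by [].
- by [].
- by move=> p Op; apply: (cvg_comp F); [exact: (h [::] p Op).1|exact: cvg_snd].
- by move=> b p _ Op; have [] := der F b p h Op.
move=> b _; apply: (Cn_ext (f := fun p => ('D_(axis R b) F p).2)); first exact: oO.
  by move=> p Op; rewrite /pd; have [_ ->] := der F b p h Op.
exact: (IH (fun p => 'D_(axis R b) F p) (smooth_D b h)).
Qed.

Lemma pderivs_pair O (f1 f2 : plane -> R) w p : open O -> Cinf O f1 -> Cinf O f2 ->
  O p -> pderivs w (fun q => (f1 q, f2 q)) p = (pderivs w f1 p, pderivs w f2 p).
Proof.
move=> oO h1 h2; elim: w p => [//|b w IH] p Op.
have [d1 d2] : derivable (pderivs w f1) p (axis R b) /\ derivable (pderivs w f2) p (axis R b).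
  by split; [exact: (((smooth_Cinf O f1).2 h1) w p Op).2|exact: (((smooth_Cinf O f2).2 h2) w p Op).2].
have h : is_derive p (axis R b) (pderivs w (fun q => (f1 q, f2 q)))
   ('D_(axis R b) (pderivs w f1) p, 'D_(axis R b) (pderivs w f2) p).
  apply: (@near_eq_is_derive _ _ _ (fun q => (pderivs w f1 q, pderivs w f2 q))).
    by apply: filterS (open_nbhs_nbhs (conj oO Op)) => q Oq; rewrite IH.
  by apply/is_derive_pair; split; exact: derivableP.
by have [_ /=] := h.
Qed.

Lemma smooth_pair O (f1 f2 : plane -> R) : open O -> Cinf O f1 -> Cinf O f2 ->
  smooth O (fun q => (f1 q, f2 q)).
Proof.
move=> oO h1 h2 w p Op.
have nE : \forall q \near p, (pderivs w f1 q, pderivs w f2 q) = pderivs w (fun q => (f1 q, f2 q)) q.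
  by apply: filterS (open_nbhs_nbhs (conj oO Op)) => q Oq; rewrite (pderivs_pair _ oO).
have [c1 d1] := ((smooth_Cinf O f1).2 h1) w p Op.
have [c2 d2] := ((smooth_Cinf O f2).2 h2) w p Op.
split.
  have /= e := nbhs_singleton nE.
  rewrite /prop_for /continuous_at -e.
  apply: cvg_trans; first by apply: near_eq_cvg; exact: nE.
  exact: (@cvg_pair _ _ _ (nbhs p) (nbhs (pderivs w f1 p)) (nbhs (pderivs w f2 p))).
move=> b.
apply: (@near_eq_derivable _ _ _ (fun q => (pderivs w f1 q, pderivs w f2 q))).
  exact: nE.
have [] // : is_derive p (axis R b) (fun q => (pderivs w f1 q, pderivs w f2 q))
   ('D_(axis R b) (pderivs w f1) p, 'D_(axis R b) (pderivs w f2) p).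
by apply/is_derive_pair; split; exact: derivableP.
Qed.

End Smooth.

(** * Flatness and jets of line fields *)

Section Flat.
Variable R : realType.
Local Notation plane := (plane R).
Implicit Types (f g G : plane -> R) (p q : plane) (O : set plane).

Lemma is_derive_on_line f (v q : plane) (t : R) :
  derivable f (t *: v + q) v ->
  is_derive t 1 (fun s => f (s *: v + q)) ('D_v f (t *: v + q)).
Proof.
move=> df; have E : (fun h : R => h^-1 *: ((f \o shift (t *: v + q)) (h *: v) - f (t *: v + q))) =
   (fun h : R => h^-1 *: (((fun s => f (s *: v + q)) \o shift t) (h *: (1 : R)) - f (t *: v + q))).
  by apply/funext => h /=; rewrite /shift/= [_%:A]mulr1 scalerDl addrA.
by split; rewrite /derivable /derive -E.
Qed.

(** Only the side [0 < f] matters, where [f] is comparable with the distance to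
    the boundary; on the other side a function is not constrained by the
    foliation. *)
Definition flat_at p f G := forall n, exists C,
  \forall q \near p, 0 < f q -> `|G q| <= C * f q ^+ n.

Lemma near_bounded f p : {for p, continuous f} ->
  \forall q \near p, `|f q| <= `|f p| + 1.
Proof.
move=> /cvgrPdist_lt /(_ _ ltr01) h; near=> q.
have : `|f p - f q| < 1 by near: q.
move=> h1; rewrite -[f q](subrK (f p)) addrC.
by apply: (le_trans (ler_normD _ _)); rewrite lerD2l distrC ltW.
Unshelve. all: by end_near. Qed.

(** Compare the derivative with a difference quotient. At a point where [f = u]
    use a step of order [u ^+ n.+1]: the values of the function are
    O(u ^ (2n + 2)), hence their quotient is O(u ^ (n + 1)), and so is the error
    of the quotient since the second derivative is bounded. The step is
    so short that [f] stays between [u / 2] and [2 * u]. *)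
Lemma flat_pd O f G p b : open O -> O p -> Cinf O f -> Cinf O G -> f p = 0 ->
  flat_at p f G -> flat_at p f (pd b G).
Proof.
move=> oO Op hf hG fp0 hfl n.
have [C0 nC] := hfl (n.+1 + n.+1)%N.
pose C := `|C0|.
pose K := (`|pd b f p| + 1) + (`|pd b (pd b G) p| + 1).
have nK1 := near_bounded (Cn_cont (Cn_pd b (hf 1%N)) Op).
have nK2 := near_bounded (Cn_cont (Cn_pd b (Cn_pd b (hG 2%N))) Op).
have nO : \forall q \near p, O q by apply: open_nbhs_nbhs.
have [d d0 H] : exists2 d, 0 < d & forall q, `|q.1 - p.1| < d -> `|q.2 - p.2| < d ->
   O q /\ (0 < f q -> `|G q| <= C * f q ^+ (n.+1 + n.+1)) /\
   `|pd b f q| <= K /\ `|pd b (pd b G) q| <= K.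
  apply/near_square; near=> q; split; first by near: q.
  split.
    move=> fq0; have : `|G q| <= C0 * f q ^+ (n.+1 + n.+1) by apply: (near nC).
    move/le_trans; apply; apply: ler_wpM2r; first by apply: exprn_ge0; exact: ltW.
    exact: ler_norm.
  split; rewrite /K.
    have : `|pd b f q| <= `|pd b f p| + 1 by near: q.
    move/le_trans; apply; rewrite lerDl; exact: addr_ge0.
  have : `|pd b (pd b G) q| <= `|pd b (pd b G) p| + 1 by near: q.
  move/le_trans; apply; rewrite lerDr; exact: addr_ge0.
have K1 : 1 <= K.
  rewrite /K; have h1 := normr_ge0 (pd b f p); have h2 := normr_ge0 (pd b (pd b G) p); lra.
have K0 : 0 < K by lra.
pose dl := Num.min 1 (d / 2).
have dl0 : 0 < dl by rewrite lt_min ltr01 /= divr_gt0.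
exists ((C * 2 ^+ (n.+1 + n.+1) + C) * (2 * K) + 1).
have d2 : 0 < d / 2 by rewrite divr_gt0.
have nf : \forall q \near p, `|f q| < dl.
  have /cvgrPdist_lt /(_ _ dl0) h := Cn_cont (hf 0%N) Op.
  by near=> q; rewrite -[f q]subr0 -fp0 distrC; near: q.
have nd : \forall q \near p, `|q.1 - p.1| < d / 2 /\ `|q.2 - p.2| < d / 2.
  by apply/near_square; exists (d / 2) => //.
near=> q => fq0.
have [q1 q2] : `|q.1 - p.1| < d / 2 /\ `|q.2 - p.2| < d / 2 by near: q.
have : `|f q| < dl by near: q.
rewrite gtr0_norm // lt_min => /andP[u1 ud].
set u := f q in fq0 u1 ud *.
(* the step: along it [f], with derivative at most [K], moves by at most [u / 2] *)
pose tau := u ^+ n.+1 / (2 * K).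
have un0 : 0 < u ^+ n.+1 by exact: exprn_gt0.
have unu : u ^+ n.+1 <= u by rewrite exprS ler_piMr ?exprn_ile1 // ltW.
have K20 : 0 < 2 * K by lra.
have tau0 : 0 < tau by rewrite divr_gt0.
have tauK : K * tau = u ^+ n.+1 / 2 by rewrite /tau; field; rewrite gt_eqF.
have tauu : tau <= u / 2.
  rewrite /tau ler_pdivrMr //; have -> : u / 2 * (2 * K) = u * K by field.
  by apply: (le_trans unu); rewrite ler_peMr // ltW.
have Ksq t : 0 <= t <= tau ->
    `|(t *: axis R b + q).1 - p.1| < d /\ `|(t *: axis R b + q).2 - p.2| < d.
  move=> /andP[t0 tt]; have td : `|t| < d / 2 by rewrite ger0_norm //; lra.
  have e (x y z : R) : `|x| <= `|t| -> `|y - z| < d / 2 -> `|x + y - z| < d.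
    by move=> h1 h2; rewrite -addrA; apply: (le_lt_trans (ler_normD _ _)); lra.
  have a1 : `|t * (axis R b).1| <= `|t| by rewrite /axis; case: (b); rewrite /= ?mulr0 ?mulr1 ?normr0.
  have a2 : `|t * (axis R b).2| <= `|t| by rewrite /axis; case: (b); rewrite /= ?mulr0 ?mulr1 ?normr0.
  by split; apply: e.
have min0 : Num.min 0 tau = 0 by rewrite min_l // ltW.
have max0 : Num.max 0 tau = tau by rewrite max_r // ltW.
have lineD (g : plane -> R) t : Cinf O g -> 0 <= t <= tau ->
    is_derive t 1 (fun s => g (s *: axis R b + q)) (pd b g (t *: axis R b + q)).
  move=> hg ht; apply: is_derive_on_line; apply: Cn_derivable (hg 1%N) _.
  by have [a1 a2] := Ksq t ht; have [] := H _ a1 a2.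
have fq' : `|f (tau *: axis R b + q) - u| <= u / 2.
  have [x hx|c hc] := @mvt R (fun s => f (s *: axis R b + q)) (fun s => pd b f (s *: axis R b + q)) 0 tau.
    by apply: lineD => //; move: hx; rewrite min0 max0.
  rewrite min0 max0 in hc; rewrite scale0r add0r subr0 => ->.
  have [a1 a2] := Ksq _ hc; have [_ [_ [h3 _]]] := H _ a1 a2.
  rewrite normrM (gtr0_norm tau0); apply: (@le_trans _ _ (K * tau)).
    by apply: ler_wpM2r => //; exact: ltW.
  by rewrite tauK; lra.
have [f1' f2'] : u / 2 <= f (tau *: axis R b + q) /\ f (tau *: axis R b + q) <= 2 * u.
  by move: fq'; rewrite ler_norml => /andP[]; lra.
have C0' : 0 <= C by exact: normr_ge0.
have Gq' : `|G (tau *: axis R b + q)| <= C * 2 ^+ (n.+1 + n.+1) * u ^+ (n.+1 + n.+1).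
  have ht : 0 <= tau <= tau by rewrite lexx ltW.
  have [a1 a2] := Ksq _ ht; have [_ [h2 _]] := H _ a1 a2.
  apply: (le_trans (h2 _)); first by lra.
  rewrite -mulrA -exprMn; apply: ler_wpM2l => //.
  by apply: lerXn2r => //; rewrite nnegrE; lra.
have ht0 : 0 <= (0 : R) <= tau by rewrite lexx ltW.
have Gq : `|G q| <= C * u ^+ (n.+1 + n.+1).
  have [a1 a2] := Ksq _ ht0; have [_ [h2 _]] := H _ a1 a2.
  by rewrite scale0r add0r in h2; exact: h2.
have [x hx|c hc] := @mvt R (fun s => G (s *: axis R b + q)) (fun s => pd b G (s *: axis R b + q)) 0 tau.
  by apply: lineD => //; move: hx; rewrite min0 max0.
rewrite min0 max0 in hc; rewrite scale0r add0r subr0 => E1.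
have /andP[c0 ct] := hc.
have minc : Num.min 0 c = 0 by rewrite min_l.
have maxc : Num.max 0 c = c by rewrite max_r.
have [x hx|e he] := @mvt R (fun s => pd b G (s *: axis R b + q)) (fun s => pd b (pd b G) (s *: axis R b + q)) 0 c.
  apply: lineD; first exact: Cinf_pd.
  by move: hx; rewrite minc maxc => /andP[-> h]; rewrite /= (le_trans h ct).
rewrite minc maxc in he; rewrite scale0r add0r subr0 => E2.
have hK2 : `|pd b (pd b G) (e *: axis R b + q)| <= K.
  have ht : 0 <= e <= tau by case/andP: he => -> h; rewrite (le_trans h).
  by have [a1 a2] := Ksq _ ht; have [_ [_ [_]]] := H _ a1 a2.
have key : `|pd b G q| * tau <= (C * 2 ^+ (n.+1 + n.+1) + C) * u ^+ (n.+1 + n.+1) + K * tau * tau.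
  have -> : `|pd b G q| * tau = `|pd b G q * tau| by rewrite normrM (gtr0_norm tau0).
  have -> : pd b G q * tau = G (tau *: axis R b + q) - G q - (pd b (pd b G) (e *: axis R b + q) * c) * tau.
    by rewrite -E2 E1; ring.
  apply: (le_trans (ler_normB _ _)); apply: lerD.
    apply: (le_trans (ler_normB _ _)); rewrite mulrDl; exact: lerD.
  rewrite 2!normrM (gtr0_norm tau0) (ger0_norm c0).
  by apply: ler_wpM2r; [exact: ltW|apply: ler_pM].
have : `|pd b G q| <= ((C * 2 ^+ (n.+1 + n.+1) + C) * (2 * K) + 1) * u ^+ n.+1.
  rewrite -(ler_pM2r tau0); apply: (le_trans key).
  have -> : K * tau * tau = u ^+ n.+1 / 2 * tau by rewrite tauK.
  have -> : u ^+ (n.+1 + n.+1) = 2 * K * tau * u ^+ n.+1.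
    by rewrite exprD /tau; field; rewrite gt_eqF.
  have a1 : 0 <= tau * u ^+ n.+1 by rewrite mulr_ge0 // ltW.
  by lra.
move/le_trans; apply; apply: ler_wpM2l.
  apply: addr_ge0 => //; apply: mulr_ge0; last exact: ltW.
  by apply: addr_ge0 => //; apply: mulr_ge0 => //; exact: exprn_ge0.
rewrite exprS ler_piMl //; [exact/exprn_ge0/ltW|exact: ltW].
Unshelve. all: by end_near. Qed.

Lemma flat_pderivs O f G p w : open O -> O p -> Cinf O f -> Cinf O G -> f p = 0 ->
  flat_at p f G -> flat_at p f (pderivs w G).
Proof.
move=> oO Op hf hG f0 h; elim: w => [//|b w IH] /=.
apply: (@flat_pd O f (pderivs w G)) => //; exact: Cinf_pderivs.
Qed.

(** The point [p] is a limit of points where [f] is positive, and [f] tends to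
    zero along them. *)
Lemma flat_at0 f G p : {for p, continuous f} -> {for p, continuous G} -> f p = 0 ->
  closure [set q | 0 < f q] p -> flat_at p f G -> G p = 0.
Proof.
move=> cf cG fp0 cl fl; apply/eqP; rewrite -normr_eq0; apply/negP => /negP.
rewrite -normr_gt0 normr_id => Gp.
have [C nC] := fl 1%N.
have e0 : 0 < `|G p| / 2 by rewrite divr_gt0.
have e1 : 0 < `|G p| / 2 / (`|C| + 1) by rewrite divr_gt0 // ltr_wpDl.
move/cvgrPdist_lt : cf => /(_ _ e1) cf.
move/cvgrPdist_lt : cG => /(_ _ e0) cG.
have : nbhs p [set q | (0 < f q -> `|G q| <= C * f q ^+ 1) /\
    `|f p - f q| < `|G p| / 2 / (`|C| + 1) /\ `|G p - G q| < `|G p| / 2].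
  by near=> q; split; [near: q|split; near: q].
move=> /cl [q /= [fq0 [/(_ fq0)]]]; rewrite expr1 fp0 sub0r normrN (gtr0_norm fq0).
move=> h1 [h2 h3].
rewrite ltr_pdivlMr in h2; last by rewrite ltr_wpDl.
have h4 : C * f q <= f q * `|C| by rewrite mulrC; apply: ler_wpM2l; [exact: ltW|exact: ler_norm].
have h5 : `|G p| <= `|G p - G q| + `|G q|.
  by rewrite -{1}[G p](subrK (G q)); exact: ler_normD.
lra.
Unshelve. all: by end_near. Qed.

Lemma flat_bounded_mul f G S p : {for p, continuous S} -> flat_at p f G ->
  flat_at p f (fun q => G q * S q).
Proof.
move=> /near_bounded nS fl n; have [C nC] := fl n.
exists (`|C| * (`|S p| + 1)); near=> q => fq.
rewrite normrM; have h1 : `|S q| <= `|S p| + 1 by near: q.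
have h2 : `|G q| <= C * f q ^+ n by apply: (near nC).
rewrite mulrAC; apply: ler_pM => //; apply: (le_trans h2).
by apply: ler_wpM2r; [exact/exprn_ge0/ltW|exact: ler_norm].
Unshelve. all: by end_near. Qed.

Lemma flat_at_ext f G G' p : (\forall q \near p, G q = G' q) -> flat_at p f G -> flat_at p f G'.
Proof.
move=> nE fl n; have [C nC] := fl n; exists C; near=> q => fq.
have <- : G q = G' q by near: q.
exact: (near nC).
Unshelve. all: by end_near. Qed.

Lemma pderivsB O f g w p : open O -> Cinf O f -> Cinf O g -> O p ->
  pderivs w (fun q => f q - g q) p = pderivs w f p - pderivs w g p.
Proof.
move=> oO hf hg; elim: w p => [//|b w IH] p Op /=.
rewrite (@near_eq_derive _ _ _ _ (fun q => pderivs w f q - pderivs w g q)); last first.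
  by apply: filterS (open_nbhs_nbhs (conj oO Op)) => q; exact: IH.
rewrite [LHS]deriveB //.
  exact: (((smooth_Cinf O f).2 hf) w p Op).2.
exact: (((smooth_Cinf O g).2 hg) w p Op).2.
Qed.

(** Where the differentials of [f1] and [f2] do not vanish, it is zero exactly
    at the points of tangency of their level curves. *)
Definition djac f1 f2 q : R := pd false f1 q * pd true f2 q - pd true f1 q * pd false f2 q.

Definition slope b f q : R := - (pd (~~ b) f q / pd b f q).

(** The vector tangent to the level curve whose component transversal to [axis b]
    is 1. *)
Definition slope_field b f q : plane := if b then (1, slope b f q) else (slope b f q, 1).

Lemma kernel_slope_field O f b q : open O -> Cn 1 O f -> O q -> pd b f q != 0 ->
  slope_field b f q != 0 /\ kernel_field f q = [set k *: slope_field b f q | k in setT].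
Proof.
move=> oO hf Oq nz; split.
  by rewrite /slope_field; case: (b); apply/eqP => -[]; [move=> e _|move=> _ e]; move/eqP: e; rewrite oner_eq0.
apply/seteqP; split=> w /=; rewrite /kernel_field /= (C1_differentiable oO hf Oq).2.
  move=> hw; exists (if b then w.1 else w.2) => //.
  move: nz; rewrite /slope_field /slope.
  case: (b) => nz; rewrite [w]surjective_pairing /GRing.scale/= /scale_pair /=; congr (_, _); rewrite /GRing.scale/= ?mulr1 //.
    by apply: (mulIf nz); rewrite mulrN mulNr mulrA divfK //; move/eqP: hw; rewrite addr_eq0 => /eqP ->; rewrite opprK.
  by apply: (mulIf nz); rewrite mulrN mulNr mulrA divfK //; move/eqP: hw; rewrite addrC addr_eq0 => /eqP ->; rewrite opprK.
move=> [k _ <-]; move: nz; rewrite /slope_field /slope.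
by case: (b) => nz; rewrite /GRing.scale/= /scale_pair /= /GRing.scale/=; field.
Qed.

(** Where the derivatives along [axis b] do not vanish, the difference of the
    slopes of the level curves is, up to sign, [djac f1 f2] divided by the
    product of these derivatives. So it is flat, and all its derivatives
    vanish at [p]. *)
Lemma same_jet_flat n p A1 (T1 : plane -> set plane) A2 (T2 : plane -> set plane) O f1 f2 b :
  open O -> O p -> Cinf O f1 -> Cinf O f2 -> f1 p = 0 ->
  closure [set q | 0 < f1 q] p ->
  pd b f1 p != 0 -> pd b f2 p != 0 ->
  (forall q, O q -> A1 q -> T1 q = kernel_field f1 q) ->
  (forall q, O q -> A2 q -> T2 q = kernel_field f2 q) ->
  flat_at p f1 (djac f1 f2) ->
  same_jet n A1 T1 A2 T2 p.
Proof.
move=> oO Op h1 h2 f1p cl n1 n2 hT1 hT2 fl.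
have [N [oN Np] sN] : exists2 N, open_nbhs p N &
   N `<=` [set q | O q /\ pd b f1 q != 0 /\ pd b f2 q != 0].
  have : nbhs p [set q | O q /\ pd b f1 q != 0 /\ pd b f2 q != 0].
    have nO : \forall q \near p, O q by apply: open_nbhs_nbhs.
    have c1 := Cn_cont (Cn_pd b (h1 1%N)) Op.
    have c2 := Cn_cont (Cn_pd b (h2 1%N)) Op.
    have nzn (g : plane -> R) : {for p, continuous g} -> g p != 0 -> \forall q \near p, g q != 0.
      by move=> cg g0; apply: (cg (fun y => y != 0)); apply: open_nbhs_nbhs; split=> //; exact: open_neq.
    near=> q; split; first by near: q.
    by split; near: q; apply: nzn.
  by rewrite nbhsE => -[N h s]; exists N.
have sO : N `<=` O by move=> q /sN [].
have Cm f : Cinf O f -> (forall q, N q -> pd b f q != 0) -> Cinf N (slope b f).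
  move=> hf nz k; apply: CnN => //; apply: CnM => //.
    apply: Cn_sub sO _; exact: Cn_pd.
  apply: CnV => //; apply: Cn_sub sO _; exact: Cn_pd.
have cm1 : Cinf N (slope b f1) by apply: Cm => // q /sN [_ []].
have cm2 : Cinf N (slope b f2) by apply: Cm => // q /sN [_ []].
have c1 : Cinf N (fun=> 1) by move=> k; exact: Cn_cst.
have spv f A (T : plane -> set plane) : Cinf O f -> (forall q, N q -> pd b f q != 0) ->
    (forall q, O q -> A q -> T q = kernel_field f q) -> spans N A (slope_field b f) T.
  move=> hf nz hT q [Nq Aq]; have Oq := sO _ Nq.
  by rewrite (hT _ Oq Aq); apply: (kernel_slope_field oO (hf 1%N)) => //; exact: nz.
exists N, (slope_field b f1), (slope_field b f2); split=> //.
- by split; rewrite /slope_field; case: (b) cm1 cm2 => cm1 cm2; apply: smooth_pair.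
- by apply: spv => // q /sN [_ []].
- by apply: spv => // q /sN [_ []].
move=> w _.
have E : pderivs w (slope b f1) p = pderivs w (slope b f2) p.
  apply/eqP; rewrite -subr_eq0; apply/eqP; rewrite -(pderivsB w oN cm1 cm2 Np).
  have cmB : Cinf N (fun q => slope b f1 q - slope b f2 q) by move=> k; apply: CnB.
  have h1' : Cinf N f1 by move=> k; apply: Cn_sub sO _.
  apply: (@flat_at0 f1); [exact: Cn_cont (h1 0%N) Op|exact: Cn_cont (Cinf_pderivs w cmB 0%N) Np|by []|by []|].
  apply: (@flat_pderivs N) => //.
  apply: (@flat_at_ext _ (fun q => djac f1 f2 q * ((if b then -1 else 1) / (pd b f1 q * pd b f2 q)))).
    apply: filterS (open_nbhs_nbhs (conj oN Np)) => q /sN [_ []] n1' n2'.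
    by move: n1' n2'; rewrite /slope /djac; case: (b) => /= z1 z2; field; rewrite z1 z2.
  apply: flat_bounded_mul => //.
  have : Cn 0 N (fun q => (if b then -1 else 1) / (pd b f1 q * pd b f2 q)).
    apply: CnM => //; first exact: Cn_cst.
    apply: CnV => //; first by move=> q /sN [_ []] ? ?; rewrite mulf_neq0.
    by apply: CnM => //; apply: Cn_sub sO _; exact: Cn_pd.
  by move/Cn_cont; apply.
rewrite /slope_field; case: (b) cm1 cm2 E => cm1 cm2 E; by rewrite !(pderivs_pair _ oN) // E.
Unshelve. all: by end_near. Qed.

End Flat.

(** * Order of vanishing at the boundary *)

Section Order.
Variable R : realType.
Local Notation plane := (plane R).
Implicit Types (f g G : plane -> R) (p q : plane) (O : set plane).

Lemma is_derive_pow n (x : R) :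
  is_derive x 1 (fun y : R => y ^+ n) (n%:R * x ^+ n.-1).
Proof.
have := @is_deriveX R R id n x 1 1 (is_derive_id _ _).
by rewrite exprfctE [_ *: _]mulr1.
Qed.

(** Integrate the lower bound [k] times from the boundary, by the mean value
    theorem applied to the difference with the power. *)
Lemma taylor_lower k G s d (e m : R) :
  (forall j r, (j < k)%N -> 0 <= r < d ->
     derivable (iter j (pd true) G) (s, r) (axis R true)) ->
  (forall j, (j < k)%N -> iter j (pd true) G (s, 0) = 0) ->
  (forall r, 0 <= r < d -> m <= e * iter k (pd true) G (s, r)) ->
  forall r, 0 <= r < d -> m / k`!%:R * r ^+ k <= e * G (s, r).
Proof.
elim: k G => [|k IH] G hd h0 hm r hr.
  by rewrite fact0 divr1 expr0 mulr1; exact: hm.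
have IH' x : 0 <= x < d -> m / k`!%:R * x ^+ k <= e * pd true G (s, x).
  apply: IH => //.
  - by move=> j y jk hy; rewrite -iterSr; exact: hd.
  - by move=> j jk; rewrite -iterSr; exact: h0.
  - by move=> y hy; rewrite -iterSr; exact: hm.
have /andP[r0 rd] := hr.
pose c := m / k.+1`!%:R.
have [x|x hx] := @mvt R (fun x => e * G (s, x) - c * x ^+ k.+1)
   (fun x => e * pd true G (s, x) - c * (k.+1%:R * x ^+ k)) 0 r.
  rewrite min_l // max_r // => /andP[x0 xr].
  have [] := @is_derive_y _ G s x.
    by apply: (hd 0%N) => //; rewrite x0 (le_lt_trans xr).
  move=> d1 d2.
  apply: is_deriveB.
    by apply: is_deriveZ; split.
  exact/is_deriveZ/(is_derive_pow k.+1).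
rewrite min_l // max_r // in hx.
have := h0 0%N erefl => /= G0; rewrite G0 expr0n /= !mulr0 !subr0 => E.
rewrite -subr_ge0 -/c E; apply: mulr_ge0 => //.
rewrite subr_ge0; have /andP[x0 xr] := hx.
have := IH' x; rewrite x0 (le_lt_trans xr) // => /(_ isT); apply: le_trans.
rewrite /c factS natrM le_eqVlt; apply/orP; left; apply/eqP; field.
by rewrite nat1r !pnatr_eq0 /= -lt0n fact_gt0.
Qed.

Lemma taylor_upper k G s d (M : R) :
  (forall j r, (j < k)%N -> 0 <= r < d ->
     derivable (iter j (pd true) G) (s, r) (axis R true)) ->
  (forall j, (j < k)%N -> iter j (pd true) G (s, 0) = 0) ->
  (forall r, 0 <= r < d -> `|iter k (pd true) G (s, r)| <= M) ->
  forall r, 0 <= r < d -> `|G (s, r)| <= M * r ^+ k.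
Proof.
elim: k G => [|k IH] G hd h0 hm r hr.
  by rewrite expr0 mulr1; exact: hm.
have IH' x : 0 <= x < d -> `|pd true G (s, x)| <= M * x ^+ k.
  apply: IH => //.
  - by move=> j y jk hy; rewrite -iterSr; exact: hd.
  - by move=> j jk; rewrite -iterSr; exact: h0.
  - by move=> y hy; rewrite -iterSr; exact: hm.
have /andP[r0 rd] := hr.
have M0 : 0 <= M by apply: le_trans (hm r hr).
have [x|x hx] := @mvt R (fun x => G (s, x)) (fun x => pd true G (s, x)) 0 r.
  rewrite min_l // max_r // => /andP[x0 xr].
  apply: is_derive_y; apply: (hd 0%N) => //; by rewrite x0 (le_lt_trans xr).
rewrite min_l // max_r // in hx.
have := h0 0%N erefl => /= ->; rewrite !subr0 => ->.
have /andP[x0 xr] := hx.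
rewrite normrM (ger0_norm r0) exprSr mulrA; apply: ler_wpM2r => //.
apply: (le_trans (IH' x _)); first by rewrite x0 (le_lt_trans xr).
by apply: ler_wpM2l => //; apply: lerXn2r.
Qed.

Lemma Cinf_iter O G k : Cinf O G -> Cinf O (iter k (pd true) G).
Proof. by move=> h; elim: k => [//|k IH] /=; exact: Cinf_pd. Qed.

Lemma order_upper O G k t0 : open O -> Cinf O G -> O (t0, 0) ->
  (exists2 d, 0 < d & forall j s, (j < k)%N -> `|s - t0| < d -> iter j (pd true) G (s, 0) = 0) ->
  exists C, \forall q \near ((t0, 0) : plane), 0 <= q.2 -> `|G q| <= C * q.2 ^+ k.
Proof.
move=> oO hG O0 [d d0 h0]; have hk := Cinf_iter k hG.
exists (`|iter k (pd true) G (t0, 0)| + 1).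
have nb := near_bounded (Cn_cont (hk 0%N) O0).
have nO : \forall q \near ((t0, 0) : plane), O q by apply: open_nbhs_nbhs.
have /near_square [d1 d10 H] : \forall q \near ((t0, 0) : plane), O q /\
   `|iter k (pd true) G q| <= `|iter k (pd true) G (t0, 0)| + 1.
  by near=> q; split; near: q.
apply/near_square; exists (Num.min d d1); first by rewrite lt_min d0.
move=> [s r] /=; rewrite subr0 !lt_min => /andP[sd sd1] /andP[_ rd1] r0.
rewrite (ger0_norm r0) in rd1.
have Hsq x : 0 <= x < d1 -> O (s, x) /\
   `|iter k (pd true) G (s, x)| <= `|iter k (pd true) G (t0, 0)| + 1.
  by move=> /andP[x0 xd]; apply: H => //=; rewrite subr0 ger0_norm.
apply: (@taylor_upper k G s d1) => //; last by rewrite r0.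
- move=> j x jk hx; apply: Cn_derivable (Cinf_iter j hG 1%N) _.
  exact: (Hsq x hx).1.
- by move=> j jk; apply: h0.
- by move=> x hx; exact: (Hsq x hx).2.
Unshelve. all: by end_near. Qed.

(** If the normal derivatives of order less than [k] vanish along the boundary and
    that of order [k] does not vanish at [(s, 0)], then it keeps its sign near
    this point, and Taylor bounds from both sides make the function comparable
    with the power [k] of the height. *)
Lemma order_induction O G t0 d : open O -> Cinf O G -> 0 < d ->
  (forall s, `|s - t0| < d -> O (s, 0)) ->
  (forall s, `|s - t0| < d -> G (s, 0) = 0) ->
  (forall s k (e c C : R), `|s - t0| < d -> (0 < k)%N -> `|e| = 1 -> 0 < c ->
    ~ (\forall q \near ((s, 0) : plane), 0 <= q.2 ->
         c * q.2 ^+ k <= e * G q /\ `|G q| <= C * q.2 ^+ k)) ->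
  forall k s, `|s - t0| < d -> iter k (pd true) G (s, 0) = 0.
Proof.
move=> oO hG d0 hO h0 ns k; have [n] := ubnP k; elim: n k => // n IH k.
rewrite ltnS => kn s sd.
case: k kn => [|k] kn; first exact: h0.
set k' := k.+1 in kn *.
apply/eqP; apply/negP => /negP v0.
have Os := hO _ sd.
set v := iter k' (pd true) G (s, 0) in v0.
have hk := Cinf_iter k' hG.
have [d1 d10 hd1] : exists2 d1, 0 < d1 & forall x, `|x - s| < d1 -> `|x - t0| < d.
  exists (d - `|s - t0|); first by rewrite subr_gt0.
  move=> x hx; rewrite -[x](subrK s) -addrA; apply: (le_lt_trans (ler_normD _ _)).
  lra.
have low j x : (j < k')%N -> `|x - s| < d1 -> iter j (pd true) G (x, 0) = 0.
  by move=> jk hx; apply: IH; [exact: leq_trans jk kn|exact: hd1].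
have [C nC] : exists C, \forall q \near ((s, 0) : plane), 0 <= q.2 -> `|G q| <= C * q.2 ^+ k'.
  by apply: (order_upper oO hG Os); exists d1.
have nO : \forall q \near ((s, 0) : plane), O q by apply: open_nbhs_nbhs.
(* the sign of the first normal derivative that does not vanish *)
pose e := Num.sg v.
have e1 : `|e| = 1 by rewrite normr_sg v0.
have ev : e * v = `|v| by rewrite /e -normrEsg.
pose m := `|v| / 2.
have m0 : 0 < m by rewrite divr_gt0 // normr_gt0.
have nl : \forall q \near ((s, 0) : plane), m <= e * iter k' (pd true) G q.
  have /cvgrPdist_lt /(_ _ m0) h := Cn_cont (hk 0%N) Os.
  near=> q; have : `|v - iter k' (pd true) G q| < m by near: q.
  move=> h1; have : `|e * (v - iter k' (pd true) G q)| < m by rewrite normrM e1 mul1r.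
  rewrite mulrBr ev ltr_norml /m => /andP[]; lra.
apply: (ns s k' e (m / k'`!%:R) C) => //.
  by rewrite divr_gt0 // ltr0n fact_gt0.
have /near_square [d2 d20 H] : \forall q \near ((s, 0) : plane), O q /\ m <= e * iter k' (pd true) G q.
  by near=> q; split; near: q.
have nsq : \forall q \near ((s, 0) : plane), 0 <= q.2 -> m / k'`!%:R * q.2 ^+ k' <= e * G q.
  apply/near_square; exists (Num.min d1 d2); first by rewrite lt_min d10.
  move=> [x r] /=; rewrite subr0 !lt_min => /andP[xd xd2] /andP[_ rd] r0.
  rewrite (ger0_norm r0) in rd.
  have Hsq y : 0 <= y < d2 -> O (x, y) /\ m <= e * iter k' (pd true) G (x, y).
    by move=> /andP[y0 yd]; apply: H => //=; rewrite subr0 ger0_norm.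
  apply: (@taylor_lower k' G x d2) => //; last by rewrite r0.
  - move=> j y jk hy; apply: Cn_derivable (Cinf_iter j hG 1%N) _.
    exact: (Hsq y hy).1.
  - by move=> j jk; apply: low.
  - by move=> y hy; exact: (Hsq y hy).2.
near=> q => q0; split; first by apply: (near nsq).
exact: (near nC).
Unshelve. all: by end_near. Qed.

(** [f] vanishes on the axis and its vertical derivative is between half and
    twice its value at [(t0, 0)]. *)
Lemma comparable_height O f t0 : open O -> Cn 1 O f -> O (t0, 0) ->
  (exists2 d, 0 < d & forall s, `|s - t0| < d -> f (s, 0) = 0) ->
  0 < pd true f (t0, 0) ->
  exists m M, [/\ 0 < m, 0 < M & \forall q \near ((t0, 0) : plane),
    (0 <= q.2 -> m * q.2 <= f q <= M * q.2) /\ (q.2 < 0 -> f q < 0)].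
Proof.
move=> oO hf O0 [d d0 h0] v0; set v := pd true f (t0, 0) in v0.
exists (v / 2), (2 * v); split; [by rewrite divr_gt0|by rewrite mulr_gt0|].
have v2 : 0 < v / 2 by rewrite divr_gt0.
have nO : \forall q \near ((t0, 0) : plane), O q by apply: open_nbhs_nbhs.
have /near_square [d1 d10 H] : \forall q \near ((t0, 0) : plane), O q /\ v / 2 <= pd true f q <= 2 * v.
  have /cvgrPdist_lt /(_ _ v2) h := Cn_cont (Cn_pd true hf) O0.
  near=> q; split; first by near: q.
  have : `|v - pd true f q| < v / 2 by near: q.
  by rewrite ltr_norml => /andP[]; lra.
apply/near_square; exists (Num.min d d1); first by rewrite lt_min d0.
move=> [s r] /=; rewrite subr0 !lt_min => /andP[sd sd1] /andP[_ rd].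
have [x hx|x hx] := @mvt R (fun x => f (s, x)) (fun x => pd true f (s, x)) 0 r.
  apply: is_derive_y; apply: Cn_derivable hf _.
  apply: (H (s, x) _ _).1 => //=; rewrite subr0; apply: le_lt_trans rd.
  move: hx; rewrite ge_min le_max => /andP[/orP[] h1 /orP[] h2];
  by rewrite ler_norml ?normr0; case: (lerP 0 r) => r0; rewrite ?(ger0_norm r0) ?(ltr0_norm r0); lra.
rewrite h0 // !subr0 => ->.
have [_ /andP[a1 a2]] : O (s, x) /\ v / 2 <= pd true f (s, x) <= 2 * v.
  apply: H => //=; rewrite subr0; apply: le_lt_trans rd.
  move: hx; rewrite ge_min le_max => /andP[/orP[] h1 /orP[] h2];
  by rewrite ler_norml ?normr0; case: (lerP 0 r) => r0; rewrite ?(ger0_norm r0) ?(ltr0_norm r0); lra.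
split=> r0; first by rewrite !ler_wpM2r.
by rewrite pmulr_rlt0 //; lra.
Unshelve. all: by end_near. Qed.

(** [order_induction] in the coordinates [x1, x2], in which the boundary is the
    horizontal axis. The bounds pass from the height to [f1] and back because
    both are comparable near the boundary; the chart being open, its image
    contains a neighborhood of the boundary point. *)
Lemma chart_flat (t0 d : R) (Ox : set plane) (x1 x2 : plane -> R) O f1 f2 :
  let X q := (x1 q, x2 q) in
  0 < d -> open Ox -> Cinf Ox x1 -> Cinf Ox x2 ->
  open O -> Cinf O f1 -> Cinf O f2 -> (forall q, Ox q -> O (X q)) ->
  (forall s, `|s - t0| < d -> Ox (s, 0)) ->
  (forall s, `|s - t0| < d -> f1 (X (s, 0)) = 0) ->
  (forall s, `|s - t0| < d -> 0 < pd true (f1 \o X) (s, 0)) ->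
  (forall s, `|s - t0| < d -> djac f1 f2 (X (s, 0)) = 0) ->
  (forall s (W : set plane), `|s - t0| < d -> nbhs ((s, 0) : plane) W ->
     nbhs (X (s, 0)) (X @` W)) ->
  (forall s k (e c C : R), `|s - t0| < d -> (0 < k)%N -> `|e| = 1 -> 0 < c ->
    ~ (\forall q \near X (s, 0), 0 <= f1 q ->
         c * f1 q ^+ k <= e * djac f1 f2 q /\ `|djac f1 f2 q| <= C * f1 q ^+ k)) ->
  flat_at (X (t0, 0)) f1 (djac f1 f2).
Proof.
move=> X d0 oOx hx1 hx2 oO h1 h2 hX hOx f0 fp D0 op ns.
have hD : Cinf O (djac f1 f2).
  by move=> n; apply: CnB => //; apply: CnM => //; exact: Cn_pd.
have hG : Cinf Ox (djac f1 f2 \o X) by move=> n; exact: (Cn_comp oO oOx).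
have hF : Cinf Ox (f1 \o X) by move=> n; exact: (Cn_comp oO oOx).
have sub s : `|s - t0| < d -> exists2 d1, 0 < d1 & forall x, `|x - s| < d1 -> `|x - t0| < d.
  move=> sd; exists (d - `|s - t0|); first by rewrite subr_gt0.
  move=> x hx; rewrite -[x](subrK s) -addrA; apply: (le_lt_trans (ler_normD _ _)).
  lra.
have cmp s : `|s - t0| < d -> exists m M, [/\ 0 < m, 0 < M & \forall q \near ((s, 0) : plane),
    (0 <= q.2 -> m * q.2 <= f1 (X q) <= M * q.2) /\ (q.2 < 0 -> f1 (X q) < 0)].
  move=> sd; apply: (comparable_height oOx (hF 1%N)); [exact: hOx| |exact: fp].
  by have [d1 d10 hd1] := sub _ sd; exists d1 => // x hx; apply: f0; exact: hd1.
have transfer s k C : `|s - t0| < d ->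
    (\forall q \near ((s, 0) : plane), 0 <= q.2 -> `|djac f1 f2 (X q)| <= C * q.2 ^+ k) ->
    exists C', \forall q \near X (s, 0), 0 <= f1 q -> `|djac f1 f2 q| <= C' * f1 q ^+ k.
  move=> sd nC; have [m [M [m0 M0 nm]]] := cmp s sd.
  exists (`|C| / m ^+ k).
  have /(op s _ sd) : nbhs ((s, 0) : plane) [set q | (0 <= q.2 -> `|djac f1 f2 (X q)| <= C * q.2 ^+ k) /\
     ((0 <= q.2 -> m * q.2 <= f1 (X q) <= M * q.2) /\ (q.2 < 0 -> f1 (X q) < 0))].
    by near=> q; split; near: q.
  apply: filterS => _ [q [a1 [a2 a3]] <-] fq.
  have q0 : 0 <= q.2 by rewrite leNgt; apply/negP => /a3; lra.
  apply: (le_trans (a1 q0)); have /andP[a4 a5] := a2 q0.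
  have mk : 0 < m ^+ k by exact: exprn_gt0.
  apply: (@le_trans _ _ (`|C| * q.2 ^+ k)).
    by apply: ler_wpM2r; [exact: exprn_ge0|exact: ler_norm].
  rewrite -mulrA; apply: ler_wpM2l => //.
  rewrite mulrC ler_pdivlMr // -exprMn mulrC; apply: lerXn2r => //; rewrite nnegrE //.
  by apply: mulr_ge0 => //; exact: ltW.
have ord := @order_induction Ox (djac f1 f2 \o X) t0 d oOx hG d0 hOx D0.
have {}ord : forall k s, `|s - t0| < d -> iter k (pd true) (djac f1 f2 \o X) (s, 0) = 0.
  apply: ord => s k e c C sd k0 e1 c0 nb.
  have [m [M [m0 M0 nm]]] := cmp s sd.
  have [C' nC'] : exists C', \forall q \near X (s, 0), 0 <= f1 q -> `|djac f1 f2 q| <= C' * f1 q ^+ k.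
    by apply: (transfer s k C sd); near=> q => q0; have [] := near nb q _ q0.
  have Mk : 0 < M ^+ k by exact: exprn_gt0.
  apply: (ns s k e (c / M ^+ k) C' sd k0 e1); first by rewrite divr_gt0.
  have n2 : \forall q \near X (s, 0), 0 <= f1 q -> c / M ^+ k * f1 q ^+ k <= e * djac f1 f2 q.
    have /(op s _ sd) : nbhs ((s, 0) : plane) [set q | (0 <= q.2 -> c * q.2 ^+ k <= e * djac f1 f2 (X q)) /\
       ((0 <= q.2 -> m * q.2 <= f1 (X q) <= M * q.2) /\ (q.2 < 0 -> f1 (X q) < 0))].
      near=> q; split; last by near: q.
      by move=> q0; have [] := near nb q _ q0.
    apply: filterS => _ [q [a1 [a2 a3]] <-] fq.
    have q0 : 0 <= q.2 by rewrite leNgt; apply/negP => /a3; lra.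
    apply: le_trans (a1 q0); have /andP[a4 a5] := a2 q0.
    rewrite -mulrA; apply: ler_wpM2l; first exact: ltW.
    rewrite mulrC ler_pdivrMr // mulrC -exprMn; apply: lerXn2r => //; rewrite nnegrE //.
    by apply: mulr_ge0 => //; exact: ltW.
  near=> q => fq; split; first by apply: (near n2).
  by apply: (near nC').
move=> n; have t00 : `|t0 - t0| < d by rewrite subrr normr0.
have [|C nC] := @order_upper Ox _ n t0 oOx hG (hOx _ t00).
  by exists d => // j s _ sd; apply: ord.
have [C' nC'] := transfer t0 n C t00 nC.
exists C'; near=> q => fq; apply: (near nC') => //; exact: ltW.
Unshelve. all: by end_near. Qed.

End Order.

(** * Leaves as graphs *)

Section Implicit.
Variable R : realType.
Local Notation plane := (plane R).
Implicit Types (f g F : plane -> R) (p q c : plane) (O : set plane).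

Lemma rect_le p q r d c :
  `|p.1 - c.1| <= d -> `|q.1 - c.1| <= d -> rect p q r -> `|r.1 - c.1| <= d.
Proof.
rewrite !ler_norml => /andP[a1 a2] /andP[a3 a4] [].
rewrite !ge_min !le_max => /andP[/orP h1 /orP h2] _.
by apply/andP; split; case: h1; case: h2; lra.
Qed.

Lemma rect_le2 p q r d c :
  `|p.2 - c.2| <= d -> `|q.2 - c.2| <= d -> rect p q r -> `|r.2 - c.2| <= d.
Proof.
rewrite !ler_norml => /andP[a1 a2] /andP[a3 a4] [] _.
rewrite !ge_min !le_max => /andP[/orP h1 /orP h2].
by apply/andP; split; case: h1; case: h2; lra.
Qed.

Lemma lipschitz_within (g : R -> R) (a b K : R) :
  (forall x y, a <= x <= b -> a <= y <= b -> `|g x - g y| <= K * `|x - y|) ->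
  {within `[a, b], continuous g}.
Proof.
move=> H; apply/subspace_continuousP => x; rewrite /= in_itv /= => xab.
apply/cvgrPdist_le => e e0.
have K0 : 0 < `|K| + 1 by rewrite ltr_wpDl.
rewrite near_withinE; apply/near_interval; exists (e / (`|K| + 1)); first by rewrite divr_gt0.
move=> y; rewrite ltr_pdivlMr // => yx; rewrite /= in_itv /= => yab.
apply: (le_trans (H _ _ xab yab)); rewrite distrC; apply/ltW/(le_lt_trans _ yx).
rewrite mulrC; apply: ler_wpM2l => //; apply: (le_trans (ler_norm K)); lra.
Qed.

(** The implicit function theorem for a level curve, on a box given in advance:
    the size of the graph must not depend on the level [u], which tends to
    zero in the applications. *)
Lemma leaf_graph O F c (al be m K u : R) : Cn 1 O F ->
  0 <= al -> 0 <= be -> 0 < m ->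
  (forall q, `|q.1 - c.1| <= al -> `|q.2 - c.2| <= be ->
     [/\ O q, m <= pd true F q & `|pd false F q| <= K]) ->
  (forall a, `|a - c.1| <= al -> `|F (a, c.2) - u| <= m * be) ->
  exists rho : R -> R,
   [/\ forall a, `|a - c.1| <= al -> `|rho a - c.2| <= be /\ F (a, rho a) = u,
       forall a b, `|a - c.1| <= al -> `|b - c.2| <= be -> F (a, b) = u -> b = rho a,
       forall a a', `|a - c.1| <= al -> `|a' - c.1| <= al ->
         `|rho a - rho a'| <= K / m * `|a - a'| &
       forall a, `|a - c.1| < al ->
         is_derive a 1 rho (- (pd false F (a, rho a) / pd true F (a, rho a)))].
Proof.
move=> hF al0 be0 m0 Hbox Hu.
have mv p q : `|p.1 - c.1| <= al -> `|p.2 - c.2| <= be ->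
    `|q.1 - c.1| <= al -> `|q.2 - c.2| <= be ->
    exists x y, [/\ rect p q x, rect p q y,
      m <= pd true F y, `|pd false F x| <= K &
      F q - F p = pd false F x * (q.1 - p.1) + pd true F y * (q.2 - p.2)].
  move=> p1 p2 q1 q2; have [r b hr|x [y [hx hy E]]] := @mvt2 R F p q.
    have [Or _ _] := Hbox r (rect_le p1 q1 hr) (rect_le2 p2 q2 hr).
    exact: Cn_derivable hF Or.
  exists x, y; split => //.
    by have [] := Hbox y (rect_le p1 q1 hy) (rect_le2 p2 q2 hy).
  by have [] := Hbox x (rect_le p1 q1 hx) (rect_le2 p2 q2 hx).
have ex a : exists b, `|a - c.1| <= al -> `|b - c.2| <= be /\ F (a, b) = u.
  have [ha|na] := boolP (`|a - c.1| <= al); last by exists 0.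
  have hu := Hu _ ha; move: hu; rewrite ler_norml => /andP[hu1 hu2].
  have bc : `|c.2 - c.2| <= be by rewrite subrr normr0.
  have bp : `|c.2 + be - c.2| <= be by rewrite addrAC subrr add0r ger0_norm.
  have bm : `|c.2 - be - c.2| <= be by rewrite addrAC subrr add0r normrN ger0_norm.
  have [x [y [_ _ h1 _ E1]]] := mv (a, c.2) (a, c.2 + be) ha bc ha bp.
  have [x' [y' [_ _ h2 _ E2]]] := mv (a, c.2 - be) (a, c.2) ha bm ha bc.
  rewrite /= subrr mulr0 add0r in E1; rewrite /= subrr mulr0 add0r in E2.
  have k1 : m * be <= pd true F y * be by apply: ler_wpM2r.
  have k2 : m * be <= pd true F y' * be by apply: ler_wpM2r.
  have [|||b] := @IVT R (fun b => F (a, b)) (c.2 - be) (c.2 + be) u.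
  - by lra.
  - apply: derivable_within_continuous => b; rewrite in_itv /= => hb.
    have [||Ob _ _] := Hbox (a, b); rewrite //= ?ler_norml; try lra; try exact: ha.
    by have [] := is_derive_y (Cn_derivable (b := true) hF Ob).
  - apply/andP; split; rewrite ?ge_min ?le_max; apply/orP; [left|right];
    lra.
  - rewrite in_itv /= => hb E; exists b => _; split => //; rewrite ler_norml; lra.
have [rho hrho] := choice ex.
have lip a a' : `|a - c.1| <= al -> `|a' - c.1| <= al ->
    `|rho a - rho a'| <= K / m * `|a - a'|.
  move=> ha ha'; have [r1 e1] := hrho _ ha; have [r2 e2] := hrho _ ha'.
  have [x [y [_ _ h1 h2 E]]] := mv (a, rho a) (a', rho a') ha r1 ha' r2.
  rewrite e1 e2 subrr /= in E.
  have E' : pd true F y * (rho a - rho a') = pd false F x * (a' - a) by lra.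
  rewrite mulrAC ler_pdivlMr //; apply: (@le_trans _ _ `|pd true F y * (rho a - rho a')|).
    by rewrite normrM mulrC; apply: ler_wpM2r => //; rewrite ger0_norm // (le_trans _ h1) // ltW.
  by rewrite E' normrM (distrC a'); apply: ler_wpM2r.
exists rho; split => //.
- move=> a b ha hb E; have [r1 e1] := hrho _ ha.
  have [x [y [_ _ h1 _ E']]] := mv (a, b) (a, rho a) ha hb ha r1.
  move: E'; rewrite E e1 /= !subrr mulr0 add0r => /esym/eqP.
  rewrite mulf_eq0 => /orP[/eqP h|]; first by lra.
  by rewrite subr_eq0 => /eqP.
- move=> a ha; have ha' := ltW ha; have [r1 e1] := hrho _ ha'.
  have [Oa mb Kb] := Hbox (a, rho a) ha' r1.
  set A0 := pd false F (a, rho a); set B0 := pd true F (a, rho a).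
  have B0p : 0 < B0 by rewrite (lt_le_trans m0).
  have K0 : 0 <= K by rewrite (le_trans _ Kb).
  have Km : 0 < 1 + K / m by rewrite ltr_pwDl // divr_ge0 // ltW.
  apply/is_derive_cvg; apply/cvgrPdist_le => e e0.
  pose e' := e * m / (1 + K / m).
  have e'0 : 0 < e' by rewrite divr_gt0 // mulr_gt0.
  have /near_square[d d0 Hd] : \forall q \near ((a, rho a) : plane),
     `|A0 - pd false F q| <= e' /\ `|B0 - pd true F q| <= e'.
    have /cvgrPdist_le/(_ _ e'0) h1 := Cn_cont (Cn_pd false hF) Oa.
    have /cvgrPdist_le/(_ _ e'0) h2 := Cn_cont (Cn_pd true hF) Oa.
    exact: near_and h1 h2.
  rewrite near_withinE; apply/near_interval.
  exists (Num.min (al - `|a - c.1|) (d / (1 + K / m))).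
    by rewrite lt_min subr_gt0 ha /= divr_gt0.
  move=> h; rewrite subr0 lt_min => /andP[h1 h2] /= hn0.
  have hah : `|h + a - c.1| <= al.
    by rewrite -addrA; apply: (le_trans (ler_normD _ _)); lra.
  have [r2 e2] := hrho _ hah.
  have [x [y [hx hy _ _ E]]] := mv (a, rho a) (h + a, rho (h + a)) ha' r1 hah r2.
  rewrite ltr_pdivlMr // in h2.
  have hd : `|h| < d by apply: le_lt_trans h2; rewrite ler_peMr // lerDl divr_ge0 // ltW.
  have lk := lip _ _ hah ha'; rewrite addrK in lk.
  have kd : `|rho (h + a) - rho a| < d.
    apply: (le_lt_trans lk); apply: le_lt_trans h2.
    by rewrite mulrC; apply: ler_wpM2l => //; rewrite lerDr.
  have sq z : rect (a, rho a) (h + a, rho (h + a)) z -> `|z.1 - a| < d /\ `|z.2 - rho a| < d.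
    by move=> hz; apply: (@rect_square R _ _ _ d (a, rho a) _ _ _ _ hz) => //=; rewrite ?subrr ?normr0 ?addrK.
  have [x1 _] := Hd x (sq _ hx).1 (sq _ hx).2.
  have [_ y1] := Hd y (sq _ hy).1 (sq _ hy).2.
  rewrite e1 e2 subrr /= addrK in E.
  rewrite /shift /= [h *: 1]mulr1.
  set k := rho (h + a) - rho a in E lk kd *.
  have n0 : 0 < `|h| by rewrite normr_gt0.
  have -> : - (A0 / B0) - h^-1 *: k = - ((A0 - pd false F x) * h + (B0 - pd true F y) * k) / (h * B0).
    rewrite /GRing.scale /=; have -> : (A0 - pd false F x) * h + (B0 - pd true F y) * k = A0 * h + B0 * k.
      by rewrite -[RHS]subr0 E; ring.
    by field; rewrite hn0 gt_eqF.
  rewrite normrM normfV normrN ler_pdivrMr; last by rewrite normr_gt0 mulf_neq0 // gt_eqF.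
  apply: (le_trans (ler_normD _ _)); rewrite !normrM (gtr0_norm B0p).
  apply: (@le_trans _ _ (e' * `|h| + e' * (K / m * `|h|))).
    by apply: lerD; apply: ler_pM.
  have -> : e' * `|h| + e' * (K / m * `|h|) = e * (`|h| * m).
    by rewrite /e'; field; rewrite !gt_eqF // ltr_pwDl.
  by apply: ler_wpM2l; [exact: ltW|apply: ler_wpM2l].
Unshelve. all: by end_near. Qed.

(** Along the graph the derivative of [F2] is [- djac F1 F2 / pd true F1]. *)
Lemma leaf_variation O F1 F2 (rho : R -> R) (a a' : R) : open O -> Cn 1 O F1 -> Cn 1 O F2 ->
  (forall x, Num.min a a' <= x <= Num.max a a' -> [/\ O (x, rho x), pd true F1 (x, rho x) != 0 &
     is_derive x 1 rho (- (pd false F1 (x, rho x) / pd true F1 (x, rho x)))]) ->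
  exists2 x, Num.min a a' <= x <= Num.max a a' &
    F2 (a', rho a') - F2 (a, rho a) =
      - (djac F1 F2 (x, rho x) / pd true F1 (x, rho x)) * (a' - a).
Proof.
move=> oO h1 h2 H.
pose dg x := 1 * pd false F2 (x, rho x) + - (pd false F1 (x, rho x) / pd true F1 (x, rho x)) * pd true F2 (x, rho x).
have [x hx|x hx E] := @mvt R (fun x => F2 (x, rho x)) dg a a'.
  have [Ox nz dr] := H _ hx.
  by apply: (@chain_curve R O F2 (fun x => x) rho) => //; exact: is_derive_id.
exists x => //; rewrite E; congr (_ * _); rewrite /dg /djac.
by have [_ nz _] := H _ hx; field.
Qed.

End Implicit.

(** * The inverse function theorem in the plane *)

Section Inverse.
Variable R : realType.
Local Notation plane := (plane R).
Implicit Types (f g F P Q : plane -> R) (p q c : plane) (O N : set plane).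

Lemma pd_cvg (T : Type) (FF : set_system T) {FFF : Filter FF} (h : T -> plane) F p :
  {for p, continuous F} -> h @ FF --> p -> (F \o h) @ FF --> F p.
Proof. by move=> cF hp; exact: cvg_comp hp cF. Qed.

Lemma near_neq0 F p : {for p, continuous F} -> F p != 0 -> \forall q \near p, F q != 0.
Proof.
move=> cF F0; apply: (cF (fun x => x != 0)); apply: open_nbhs_nbhs; split => //.
Qed.

Lemma square_open c d : open [set q : plane | `|q.1 - c.1| < d /\ `|q.2 - c.2| < d].
Proof.
rewrite openE => q /= [q1 q2]; apply/near_square.
exists (Num.min (d - `|q.1 - c.1|) (d - `|q.2 - c.2|)).
  by rewrite lt_min !subr_gt0 q1.
move=> r; rewrite !lt_min => /andP[r1 _] /andP[_ r2].
have tr (x y z : R) : `|x - y| < d - `|y - z| -> `|x - z| < d.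
  by move=> h; rewrite -[x](subrK y) -addrA; apply: (le_lt_trans (ler_normD _ _)); lra.
by split; [apply: tr r1|apply: tr r2].
Qed.

(** On a small square both partial differentials are within 1/4 of the
    identity, so the map is injective with a Lipschitz inverse. A preimage of
    [y] is found on the level curve [Q = y.2], a graph by [leaf_graph], by the
    intermediate value theorem for [P] along it. The difference quotients
    of the inverse solve a linear system with coefficients tending to the
    partial derivatives of [P] and [Q]; Cramer's formula then expresses the
    derivatives of the inverse through the inverse, whence smoothness by
    induction. *)
Lemma inverse_near_id O P Q c : open O -> O c -> Cinf O P -> Cinf O Q ->
  pd false P c = 1 -> pd true P c = 0 -> pd false Q c = 0 -> pd true Q c = 1 ->
  exists N (th1 th2 : plane -> R),
    [/\ open N /\ N (P c, Q c), Cinf N th1, Cinf N th2,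
       forall y, N y -> O (th1 y, th2 y) /\ (P (th1 y, th2 y), Q (th1 y, th2 y)) = y &
       \forall q \near c, N (P q, Q q) /\ (th1 (P q, Q q), th2 (P q, Q q)) = q].
Proof.
move=> oO Oc hP hQ Pa Pb Qa Qb.
have nO : \forall q \near c, O q by apply: open_nbhs_nbhs.
have [ep epE] : exists x : R, x = 4^-1 by exists 4^-1.
have ep0 : 0 < ep by rewrite epE invr_gt0.
have nF F i : Cinf O F -> \forall q \near c, `|pd i F c - pd i F q| < ep.
  by move=> hF; move/cvgrPdist_lt : (Cn_cont (Cn_pd i (hF 1%N)) Oc); exact.
have nall : \forall q \near c, [/\ O q,
   `|1 - pd false P q| < ep, `|0 - pd true P q| < ep,
   `|0 - pd false Q q| < ep & `|1 - pd true Q q| < ep].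
  have := near_and nO (near_and (near_and (nF P false hP) (nF P true hP)) (near_and (nF Q false hQ) (nF Q true hQ))).
  rewrite Pa Pb Qa Qb; apply: filterS => q [Oq [[a1 a2] [a3 a4]]].
  exact: And5 Oq a1 a2 a3 a4.
have /near_square[d0 d00 H0] : \forall q \near c, [/\ O q,
   `|1 - pd false P q| < 4^-1, `|pd true P q| < 4^-1,
   `|pd false Q q| < 4^-1 & `|1 - pd true Q q| < 4^-1].
  by apply: filterS nall => q; rewrite !sub0r !normrN epE.
pose d := d0 / 2.
have dp : 0 < d by rewrite divr_gt0.
have H q : `|q.1 - c.1| <= d -> `|q.2 - c.2| <= d -> [/\ O q,
   `|1 - pd false P q| < 4^-1, `|pd true P q| < 4^-1,
   `|pd false Q q| < 4^-1 & `|1 - pd true Q q| < 4^-1].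
  have dd : d < d0 by rewrite /d ltr_pdivrMr // ltr_pMr // ltr1n.
  by move=> h1 h2; apply: H0; exact: le_lt_trans dd.
pose sq q := `|q.1 - c.1| <= d /\ `|q.2 - c.2| <= d.
have mv F p q : Cinf O F -> sq p -> sq q -> exists x y, [/\ rect p q x, rect p q y, sq x, sq y &
      F q - F p = pd false F x * (q.1 - p.1) + pd true F y * (q.2 - p.2)].
  move=> hF [p1 p2] [q1 q2]; have [r b hr|x [y [hx hy E]]] := @mvt2 R F p q.
    have [Or _ _ _ _] := H r (rect_le p1 q1 hr) (rect_le2 p2 q2 hr).
    exact: Cn_derivable (hF 1%N) Or.
  exists x, y; split => //.
    by split; [exact: rect_le p1 q1 hx|exact: rect_le2 p2 q2 hx].
  by split; [exact: rect_le p1 q1 hy|exact: rect_le2 p2 q2 hy].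
have lower p q : sq p -> sq q ->
   `|q.1 - p.1| + `|q.2 - p.2| <= 2 * (`|P q - P p| + `|Q q - Q p|).
  move=> hp hq.
  have [x [y [_ _ [x1 x2] [y1 y2] EP]]] := mv P p q hP hp hq.
  have [x' [y' [_ _ [x1' x2'] [y1' y2'] EQ]]] := mv Q p q hQ hp hq.
  have [_ a1 _ _ _] := H _ x1 x2; have [_ _ a2 _ _] := H _ y1 y2.
  have [_ _ _ a3 _] := H _ x1' x2'; have [_ _ _ _ a4] := H _ y1' y2'.
  set u := q.1 - p.1 in EP EQ *; set v := q.2 - p.2 in EP EQ *.
  have b1 : `|u| <= `|P q - P p| + 4^-1 * `|u| + 4^-1 * `|v|.
    have {1}-> : u = (P q - P p) + (1 - pd false P x) * u - pd true P y * v by rewrite EP; ring.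
    apply: (le_trans (ler_normB _ _)); apply: lerD; last by rewrite normrM; apply: ler_wpM2r => //; exact: ltW.
    by apply: (le_trans (ler_normD _ _)); apply: lerD => //; rewrite normrM; apply: ler_wpM2r => //; exact: ltW.
  have b2 : `|v| <= `|Q q - Q p| + 4^-1 * `|v| + 4^-1 * `|u|.
    have {1}-> : v = (Q q - Q p) + (1 - pd true Q y') * v - pd false Q x' * u by rewrite EQ; ring.
    apply: (le_trans (ler_normB _ _)); apply: lerD; last by rewrite normrM; apply: ler_wpM2r => //; exact: ltW.
    by apply: (le_trans (ler_normD _ _)); apply: lerD => //; rewrite normrM; apply: ler_wpM2r => //; exact: ltW.
  by move: b1 b2; clear; lra.
pose N := [set y : plane | `|y.1 - P c| < d / 4 /\ `|y.2 - Q c| < d / 4].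
have oN : open N by exact: (@square_open (P c, Q c) (d / 4)).
have cc : sq c by rewrite /sq !subrr normr0; split; exact: ltW.
(* the preimage is searched on the curve [Q = y.2] *)
have ex y : exists q, N y -> sq q /\ (P q, Q q) = y.
  have [[y1 y2]|] := pselect (N y); last by exists c.
  have [|||||rho [hr _ lip _]] := @leaf_graph R O Q c d d (3 / 4) (4^-1) y.2 (hQ 1%N); try exact: ltW.
  - by rewrite divr_gt0.
  - move=> q q1 q2; have [Oq _ _ h1 h2] := H _ q1 q2; split => //; last exact: ltW.
    by move: h2; rewrite ltr_norml => /andP[]; clear; lra.
  - move=> a ha.
    have sa : sq (a, c.2) by split => //=; rewrite subrr normr0 ltW.
    have [x' [z' [_ _ [x1' x2'] _ EQ]]] := mv Q c (a, c.2) hQ cc sa.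
    have [_ _ _ a3 _] := H _ x1' x2'.
    rewrite /= subrr mulr0 addr0 in EQ.
    have : `|Q (a, c.2) - Q c| <= 4^-1 * d by rewrite EQ normrM; apply: ler_pM => //; exact: ltW.
    have -> : Q (a, c.2) - y.2 = (Q (a, c.2) - Q c) - (y.2 - Q c) by ring.
    have y2' : `|y.2 - Q c| < d / 4 by [].
    move=> h; apply: (le_trans (ler_normB _ _)); move: h y2' dp; clear; lra.
  have sr a : `|a - c.1| <= d -> sq (a, rho a) by move=> ha; split => //=; have [] := hr _ ha.
  have Pe a : `|a - c.1| <= d -> `|P (a, rho a) - P c - (a - c.1)| <= 4^-1 * d + 4^-1 * d.
    move=> ha; have [x [z [_ _ [x1 x2] [z1 z2] EP]]] := mv P c (a, rho a) hP cc (sr _ ha).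
    have [_ a1 _ _ _] := H _ x1 x2; have [_ _ a2 _ _] := H _ z1 z2.
    rewrite EP /=.
    have -> : pd false P x * (a - c.1) + pd true P z * (rho a - c.2) - (a - c.1) =
      - ((1 - pd false P x) * (a - c.1)) + pd true P z * (rho a - c.2) by ring.
    apply: (le_trans (ler_normD _ _)); apply: lerD; rewrite ?normrN normrM; apply: ler_pM => //; try exact: ltW.
    by have [] := hr _ ha.
  have [|||a] := @IVT R (fun a => P (a, rho a)) (c.1 - d) (c.1 + d) y.1.
  - by move: dp; clear; lra.
  - apply: (@lipschitz_within _ _ _ _ (2 + 4^-1 / (3 / 4))) => a a' h h'.
    have ha : `|a - c.1| <= d by rewrite ler_norml; move: h; clear; lra.
    have ha' : `|a' - c.1| <= d by rewrite ler_norml; move: h'; clear; lra.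
    have [x [z [_ _ [x1 x2] [z1 z2] EP]]] := mv P (a', rho a') (a, rho a) hP (sr _ ha') (sr _ ha).
    have [_ a1 _ _ _] := H _ x1 x2; have [_ _ a2 _ _] := H _ z1 z2.
    rewrite EP /= mulrDl; apply: (le_trans (ler_normD _ _)); apply: lerD; rewrite normrM.
      by apply: ler_wpM2r => //; move: a1; rewrite ltr_norml => /andP[]; rewrite ler_norml; clear; lra.
    apply: le_trans (lip _ _ ha ha'); rewrite ler_piMl //; move: a2; clear; lra.
  - have hl : `|c.1 - d - c.1| <= d by rewrite addrAC subrr add0r normrN ger0_norm // ltW.
    have hr' : `|c.1 + d - c.1| <= d by rewrite addrAC subrr add0r ger0_norm // ltW.
    have := Pe _ hl; have := Pe _ hr'; rewrite !ler_norml => /andP[u1 u2] /andP[u3 u4].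
    have : `|y.1 - P c| < d / 4 by []; rewrite ltr_norml => /andP[u5 u6].
    rewrite ge_min le_max; apply/andP; split; apply/orP; [left|right]; move: u1 u2 u3 u4 u5 u6; clear; lra.
  - rewrite in_itv /= => ha E; have ha' : `|a - c.1| <= d by rewrite ler_norml; lra.
    exists (a, rho a) => _; split; first exact: sr.
    by rewrite E (hr _ ha').2 -surjective_pairing.
have [th hth] := choice ex.
have thd y z : N y -> N z ->
   `|(th y).1 - (th z).1| + `|(th y).2 - (th z).2| <= 2 * (`|y.1 - z.1| + `|y.2 - z.2|).
  move=> Ny Nz; have [s1 e1] := hth _ Ny; have [s2 e2] := hth _ Nz.
  apply: (le_trans (lower _ _ s2 s1)).
  rewrite (congr1 fst e1 : P _ = _) (congr1 snd e1 : Q _ = _).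
  by rewrite (congr1 fst e2 : P _ = _) (congr1 snd e2 : Q _ = _).
have thc y : N y -> {for y, continuous th}.
  move=> Ny; rewrite /prop_for /continuous_at; apply/cvg_ballP => e e0.
  have nN : \forall z \near y, N z by apply: open_nbhs_nbhs.
  have e4' : 0 < e / 4 by rewrite divr_gt0.
  have nd : \forall z \near y, `|z.1 - y.1| < e / 4 /\ `|z.2 - y.2| < e / 4.
    by apply/near_square; exists (e / 4).
  near=> z; have Nz : N z by near: z.
  have [z1 z2] : `|z.1 - y.1| < e / 4 /\ `|z.2 - y.2| < e / 4 by near: z.
  have h := thd _ _ Nz Ny.
  have p1 := normr_ge0 ((th z).1 - (th y).1); have p2 := normr_ge0 ((th z).2 - (th y).2).
  by split; rewrite -ball_normE /= distrC; move: h p1 p2 z1 z2; clear; lra.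
have jac_ne q : sq q -> pd false P q * pd true Q q - pd true P q * pd false Q q != 0.
  move=> [q1 q2]; have [_ a1 a2 a3 a4] := H _ q1 q2.
  have b1 : 3 / 4 < pd false P q by move: a1; rewrite ltr_norml => /andP[]; clear; lra.
  have b2 : 3 / 4 < pd true Q q by move: a4; rewrite ltr_norml => /andP[]; clear; lra.
  have b3 : `|pd true P q * pd false Q q| <= 4^-1 * 4^-1.
    by rewrite normrM; apply: ler_pM => //; exact: ltW.
  have b4 : 3 / 4 * (3 / 4) <= pd false P q * pd true Q q.
    by apply: ler_pM; rewrite ?ltW // divr_gt0.
  rewrite gt_eqF //; move: b3 b4; rewrite ler_norml; clear => /andP[]; lra.
pose J q := pd false P q * pd true Q q - pd true P q * pd false Q q.
have thD y v : N y ->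
   is_derive y v (fun z => (th z).1) ((pd true Q (th y) * v.1 - pd true P (th y) * v.2) / J (th y)) /\
   is_derive y v (fun z => (th z).2) ((pd false P (th y) * v.2 - pd false Q (th y) * v.1) / J (th y)).
  move=> Ny; have [s0 e0] := hth _ Ny.
  (* the points where the mean value theorem takes the partial derivatives *)
  have exh h : exists t : plane * plane * (plane * plane), N (h *: v + y) ->
    [/\ rect (th y) (th (h *: v + y)) t.1.1 /\ rect (th y) (th (h *: v + y)) t.1.2,
       rect (th y) (th (h *: v + y)) t.2.1 /\ rect (th y) (th (h *: v + y)) t.2.2,
       h * v.1 = pd false P t.1.1 * ((th (h *: v + y)).1 - (th y).1) + pd true P t.1.2 * ((th (h *: v + y)).2 - (th y).2) &
       h * v.2 = pd false Q t.2.1 * ((th (h *: v + y)).1 - (th y).1) + pd true Q t.2.2 * ((th (h *: v + y)).2 - (th y).2)].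
    have [Nh|] := pselect (N (h *: v + y)); last by exists (c, c, (c, c)).
    have [s1 e1] := hth _ Nh.
    have [x [z [r1 r2 _ _ EP]]] := mv P _ _ hP s0 s1.
    have [x' [z' [r1' r2' _ _ EQ]]] := mv Q _ _ hQ s0 s1.
    exists (x, z, (x', z')) => _; split => //=.
      rewrite -EP; move/(congr1 fst): e1 => /= ->; move/(congr1 fst): e0 => /= ->.
      by rewrite addrK.
    rewrite -EQ; move/(congr1 snd): e1 => /= ->; move/(congr1 snd): e0 => /= ->.
    by rewrite addrK.
  have [t ht] := choice exh.
  have nN : \forall h \near (0:R)^', N (h *: v + y).
    apply: cvg_within; have cl : {for (0:R), continuous (fun h : R => h *: v + y)}.
      apply: cvgD; last exact: cvg_cst.
      exact: (@scalel_continuous R (plane : normedModType R) v (0:R)).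
    apply: (cl N); rewrite /= scale0r add0r; exact: open_nbhs_nbhs.
  have cvr (s : R -> plane) : (\forall h \near (0:R)^', rect (th y) (th (h *: v + y)) (s h)) ->
     s h @[h --> (0:R)^'] --> th y.
    move=> hs; apply/cvg_ballP => e ee0.
    pose V := 2 * (`|v.1| + `|v.2|) + 1.
    have V0 : 0 < V.
      by rewrite /V; have := normr_ge0 v.1; have := normr_ge0 v.2; clear; lra.
    have n0 : \forall h \near (0:R)^', `|h| < e / V.
      apply: cvg_within; apply/near_interval; exists (e / V); first by rewrite divr_gt0.
      by move=> h; rewrite subr0.
    near=> h; have Nh : N (h *: v + y) by near: h.
    have hr : rect (th y) (th (h *: v + y)) (s h) by near: h.
    have hh : `|h| < e / V by near: h.
    have := thd _ _ Nh Ny; rewrite /= !addrK !normrM => h3.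
    rewrite ltr_pdivlMr // /V in hh.
    have p0 := normr_ge0 h.
    have p1 := normr_ge0 ((th (h *: v + y)).1 - (th y).1); have p2 := normr_ge0 ((th (h *: v + y)).2 - (th y).2).
    have [] := @rect_square R (th y) (th (h *: v + y)) (s h) e (th y) _ _ _ _ hr; rewrite ?subrr ?normr0 //; [by move: h3 hh p0 p1 p2; clear; nra|by move: h3 hh p0 p1 p2; clear; nra|].
    by move=> h1 h2; split; rewrite -ball_normE /= distrC.
  have ch i (F : plane -> R) (s : R -> plane) : Cinf O F -> (\forall h \near (0:R)^', rect (th y) (th (h *: v + y)) (s h)) ->
     pd i F (s h) @[h --> (0:R)^'] --> pd i F (th y).
    move=> hF hs; apply: (@pd_cvg _ _ _ s (pd i F)); last exact: cvr.
    by apply: (Cn_cont (Cn_pd i (hF 1%N))); have [] := H _ s0.1 s0.2.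
  have A := ch false P (fun h => (t h).1.1) hP. have B := ch true P (fun h => (t h).1.2) hP.
  have C := ch false Q (fun h => (t h).2.1) hQ. have D := ch true Q (fun h => (t h).2.2) hQ.
  have [k1 k2 k3 k4] : [/\ \forall h \near (0:R)^', rect (th y) (th (h *: v + y)) (t h).1.1,
     \forall h \near (0:R)^', rect (th y) (th (h *: v + y)) (t h).1.2,
     \forall h \near (0:R)^', rect (th y) (th (h *: v + y)) (t h).2.1 &
     \forall h \near (0:R)^', rect (th y) (th (h *: v + y)) (t h).2.2].
    by split; apply: filterS nN => h /ht [] [r1 r2] [r3 r4] _ _.
  have {}A := A k1. have {}B := B k2. have {}C := C k3. have {}D := D k4.
  pose Jh h := pd false P (t h).1.1 * pd true Q (t h).2.2 - pd true P (t h).1.2 * pd false Q (t h).2.1.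
  have cJ : Jh h @[h --> (0:R)^'] --> J (th y) by exact: (cvgB (cvgM A D) (cvgM B C)).
  have nJ : \forall h \near (0:R)^', Jh h != 0.
    apply: (cJ (fun x => x != 0)); apply: open_nbhs_nbhs; split; [exact: open_neq|exact: jac_ne].
  have nz : \forall h \near (0:R)^', h != 0 by exact: nbhs_dnbhs_neq.
  split; apply/is_derive_cvg.
    apply: cvg_trans (cvgM (cvgB (cvgM D (cvg_cst v.1)) (cvgM B (cvg_cst v.2))) (cvgV (jac_ne _ s0) cJ)).
    apply: near_eq_cvg; near=> h.
    have Nh : N (h *: v + y) by near: h.
    have h0 : h != 0 by near: h.
    have J0 : Jh h != 0 by near: h.
    have [_ _ E1 E2] := ht _ Nh; rewrite /shift /=.
    apply: (mulfI h0); rewrite /GRing.scale /= [RHS]mulrA divff // mul1r.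
    apply: (mulIf J0); rewrite -[(_ * _^-1)%R]/(_ / Jh h) -mulrA divfK //.
    have -> : h * (pd true Q (t h).2.2 * v.1 - pd true P (t h).1.2 * v.2) =
      pd true Q (t h).2.2 * (h * v.1) - pd true P (t h).1.2 * (h * v.2) by ring.
    rewrite E1 E2 /Jh; ring.
  apply: cvg_trans (cvgM (cvgB (cvgM A (cvg_cst v.2)) (cvgM C (cvg_cst v.1))) (cvgV (jac_ne _ s0) cJ)).
  apply: near_eq_cvg; near=> h.
  have Nh : N (h *: v + y) by near: h.
  have h0 : h != 0 by near: h.
  have J0 : Jh h != 0 by near: h.
  have [_ _ E1 E2] := ht _ Nh; rewrite /shift /=.
  apply: (mulfI h0); rewrite /GRing.scale /= [RHS]mulrA divff // mul1r.
  apply: (mulIf J0); rewrite -[(_ * _^-1)%R]/(_ / Jh h) -mulrA divfK //.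
  have -> : h * (pd false P (t h).1.1 * v.2 - pd false Q (t h).2.1 * v.1) =
      pd false P (t h).1.1 * (h * v.2) - pd false Q (t h).2.1 * (h * v.1) by ring.
  rewrite E1 E2 /Jh; ring.
exists N, (fun y => (th y).1), (fun y => (th y).2).
have ctr : forall y, ((th y).1, (th y).2) = th y by move=> y; rewrite -surjective_pairing.
have CJ : Cinf O J.
  by move=> n; apply: CnB => //; apply: CnM => //; exact: Cn_pd.
have sO : sq `<=` O by move=> q [q1 q2]; have [] := H _ q1 q2.
have CC n : Cn n N (fun y => (th y).1) /\ Cn n N (fun y => (th y).2).
  have t1 y : N y -> {for y, continuous (fun y => (th y).1)}.
    by move=> Ny; apply: (cvg_comp th); [exact: thc|exact: cvg_fst].
  have t2 y : N y -> {for y, continuous (fun y => (th y).2)}.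
    by move=> Ny; apply: (cvg_comp th); [exact: thc|exact: cvg_snd].
  elim: n => [|n [IH1 IH2]].
    by split; (split; last by []); [exact: t1|exact: t2].
  pose O' := O `&` [set q | J q != 0].
  have oO' : open O'.
    rewrite openE => q [Oq Jq]; have := near_neq0 (Cn_cont (CJ 0%N) Oq) Jq.
    by move/(near_and (open_nbhs_nbhs (conj oO Oq))).
  have sO' : O' `<=` O by move=> q [].
  have cmp F : Cinf O F -> Cn n N (fun y => F (th y) / J (th y)).
    move=> hF; rewrite (_ : (fun y => F (th y) / J (th y)) = (fun y => (fun q => F q / J q) ((th y).1, (th y).2))); last first.
      by apply/funext => y; rewrite ctr.
    apply: (@Cn_comp R n O' N (fun q => F q / J q)) => //.
      apply: CnM => //; first exact: Cn_sub sO' (hF n).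
      by apply: CnV => //; [move=> q []|exact: Cn_sub sO' (CJ n)].
    by move=> y /hth [sy _]; rewrite ctr; split; [exact: sO|exact: jac_ne].
  have k1 := cmp _ (Cinf_pd true hQ); have k2 := cmp _ (Cinf_pd true hP).
  have k3 := cmp _ (Cinf_pd false hQ); have k4 := cmp _ (Cinf_pd false hP).
  split; apply: Cn_intro.
  - exact: t1.
  - by move=> b y _ Ny; have [[]] := thD y (axis R b) Ny.
  - move=> b _.
    apply: (Cn_ext (f := fun y => (axis R b).1 * (pd true Q (th y) / J (th y)) - (axis R b).2 * (pd true P (th y) / J (th y)))); first exact: oN.
      by move=> y Ny; rewrite /pd; have [[_ ->] _] := thD y (axis R b) Ny; rewrite mulrBl !mulrA; congr (_ / _ - _ / _); exact: mulrC.
    exact: (CnB oN (CnZ _ oN k1) (CnZ _ oN k2)).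
  - exact: t2.
  - by move=> b y _ Ny; have [_ []] := thD y (axis R b) Ny.
  - move=> b _.
    apply: (Cn_ext (f := fun y => (axis R b).2 * (pd false P (th y) / J (th y)) - (axis R b).1 * (pd false Q (th y) / J (th y)))); first exact: oN.
      by move=> y Ny; rewrite /pd; have [_ [_ ->]] := thD y (axis R b) Ny; rewrite mulrBl !mulrA; congr (_ / _ - _ / _); exact: mulrC.
    exact: (CnB oN (CnZ _ oN k4) (CnZ _ oN k3)).
have Nc : N (P c, Q c) by rewrite /N /= !subrr normr0; split; rewrite divr_gt0.
split.
- by [].
- by move=> n; have [] := CC n.
- by move=> n; have [] := CC n.
- by move=> y Ny; rewrite ctr; have [s e] := hth _ Ny; split => //; exact: sO.
have nN : \forall q \near c, N (P q, Q q).
  have cPQ : {for c, continuous (fun q => (P q, Q q))}.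
    apply: (@cvg_pair _ _ _ (nbhs c) (nbhs (P c)) (nbhs (Q c))); [exact: (Cn_cont (hP 0%N) Oc)|exact: (Cn_cont (hQ 0%N) Oc)].
  by apply: (cPQ N); exact: open_nbhs_nbhs.
have ns : \forall q \near c, sq q.
  by apply/near_square; exists d => // q q1 q2; split; exact: ltW.
near=> q; have Nq : N (P q, Q q) by near: q.
have sQ : sq q by near: q.
split => //; rewrite ctr; have [s1 e1] := hth _ Nq.
have := lower _ _ s1 sQ; rewrite (congr1 fst e1 : P _ = _) (congr1 snd e1 : Q _ = _) !subrr normr0 addr0 mulr0.
move=> h; have p1 := normr_ge0 (q.1 - (th (P q, Q q)).1); have p2 := normr_ge0 (q.2 - (th (P q, Q q)).2).
rewrite [LHS]surjective_pairing [RHS]surjective_pairing; congr (_, _); apply/eqP; rewrite eq_sym -subr_eq0 -normr_eq0; move: h p1 p2; clear; lra.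
Unshelve. all: by end_near. Qed.

End Inverse.


Section InverseFunction.
Variable R : realType.
Local Notation plane := (plane R).
Implicit Types (f g F P Q : plane -> R) (p q c : plane) (O N : set plane).

Lemma pd_lin O P Q q b (u v : R) : Cn 1 O P -> Cn 1 O Q -> O q ->
  pd b (fun q => u * P q + v * Q q) q = u * pd b P q + v * pd b Q q.
Proof.
move=> hP hQ Oq; rewrite /pd.
have [] // : is_derive q (axis R b) (fun q => u * P q + v * Q q) (u * pd b P q + v * pd b Q q).
apply: is_deriveD; apply: is_deriveZ; apply/derivableP.
  exact: Cn_derivable hP Oq.
exact: Cn_derivable hQ Oq.
Qed.

(** Composing with the inverse of the linear part reduces this to
    [inverse_near_id]. *)
Lemma inverse_function O P Q c : open O -> O c -> Cinf O P -> Cinf O Q ->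
  djac P Q c != 0 ->
  exists N (th1 th2 : plane -> R),
    [/\ open N /\ N (P c, Q c), Cinf N th1, Cinf N th2,
       forall y, N y -> O (th1 y, th2 y) /\ (P (th1 y, th2 y), Q (th1 y, th2 y)) = y &
       \forall q \near c, N (P q, Q q) /\ (th1 (P q, Q q), th2 (P q, Q q)) = q].
Proof.
move=> oO Oc hP hQ; rewrite /djac.
set Pa := pd false P c; set Pb := pd true P c; set Qa := pd false Q c; set Qb := pd true Q c.
set j := Pa * Qb - Pb * Qa => j0.
have clin (F G : plane -> R) S (u v : R) : open S -> Cinf S F -> Cinf S G -> Cinf S (fun q => u * F q + v * G q).
  by move=> oS h1 h2 n; apply: CnD => //; apply: CnZ.
have [||||N' [t1 [t2 [[oN' N'c] h1 h2 H1 H2]]]] := @inverse_near_id R O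
    (fun q => (Qb / j) * P q + (- Pb / j) * Q q) (fun q => (- Qa / j) * P q + (Pa / j) * Q q) c oO Oc (clin _ _ _ _ _ oO hP hQ) (clin _ _ _ _ _ oO hP hQ).
- by rewrite (pd_lin _ _ _ (hP 1%N) (hQ 1%N)) // -/Pa -/Qa; apply: (mulIf j0); rewrite /j; field.
- by rewrite (pd_lin _ _ _ (hP 1%N) (hQ 1%N)) // -/Pb -/Qb; apply: (mulIf j0); rewrite /j; field.
- by rewrite (pd_lin _ _ _ (hP 1%N) (hQ 1%N)) // -/Pa -/Qa; apply: (mulIf j0); rewrite /j; field.
- by rewrite (pd_lin _ _ _ (hP 1%N) (hQ 1%N)) // -/Pb -/Qb; apply: (mulIf j0); rewrite /j; field.
pose L1 (y : plane) := (Qb / j) * y.1 + (- Pb / j) * y.2.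
pose L2 (y : plane) := (- Qa / j) * y.1 + (Pa / j) * y.2.
have cL1 S : open S -> Cinf S L1 by move=> oS; apply: clin => //; move=> n; [exact: Cn_fst|exact: Cn_snd].
have cL2 S : open S -> Cinf S L2 by move=> oS; apply: clin => //; move=> n; [exact: Cn_fst|exact: Cn_snd].
have Linj y z : L1 y = L1 z -> L2 y = L2 z -> y = z.
  rewrite /L1 /L2 => e1 e2.
  have k1 (w : plane) : Pa * (Qb / j * w.1 + - Pb / j * w.2) + Pb * (- Qa / j * w.1 + Pa / j * w.2) = w.1.
    by apply: (mulIf j0); rewrite /j; field.
  have k2 (w : plane) : Qa * (Qb / j * w.1 + - Pb / j * w.2) + Qb * (- Qa / j * w.1 + Pa / j * w.2) = w.2.
    by apply: (mulIf j0); rewrite /j; field.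
  have e3 : y.1 = z.1 by rewrite -(k1 y) -(k1 z) e1 e2.
  have e4 : y.2 = z.2 by rewrite -(k2 y) -(k2 z) e1 e2.
  by rewrite [y]surjective_pairing [z]surjective_pairing e3 e4.
pose N := [set y : plane | N' (L1 y, L2 y)].
have oN : open N.
  rewrite openE => y Ny.
  have cc : {for y, continuous (fun y => (L1 y, L2 y))}.
    by apply: (@cvg_pair _ _ _ (nbhs y) (nbhs (L1 y)) (nbhs (L2 y))); [apply: (Cn_cont (cL1 setT openT 0%N))|apply: (Cn_cont (cL2 setT openT 0%N))].
  by apply: (cc N'); exact: open_nbhs_nbhs.
exists N, (fun y => t1 (L1 y, L2 y)), (fun y => t2 (L1 y, L2 y)); split.
- by split.
- by move=> n; apply: (Cn_comp oN' oN) => //; [exact: cL1|exact: cL2].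
- by move=> n; apply: (Cn_comp oN' oN) => //; [exact: cL1|exact: cL2].
- move=> y Ny; have [a1 a2] := H1 _ Ny; split => //.
  by apply: Linj; [exact: (congr1 fst a2)|exact: (congr1 snd a2)].
- exact: H2.
Qed.

Lemma local_homeo_open_map O P Q c (W : set plane) : open O -> O c -> Cinf O P -> Cinf O Q ->
  djac P Q c != 0 -> nbhs c W -> nbhs (P c, Q c) ((fun q => (P q, Q q)) @` W).
Proof.
move=> oO Oc hP hQ j0 nW.
have [N [t1 [t2 [[oN Nc] h1 h2 H1 H2]]]] := inverse_function oO Oc hP hQ j0.
have ct : {for (P c, Q c), continuous (fun y => (t1 y, t2 y))}.
  apply: (@cvg_pair _ _ _ (nbhs (P c, Q c)) (nbhs (t1 (P c, Q c))) (nbhs (t2 (P c, Q c)))).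
    exact: (Cn_cont (h1 0%N) Nc).
  exact: (Cn_cont (h2 0%N) Nc).
have [_ ec] := nbhs_singleton H2.
have nWN : \forall y \near (P c, Q c), W (t1 y, t2 y) by apply: (ct W); rewrite ec.
have nN : \forall y \near (P c, Q c), N y by apply: open_nbhs_nbhs.
have := near_and nWN nN; apply: filterS => y [Wy Ny].
by exists (t1 y, t2 y) => //; have [_] := H1 y Ny.
Qed.

End InverseFunction.

(** * Tangent lines from the origin to the leaves *)

Section Tangency.
Variable R : realType.
Local Notation plane := (plane R).
Implicit Types (F : plane -> R) (p q : plane) (O N : set plane).

(** The derivative of [F] along the line of slope [th] through the origin; it
    vanishes at the points where the line is tangent to a level curve. *)
Definition along F (th a : R) : R :=
  pd false F (a, th * a) + th * pd true F (a, th * a).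

(** The second derivative of [F] along a direction of slope [th], at any point. *)
Definition along2 F (th : R) q : R :=
  (pd false (pd false F) q + th * pd true (pd false F) q) +
  th * (pd false (pd true F) q + th * pd true (pd true F) q).

(** Uniform bounds on a square for a function which is strictly increasing in
    height and strictly concave on all lines of slope at most [t]. The last
    inequality forces a line of slope at most [t] to attain its maximum inside
    the square. *)
Record line_box O F (r m K t : R) : Prop := LineBox {
  lb_r : 0 < r <= 1; lb_m : 0 < m; lb_K : 0 < K; lb_t : 0 < t <= 1;
  lb_O : forall q, `|q.1| <= r -> `|q.2| <= r -> O q;
  lb_y : forall q, `|q.1| <= r -> `|q.2| <= r -> m <= pd true F q <= K;
  lb_x : forall q, `|q.1| <= r -> `|q.2| <= r -> `|pd false F q| <= K;
  lb_yx : forall q, `|q.1| <= r -> `|q.2| <= r -> `|pd true (pd false F) q| <= K;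
  lb_yy : forall q, `|q.1| <= r -> `|q.2| <= r -> `|pd true (pd true F) q| <= K;
  lb_2 : forall th q, `|th| <= t -> `|q.1| <= r -> `|q.2| <= r ->
    - K <= along2 F th q <= - m;
  lb_tr : t * K < m * r }.

Lemma normr_le_bounds (x y : R) : `|x| <= y -> - y <= x /\ x <= y.
Proof. by rewrite ler_norml => /andP[]. Qed.

Lemma along2_arith (w1 w2 w3 w4 z K s e : R) : 2 * s + e <= K -> 3 * z <= s / 4 -> e <= s / 4 ->
  0 < e -> 0 < s -> - z <= w2 -> w2 <= z -> - z <= w3 -> w3 <= z -> - z <= w4 -> w4 <= z ->
  - (s + e) <= w1 -> w1 <= - (s - e) -> - K <= w1 + w2 + (w3 + w4) <= - e.
Proof. by move=> *; lra. Qed.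

Lemma ex_line_box O F d : open O -> O (0, 0) -> Cinf O F ->
  0 < pd true F (0, 0) -> pd false (pd false F) (0, 0) < 0 -> 0 < d ->
  exists r m K t, line_box O F r m K t /\ r <= d.
Proof.
move=> oO O0 hF v0 s0' d0.
have [v vE] : exists v, v = pd true F (0, 0) by exists (pd true F (0, 0)).
have [s sE] : exists s, s = - pd false (pd false F) (0, 0) by exists (- pd false (pd false F) (0, 0)).
have s0 : 0 < s by rewrite sE oppr_gt0.
rewrite -vE in v0.
have [e [e0 ev es]] : exists e, [/\ 0 < e, e <= v / 2 & e <= s / 4].
  exists (Num.min (v / 2) (s / 4)); split; first by rewrite lt_min !divr_gt0.
    by rewrite ge_min lexx.
  by rewrite ge_min lexx orbT.
have b1 F' : Cinf O F' -> \forall q \near ((0, 0) : plane), `|F' (0, 0) - F' q| < e.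
  by move=> h; move/cvgrPdist_lt : (Cn_cont (h 0%N) O0); exact.
have h_x := Cinf_pd false hF; have h_y := Cinf_pd true hF.
have h_xx := Cinf_pd false h_x; have h_yx := Cinf_pd true h_x.
have h_xy := Cinf_pd false h_y; have h_yy := Cinf_pd true h_y.
have := near_and (open_nbhs_nbhs (conj oO O0)) (near_and (near_and (near_and (b1 _ h_x) (b1 _ h_y)) (b1 _ h_xx)) (near_and (near_and (b1 _ h_yx) (b1 _ h_xy)) (b1 _ h_yy))).
move=> /near_square [r0 r00 H].
pose x1 := `|pd false F (0,0)|; pose x2 := `|pd true (pd false F) (0, 0)|.
pose x3 := `|pd false (pd true F) (0, 0)|; pose x4 := `|pd true (pd true F) (0, 0)|.
have [y1 y2 y3 y4] : [/\ 0 <= x1, 0 <= x2, 0 <= x3 & 0 <= x4] by split; exact: normr_ge0.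
have [K KE] : exists K : R, K = e + (x1 + v + 2 * s + (x2 + x3 + x4)) by exists (e + (x1 + v + 2 * s + (x2 + x3 + x4))).
have min3 (x y z : R) : 0 < x -> 0 < y -> 0 < z -> exists w, [/\ 0 < w, w <= x, w <= y & w <= z].
  move=> x0 y0 z0; exists (Num.min (Num.min x y) z).
  by rewrite !lt_min x0 y0 z0 !ge_min !lexx !orbT.
have [r [rp r1 rd rr]] : exists r, [/\ 0 < r, r <= 1, r <= d & r <= r0 / 2].
  by apply: min3 => //; rewrite divr_gt0.
have rr0 : r < r0.
  by apply: (le_lt_trans rr); move: r00; clear; lra.
have K0 : 0 < K by rewrite KE; move: e0 v0 s0 y1 y2 y3 y4; clear; lra.
have K30 : 0 < 3 * K by rewrite mulr_gt0.
have K20 : 0 < 2 * K by rewrite mulr_gt0.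
have mr0 : 0 < e * r by rewrite mulr_gt0.
have [t [t0 t1 tt1 tt2]] : exists t, [/\ 0 < t, t <= 1, t <= s / 4 / (3 * K) & t <= e * r / (2 * K)].
  by apply: min3 => //; rewrite !divr_gt0.
have tK : t * (3 * K) <= s / 4 by rewrite (@ler_pdivlMr _ (3 * K) t (s / 4) K30) in tt1.
have tr : t * K < e * r.
  have h : t * (2 * K) <= e * r by rewrite (@ler_pdivlMr _ (2 * K) t (e * r) K20) in tt2.
  have : 0 < t * K by rewrite mulr_gt0.
  by move: h; clear; lra.
have near0 (x y : R) : `|x - y| < e -> x - e < y < x + e.
  by rewrite ltr_norml; clear; lra.
have nb (x y : R) : `|x - y| < e -> `|y| <= `|x| + e.
  by move=> h; rewrite -[y](subrK x) addrC; apply: (le_trans (ler_normD _ _)); rewrite lerD2l distrC ltW.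
have B q : `|q.1| <= r -> `|q.2| <= r -> [/\ O q, v / 2 <= pd true F q <= K, `|pd false F q| <= K &
   [/\ - (s + e) <= pd false (pd false F) q <= - (s - e), `|pd true (pd false F) q| <= x2 + e,
      `|pd false (pd true F) q| <= x3 + e & `|pd true (pd true F) q| <= x4 + e]].
  move=> q1 q2; have [||Oq [[[a1 a2] a3] [[a4 a5] a6]]] := H q; rewrite /= ?subr0; try exact: le_lt_trans rr0.
  split.
  - exact: Oq.
  - have /andP[] := near0 _ _ a2; rewrite -vE KE; move: ev v0 s0 e0 y1 y2 y3 y4; clear; lra.
  - apply: (le_trans (nb _ _ a1)); rewrite -/x1 KE; move: v0 s0 e0 y1 y2 y3 y4; clear; lra.
  - split; [|exact: nb a4|exact: nb a5|exact: nb a6].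
    have /andP[] := near0 _ _ a3; have : pd false (pd false F) (0, 0) = - s by rewrite sE opprK.
    move=> ->; clear; lra.
exists r, e, K, t; split; last exact: rd.
split.
- by rewrite rp r1.
- exact: e0.
- exact: K0.
- by rewrite t0 t1.
- by move=> q q1 q2; have [] := B q q1 q2.
- by move=> q q1 q2; have [_ /andP[h1 h2] _ _] := B q q1 q2; rewrite h2 (le_trans ev).
- by move=> q q1 q2; have [] := B q q1 q2.
- move=> q q1 q2; have [_ _ _ [_ h _ _]] := B q q1 q2; apply: (le_trans h).
  by rewrite KE; move: v0 s0 e0 y1 y2 y3 y4; clear; lra.
- move=> q q1 q2; have [_ _ _ [_ _ _ h]] := B q q1 q2; apply: (le_trans h).
  by rewrite KE; move: v0 s0 e0 y1 y2 y3 y4; clear; lra.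
- move=> th q hth q1 q2; have [_ _ _ [h1 h2 h3 h4]] := B q q1 q2.
  have le1 (x z : R) : `|x| <= z -> z <= K -> `|th * x| <= t * K.
    by move=> a b; rewrite normrM; apply: ler_pM => //; exact: le_trans b.
  have k2 : `|th * pd true (pd false F) q| <= t * K.
    by apply: (le1 _ _ h2); rewrite KE; move: v0 s0 e0 y1 y2 y3 y4; clear; lra.
  have k3 : `|th * pd false (pd true F) q| <= t * K.
    by apply: (le1 _ _ h3); rewrite KE; move: v0 s0 e0 y1 y2 y3 y4; clear; lra.
  have k4 : `|th * pd true (pd true F) q| <= t * K.
    by apply: (le1 _ _ h4); rewrite KE; move: v0 s0 e0 y1 y2 y3 y4; clear; lra.
  have k5 : `|th * (th * pd true (pd true F) q)| <= t * K.
    rewrite normrM; apply: (le_trans _ k4); rewrite ler_piMl //.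
    exact: le_trans t1.
  rewrite /along2 mulrDr.
  have KK : 2 * s + e <= K by rewrite KE; move: v0 s0 e0 y1 y2 y3 y4; clear; lra.
  have [u1 u2] := normr_le_bounds k2; have [u3 u4] := normr_le_bounds k3; have [u5 u6] := normr_le_bounds k5.
  have /andP[h11 h12] := h1.
  have tK' : 3 * (t * K) <= s / 4 by have -> : 3 * (t * K) = t * (3 * K) by ring.
  exact: (along2_arith KK tK' es e0 s0 u1 u2 u3 u4 u5 u6 h11 h12).
- exact: tr.
Qed.

Section OneFoliation.
Implicit Types (th a b : R).
Variables (O : set plane) (F : plane -> R) (r m K t : R).
Hypothesis (oO : open O) (hF : Cinf O F) (box : line_box O F r m K t).

Let r0 : 0 < r. Proof. by have /andP[] := lb_r box. Qed.
Let r1 : r <= 1. Proof. by have /andP[] := lb_r box. Qed.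
Let m0 := lb_m box.
Let K0 := lb_K box.
Let t0 : 0 < t. Proof. by have /andP[] := lb_t box. Qed.
Let t1 : t <= 1. Proof. by have /andP[] := lb_t box. Qed.

Let in_box th a : `|th| <= t -> `|a| <= r -> `|th * a| <= r.
Proof.
move=> h1 h2; rewrite normrM; apply: le_trans h2; rewrite ler_piMl //.
exact: le_trans t1.
Qed.

Lemma is_derive_sloped G th a : Cinf O G -> `|th| <= t -> `|a| <= r ->
  is_derive a 1 (fun x => G (x, th * x)) (pd false G (a, th * a) + th * pd true G (a, th * a)).
Proof.
move=> hG h1 h2; have Oa : O (a, th * a) by apply: (lb_O box) => //=; exact: in_box.
have := chain_curve oO (hG 1%N) Oa (is_derive_id a (1:R)) (is_deriveZ th (is_derive_id a (1:R))).
by rewrite mul1r [th *: 1]mulr1.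
Qed.

Lemma is_derive_along th a : `|th| <= t -> `|a| <= r ->
  is_derive a 1 (fun x => F (x, th * x)) (along F th a).
Proof. exact: is_derive_sloped. Qed.

Lemma is_derive_along2 th a : `|th| <= t -> `|a| <= r ->
  is_derive a 1 (along F th) (along2 F th (a, th * a)).
Proof.
move=> h1 h2.
have d1 := is_derive_sloped (Cinf_pd false hF) h1 h2.
have d2 := is_derive_sloped (Cinf_pd true hF) h1 h2.
exact: (is_deriveD d1 (is_deriveZ th d2)).
Qed.

Lemma between_le (x y z b : R) : `|x| <= b -> `|y| <= b -> Num.min x y <= z <= Num.max x y -> `|z| <= b.
Proof.
rewrite !ler_norml => /andP[a1 a2] /andP[a3 a4].
have [xy|yx] := leP x y => /andP[h1 h2]; apply/andP; split.
- exact: le_trans h1.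
- exact: le_trans h2 _.
- exact: le_trans h1.
- exact: le_trans h2 _.
Qed.

(** The strict concavity along lines, in integrated form. *)
Lemma along_slope th a b : `|th| <= t -> `|a| <= r -> `|b| <= r ->
  exists2 c, m <= c <= K & along F th b - along F th a = - c * (b - a).
Proof.
move=> h1 ha hb.
have [x hx|x hx ->] := @mvt R (along F th) (fun x => along2 F th (x, th * x)) a b.
  by apply: is_derive_along2 => //; exact: between_le hx.
have hxr := between_le ha hb hx.
exists (- along2 F th (x, th * x)); last by rewrite opprK.
have /andP[u1 u2] := lb_2 box (q := (x, th * x)) h1 hxr (in_box h1 hxr).
by rewrite lerNr u2 lerNl u1.
Qed.

Lemma along0 th : `|th| <= t -> pd false F (0, 0) = 0 -> along F th 0 = th * pd true F (0, 0).
Proof. by move=> _ h; rewrite /along mulr0 h add0r. Qed.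

Hypothesis (F0 : F (0, 0) = 0) (Fx0 : pd false F (0, 0) = 0).

Let r00 : `|(0 : R)| <= r. Proof. by rewrite normr0 ltW. Qed.

Lemma ex_tangency th : `|th| <= t -> exists2 a, `|a| <= r & along F th a = 0.
Proof.
move=> hth; have rr : `|r| <= r by rewrite ger0_norm // ltW.
have rr' : `|- r| <= r by rewrite normrN.
have /andP[v1 v2] := lb_y box (q := (0, 0)) r00 r00.
have bd : `|along F th 0| < m * r.
  rewrite along0 // normrM; apply: le_lt_trans (lb_tr box).
  apply: ler_pM => //; rewrite ger0_norm //; exact: le_trans (ltW m0) v1.
have [c1 /andP[a1 a2] E1] := along_slope hth r00 rr.
have [c2 /andP[a3 a4] E2] := along_slope hth r00 rr'.
have b1 : m * r <= c1 * r by rewrite ler_pM2r.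
have b2 : m * r <= c2 * r by rewrite ler_pM2r.
have [|||a] := @IVT R (along F th) (- r) r 0.
- by rewrite ge0_cp // ltW.
- apply: derivable_within_continuous => x; rewrite in_itv /= => hx.
  have hxr : `|x| <= r by rewrite ler_norml.
  by have [] := is_derive_along2 hth hxr.
- move: bd E1 E2 b1 b2; rewrite ltr_norml ge_min le_max subr0.
  move=> /andP[? ?] ? ? ? ?; apply/andP; split; apply/orP; [right|left]; lra.
- by rewrite in_itv /= => ha E; exists a => //; rewrite ler_norml.
Qed.

(** The abscissa of the point where the line of slope [th] is tangent to a level
    curve; it is unique by concavity. *)
Definition tangency th : R := xget 0 [set a | `|a| <= r /\ along F th a = 0].

Lemma tangencyP th : `|th| <= t -> `|tangency th| <= r /\ along F th (tangency th) = 0.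
Proof.
move=> h; have [a a1 a2] := ex_tangency h.
by apply: (@xgetPex _ 0 [set a | `|a| <= r /\ along F th a = 0]); exists a.
Qed.

Lemma tangency_dist th a : `|th| <= t -> `|a| <= r ->
  m * `|tangency th - a| <= `|along F th a|.
Proof.
move=> h ha; have [h1 h2] := tangencyP h.
have [c /andP[c1 c2]] := along_slope h ha h1; rewrite h2 sub0r mulNr => /oppr_inj ->.
by rewrite normrM; apply: ler_wpM2r => //; rewrite ger0_norm // (le_trans _ c1) // ltW.
Qed.

Lemma tangency_bound th : `|th| <= t -> `|tangency th| <= K / m * `|th|.
Proof.
move=> h; have := tangency_dist h r00; rewrite subr0 along0 // normrM => h1.
have /andP[v1 v2] := lb_y box (q := (0, 0)) r00 r00.
rewrite mulrAC ler_pdivlMr // mulrC; apply: (le_trans h1); rewrite mulrC.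
by apply: ler_wpM2r => //; rewrite ger0_norm // (le_trans _ v1) // ltW.
Qed.

Lemma tangency_sign th : `|th| <= t ->
  (0 < th -> 0 < tangency th) /\ (th < 0 -> tangency th < 0).
Proof.
move=> h; have [h1 h2] := tangencyP h.
have [c /andP[c1 c2]] := along_slope h r00 h1.
rewrite h2 along0 // subr0 sub0r mulNr => /oppr_inj E.
have /andP[v1 v2] := lb_y box (q := (0, 0)) r00 r00.
have v0 : 0 < pd true F (0, 0) by exact: lt_le_trans v1.
have c0 : 0 < c by exact: lt_le_trans c1.
split => th0.
  by rewrite -(pmulr_rgt0 _ c0) -E mulr_gt0.
by rewrite -(pmulr_rlt0 _ c0) -E pmulr_llt0.
Qed.

Lemma tangency0 : tangency 0 = 0.
Proof.
have h : `|(0:R)| <= t by rewrite normr0 ltW.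
by have := tangency_bound h; rewrite normr0 mulr0 normr_le0 => /eqP.
Qed.

(** By concavity along the line this is the maximum of [F] on it. *)
Definition maxline th : R := F (tangency th, th * tangency th).

(** Near a nondegenerate maximum the defect of the value is quadratic in the
    derivative. This gain of a square is what makes the comparison of two
    foliations work. *)
Lemma maxline_error th a : `|th| <= t -> `|a| <= r ->
  0 <= maxline th - F (a, th * a) <= `|along F th a| ^+ 2 / m.
Proof.
move=> h ha; have [h1 h2] := tangencyP h.
have [x hx|x hx E] := @mvt R (fun x => F (x, th * x)) (along F th) a (tangency th).
  by apply: is_derive_along => //; exact: between_le hx.
rewrite /maxline E; have hxr := between_le ha h1 hx.
have [c /andP[c1 c2]] := along_slope h hxr h1; rewrite h2 sub0r mulNr => /oppr_inj Ex.
have [c' /andP[c1' c2']] := along_slope h ha hxr => Ea.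
have td := tangency_dist h ha.
have xd : 0 <= (tangency th - x) * (tangency th - a).
  move: hx; case: (leP a (tangency th)) => at' /andP[x1 x2].
    by apply: mulr_ge0; rewrite subr_ge0.
  by apply: mulr_le0; rewrite subr_le0 // ltW.
have xa : `|tangency th - x| <= `|tangency th - a|.
  move: hx; case: (leP a (tangency th)) => at' /andP[x1 x2].
    rewrite ger0_norm; last by lra.
    rewrite ger0_norm; lra.
  rewrite ler0_norm; last by lra.
  rewrite ler0_norm; lra.
rewrite Ex; apply/andP; split.
  by rewrite -mulrA mulr_ge0 // (le_trans _ c1) // ltW.
have sg : `|c * (tangency th - x)| <= `|along F th a|.
  have cc : along F th a = c * (tangency th - x) + c' * (x - a).
    by rewrite -Ex; move: Ea; rewrite mulNr => E'; rewrite -[LHS](subrK (along F th x)) addrC -[X in _ + X]opprB E' opprK.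
  have c0 : 0 < c by exact: lt_le_trans c1.
  have c0' : 0 < c' by exact: lt_le_trans c1'.
  move: hx; case: (leP a (tangency th)) => at' /andP[x1 x2].
    have k1 : 0 <= c * (tangency th - x) by rewrite mulr_ge0 ?subr_ge0 // ltW.
    have k2 : 0 <= c' * (x - a) by rewrite mulr_ge0 ?subr_ge0 // ltW.
    by rewrite cc !ger0_norm ?lerDl // addr_ge0.
  have k1 : c * (tangency th - x) <= 0 by rewrite pmulr_rle0 // subr_le0.
  have k2 : c' * (x - a) <= 0 by rewrite pmulr_rle0 // subr_le0.
  rewrite cc ler0_norm // ler0_norm; lra.
apply: (le_trans (ler_norm _)); rewrite normrM expr2 -mulrA.
apply: ler_pM => //; rewrite ler_pdivlMr // mulrC; exact: td.
Qed.

End OneFoliation.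
End Tangency.

(** * The reflection law and even functions *)

Section Even.
Variable R : realType.
Local Notation plane := (plane R).
Implicit Types (F : plane -> R) (p q : plane) (O N : set plane) (th a b : R).

Lemma ex_min2 (x y : R) : 0 < x -> 0 < y -> exists z, [/\ 0 < z, z <= x & z <= y].
Proof. by move=> x0 y0; exists (Num.min x y); rewrite lt_min x0 y0 !ge_min !lexx orbT. Qed.

Lemma within_segmentP (f : R -> R) (a b : R) :
  {within `[a, b], continuous f} <->
  (forall x, a <= x <= b -> forall e, 0 < e -> exists2 d, 0 < d &
     forall y, a <= y <= b -> `|y - x| < d -> `|f y - f x| < e).
Proof.
split=> [/subspace_continuousP H x xab e e0|H].
  have := H x; rewrite /= in_itv /= => /(_ xab) /cvgrPdist_lt/(_ _ e0).
  rewrite near_withinE => /near_interval [d d0 h]; exists d => // y yab yx.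
  by rewrite distrC; apply: (h y yx); rewrite /= in_itv.
apply/subspace_continuousP => x; rewrite /= in_itv /= => xab.
apply/cvgrPdist_lt => e e0; have [d d0 h] := H x xab e e0.
rewrite near_withinE; apply/near_interval; exists d => // y yx.
by rewrite /= in_itv /= distrC => yab; apply: h.
Qed.

Lemma within_comp (f g : R -> R) (a b c d : R) :
  {within `[a, b], continuous f} -> {within `[c, d], continuous g} ->
  (forall x, a <= x <= b -> c <= f x <= d) ->
  {within `[a, b], continuous (g \o f)}.
Proof.
move=> /within_segmentP hf /within_segmentP hg hm; apply/within_segmentP => x xab e e0.
have [d1 d10 h1] := hg _ (hm _ xab) e e0.
have [d2 d20 h2] := hf _ xab d1 d10.
by exists d2 => // y yab yx; apply: h1; [exact: hm|exact: h2].
Qed.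

Lemma within_pair (f g : R -> R) (a b : R) :
  {within `[a, b], continuous f} -> {within `[a, b], continuous g} ->
  {within `[a, b], continuous (fun x => (f x, g x))}.
Proof.
move=> /within_segmentP hf /within_segmentP hg; apply/subspace_continuousP => x.
rewrite /= in_itv /= => xab; apply/cvg_ballP => e e0.
have [d1 d10 h1] := hf _ xab e e0; have [d2 d20 h2] := hg _ xab e e0.
rewrite near_withinE; apply/near_interval; exists (Num.min d1 d2); first by rewrite lt_min d10.
move=> y; rewrite lt_min => /andP[y1 y2]; rewrite /= in_itv /= => yab.
by split; rewrite -ball_normE /= distrC; [exact: h1|exact: h2].
Qed.

(** It serves to parametrize the points of tangency by the level of the leaf. *)
Lemma increasing_inverse (g : R -> R) (t : R) : 0 <= t ->
  {within `[0, t], continuous g} -> g 0 = 0 ->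
  (forall x y, 0 <= x -> x < y -> y <= t -> g x < g y) ->
  exists h : R -> R, {within `[0, g t], continuous h} /\
    forall u, 0 <= u <= g t -> 0 <= h u <= t /\ g (h u) = u.
Proof.
move=> t0 cg g0 mono.
have gt0 : 0 <= g t.
  by have [->|tn] := eqVneq t 0; [rewrite g0|apply/ltW; rewrite -{1}g0; apply: mono => //; rewrite lt_def tn].
have ex u : exists x, 0 <= u <= g t -> 0 <= x <= t /\ g x = u.
  have [hu|] := boolP (0 <= u <= g t); last by exists 0.
  have [|x] := @IVT R g 0 t u t0 cg.
    by rewrite g0 min_l // max_r.
  by rewrite in_itv /= => xt gx; exists x.
have [h hh] := choice ex.
have mon x y : 0 <= x <= t -> 0 <= y <= t -> g x = g y -> x = y.
  move=> /andP[x0 xt] /andP[y0 yt] e; have [xy|yx|//] := ltgtP x y.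
    by have := mono x y x0 xy yt; rewrite e ltxx.
  by have := mono y x y0 yx xt; rewrite e ltxx.
exists h; split; last by move=> u /hh.
have can : {in `[0, t], cancel g h}.
  move=> x; rewrite in_itv /= => xt.
  have gx : 0 <= g x <= g t.
    have /andP[x0 x1] := xt; apply/andP; split.
      have [->|xn] := eqVneq x 0; first by rewrite g0.
      by rewrite -{1}g0; apply/ltW/mono => //; rewrite lt_def xn.
    have [->|xn] := eqVneq x t; first by [].
    by apply/ltW/mono => //; rewrite lt_def eq_sym xn.
  by have [h1 h2] := hh _ gx; apply: mon.
by have := segment_can_le_continuous t0 cg can; rewrite g0.
Qed.

Section OneFoliation.
Variables (O : set plane) (F : plane -> R) (r m K t : R).
Hypothesis (oO : open O) (hF : Cinf O F) (box : line_box O F r m K t).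
Hypothesis (F0 : F (0, 0) = 0) (Fx0 : pd false F (0, 0) = 0).

Let r0 : 0 < r. Proof. by have /andP[] := lb_r box. Qed.
Let r1 : r <= 1. Proof. by have /andP[] := lb_r box. Qed.
Let m0 := lb_m box.
Let K0 := lb_K box.
Let t0 : 0 < t. Proof. by have /andP[] := lb_t box. Qed.
Let t1 : t <= 1. Proof. by have /andP[] := lb_t box. Qed.
Local Notation tang := (tangency F r).
Local Notation M := (maxline F r).

Let in_box th a : `|th| <= t -> `|a| <= r -> `|th * a| <= r.
Proof.
move=> h1 h2; rewrite normrM; apply: le_trans h2; rewrite ler_piMl //.
exact: le_trans t1.
Qed.

Let tangP th (h : `|th| <= t) := tangencyP oO hF box Fx0 h.

Lemma vertical_lip G a b b' : Cinf O G -> `|a| <= r -> `|b| <= r -> `|b'| <= r ->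
  (forall q, `|q.1| <= r -> `|q.2| <= r -> `|pd true G q| <= K) ->
  `|G (a, b) - G (a, b')| <= K * `|b - b'|.
Proof.
move=> hG ha hb hb' hK.
have [x hx|x hx ->] := @mvt R (fun x => G (a, x)) (fun x => pd true G (a, x)) b' b.
  by apply/is_derive_y/(Cn_derivable (hG 1%N))/(lb_O box) => //=; exact: between_le hx.
by rewrite normrM; apply: ler_wpM2r => //; apply: hK => //=; exact: between_le hx.
Qed.

Lemma pdy_le q : `|q.1| <= r -> `|q.2| <= r -> `|pd true F q| <= K.
Proof.
move=> q1 q2; have /andP[h1 h2] := lb_y box q1 q2.
by rewrite ger0_norm // (le_trans _ h1) // ltW.
Qed.

Lemma along_lip th th' a : `|th| <= t -> `|th'| <= t -> `|a| <= r ->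
  `|along F th a - along F th' a| <= 3 * K * `|th - th'|.
Proof.
move=> h h' ha; rewrite /along.
have i1 := in_box h ha; have i2 := in_box h' ha.
have d : `|th * a - th' * a| <= `|th - th'|.
  by rewrite -mulrBl normrM ler_piMr //; exact: le_trans r1.
have l1 := vertical_lip (Cinf_pd false hF) ha i1 i2 (lb_yx box).
have l2 := vertical_lip (Cinf_pd true hF) ha i1 i2 (lb_yy box).
have l3 := pdy_le (q := (a, th * a)) ha i1.
have kd : K * `|th * a - th' * a| <= K * `|th - th'| by rewrite ler_wpM2l // ltW.
have {}l1 := le_trans l1 kd; have {}l2 := le_trans l2 kd.
have l4 : `|(th - th') * pd true F (a, th * a)| <= K * `|th - th'|.
  by rewrite normrM mulrC; apply: ler_wpM2r.
have l5 : `|th' * (pd true F (a, th * a) - pd true F (a, th' * a))| <= K * `|th - th'|.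
  by rewrite normrM; apply: le_trans l2; rewrite ler_piMl //; exact: le_trans t1.
have -> : pd false F (a, th * a) + th * pd true F (a, th * a) -
    (pd false F (a, th' * a) + th' * pd true F (a, th' * a)) =
  (pd false F (a, th * a) - pd false F (a, th' * a)) + (th - th') * pd true F (a, th * a) +
   th' * (pd true F (a, th * a) - pd true F (a, th' * a)) by ring.
have -> : 3 * K * `|th - th'| = K * `|th - th'| + K * `|th - th'| + K * `|th - th'| by ring.
apply: (le_trans (ler_normD _ _)); apply: lerD l5; apply: (le_trans (ler_normD _ _)); exact: lerD l1 l4.
Qed.

Lemma tangency_lip th th' : `|th| <= t -> `|th'| <= t ->
  `|tang th - tang th'| <= 3 * K / m * `|th - th'|.
Proof.
move=> h h'; have [h1 h2] := tangP h'.
have := tangency_dist oO hF box Fx0 h h1.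
rewrite -[along F th _]subr0 -h2 => /le_trans/(_ (along_lip h h' h1)) H.
by rewrite mulrAC ler_pdivlMr // mulrC.
Qed.

Lemma F_lip p q : `|p.1| <= r -> `|p.2| <= r -> `|q.1| <= r -> `|q.2| <= r ->
  `|F q - F p| <= K * `|q.1 - p.1| + K * `|q.2 - p.2|.
Proof.
move=> p1 p2 q1 q2.
have [x b hx|x [y [[x1 x2] [y1 y2] ->]]] := @mvt2 R F p q.
  apply/(Cn_derivable (hF 1%N))/(lb_O box); case: hx => hx1 hx2.
    exact: between_le hx1.
  exact: between_le hx2.
apply: (le_trans (ler_normD _ _)); rewrite !normrM; apply: lerD; apply: ler_wpM2r => //.
  by apply: (lb_x box); [exact: between_le x1|exact: between_le x2].
by apply: pdy_le; [exact: between_le y1|exact: between_le y2].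
Qed.

Let L := 3 * K / m.

Lemma height_lip th th' : `|th| <= t -> `|th'| <= t ->
  `|th * tang th - th' * tang th'| <= (1 + L) * `|th - th'|.
Proof.
move=> h h'; have [h1 _] := tangP h; have l := tangency_lip h h'.
have -> : th * tang th - th' * tang th' = (th - th') * tang th + th' * (tang th - tang th') by ring.
apply: (le_trans (ler_normD _ _)); rewrite [X in _ <= X]mulrDl mul1r; apply: lerD.
  by rewrite normrM ler_piMr //; exact: le_trans r1.
by rewrite normrM; apply: le_trans l; rewrite ler_piMl //; exact: le_trans t1.
Qed.

Lemma maxline_lip th th' : `|th| <= t -> `|th'| <= t ->
  `|M th - M th'| <= (K * L + K * (1 + L)) * `|th - th'|.
Proof.
move=> h h'; have [h1 _] := tangP h; have [h1' _] := tangP h'.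
apply: (le_trans (F_lip _ _ _ _)) => //=; try exact: in_box.
rewrite [X in _ <= X]mulrDl -[K * L * _]mulrA -[K * (1 + L) * _]mulrA; apply: lerD; (apply: ler_wpM2l; first exact: ltW).
  exact: tangency_lip.
exact: height_lip.
Qed.

(** Moving the point of tangency vertically onto the steeper line increases [F],
    and the maximum on that line is at least as large. *)
Lemma maxline_lt th th' : `|th| <= t -> `|th'| <= t -> 0 < (th' - th) * tang th ->
  M th < M th'.
Proof.
move=> h h' pos; have [h1 _] := tangP h.
have /andP[e _] := maxline_error oO hF box Fx0 h' h1.
apply: lt_le_trans (_ : _ < F (tang th, th' * tang th)) _; last by rewrite -subr_ge0.
have i1 := in_box h h1; have i2 := in_box h' h1.
have [x hx|x hx E] := @mvt R (fun x => F (tang th, x)) (fun x => pd true F (tang th, x)) (th * tang th) (th' * tang th).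
  by apply/is_derive_y/(Cn_derivable (hF 1%N))/(lb_O box) => //=; exact: between_le hx.
have /andP[y1 _] := lb_y box (q := (tang th, x)) h1 (between_le i1 i2 hx).
by rewrite -subr_gt0 E -mulrBl mulr_gt0 // (lt_le_trans m0).
Qed.

Lemma along_tangency th a : `|th| <= t -> `|a| <= r -> exists2 c, m <= c <= K &
  along F th a = c * (tang th - a).
Proof.
move=> h ha; have [h1 h2] := tangP h; have [c c1 E] := along_slope oO hF box h ha h1.
by exists c => //; move: E; rewrite h2 sub0r mulNr => /oppr_inj.
Qed.

Lemma along_origin th a : `|th| <= t -> `|a| <= r -> exists2 x,
  Num.min 0 a <= x <= Num.max 0 a & F (a, th * a) = along F th x * a.
Proof.
move=> h ha; have r00 : `|(0:R)| <= r by rewrite normr0 ltW.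
have [x hx|x hx] := @mvt R (fun x => F (x, th * x)) (along F th) 0 a.
  by apply: (is_derive_along oO hF box) => //; exact: between_le hx.
by rewrite mulr0 F0 !subr0 => E; exists x.
Qed.

Lemma maxline0 : M 0 = 0.
Proof. by rewrite /maxline (tangency0 oO hF box Fx0) mulr0 F0. Qed.

Lemma maxline_gt0 th : `|th| <= t -> th != 0 -> 0 < M th.
Proof.
move=> h thn; have [h1 _] := tangP h.
have hh : `|tang th / 2| <= r.
  by rewrite normrM (ger0_norm (_ : 0 <= 2^-1)) ?invr_ge0 //; apply: le_trans h1; rewrite ler_piMr // invf_le1 // ler1n.
have /andP[e _] := maxline_error oO hF box Fx0 h hh.
apply: lt_le_trans (_ : _ < F (tang th / 2, th * (tang th / 2))) _; last by rewrite -subr_ge0.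
have [x hx ->] := along_origin h hh.
have r00 : `|(0:R)| <= r by rewrite normr0 ltW.
have [c /andP[c1 c2] ->] := along_tangency h (between_le r00 hh hx).
rewrite -mulrA mulr_gt0 //; first exact: lt_le_trans c1.
have [s1 s2] := tangency_sign oO hF box Fx0 h.
move: hx; case: (ltgtP th 0) thn => // th0 _.
  have a0 := s2 th0; rewrite min_r ?max_l; try lra.
  by move=> /andP[x1 x2]; rewrite nmulr_rgt0; lra.
have a0 := s1 th0; rewrite min_l ?max_r; try lra.
by move=> /andP[x1 x2]; rewrite pmulr_rgt0; lra.
Qed.

(** The derivative along the line vanishes at the tangency and has a bounded
    slope, so the value is at most quadratic in the abscissa. *)
Lemma maxline_le th : `|th| <= t -> M th <= K * tang th ^+ 2.
Proof.
move=> h; have [h1 _] := tangP h; have [x hx E] := along_origin h h1.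
have r00 : `|(0:R)| <= r by rewrite normr0 ltW.
have [c /andP[c1 c2] E2] := along_tangency h (between_le r00 h1 hx).
rewrite /maxline E E2 expr2 -mulrA.
have c0 : 0 <= c by rewrite (le_trans _ c1) // ltW.
have sq : 0 <= (tang th - x) * tang th <= tang th * tang th.
  move: hx; case: (leP 0 (tang th)) => a0 /andP[x1 x2].
    by rewrite mulr_ge0 ?subr_ge0 //= ler_wpM2r // gerBl.
  have k1 : 0 <= x * tang th by apply: mulr_le0 => //; exact: ltW.
  have k2 : 0 <= (tang th - x) * tang th by apply: mulr_le0; [rewrite subr_le0|exact: ltW].
  by rewrite k2 /=; lra.
by have /andP[q1 q2] := sq; apply: ler_pM.
Qed.

(** The reflection law at the origin in normal coordinates. Two paths of
    tangency points start at the origin and stay on common leaves; in the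
    conclusion the slopes of the lines from the origin to their endpoints are
    opposite. *)
Definition symmetric_near d := forall y z : R -> plane,
  {within `[0, 1], continuous y} -> {within `[0, 1], continuous z} ->
  y 0 = (0, 0) -> z 0 = (0, 0) ->
  (forall s, 0 < s <= 1 ->
    [/\ (`|(y s).1| <= d /\ `|(y s).2| <= d) /\ (`|(z s).1| <= d /\ `|(z s).2| <= d),
        0 < F (y s), F (y s) = F (z s) /\ y s != z s,
        (y s).1 * pd false F (y s) + (y s).2 * pd true F (y s) = 0 &
        (z s).1 * pd false F (z s) + (z s).2 * pd true F (z s) = 0]) ->
  (y 1).1 * (z 1).2 - (y 1).2 * (z 1).1 != 0 ->
  (y 1).1 * (z 1).2 + (y 1).2 * (z 1).1 = 0.

(** [maxline] is increasing in the slope on either side of 0, so for a small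
    level [u] there are a positive and a negative slope, both continuous in
    [u], for which the maximum is [u]. The points of tangency form two paths
    on common leaves, and the reflection law makes the slopes opposite. *)
Lemma maxline_even d : 0 < d -> symmetric_near d ->
  exists2 t2, 0 < t2 <= t & forall th, 0 < th <= t2 -> M th = M (- th).
Proof.
move=> d0 sym.
have KM : 0 < K / m by rewrite divr_gt0.
have [t' [t'0 t't t'd]] : exists t', [/\ 0 < t', t' <= t & K / m * t' <= d].
  have [t' [a1 a2 a3]] := ex_min2 t0 (divr_gt0 d0 KM); exists t'; split => //.
  by rewrite mulrC; rewrite (@ler_pdivlMr _ (K / m) t' d KM) in a3.
have absn th : 0 <= th <= t' -> `|th| <= t /\ `|- th| <= t.
  by move=> /andP[th0 tht]; rewrite normrN ger0_norm // (le_trans tht).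
have cont (s : R) : `|s| = 1 -> {within `[0, t'], continuous (fun x => M (s * x))}.
  move=> s1; apply: (@lipschitz_within _ _ _ _ (K * L + K * (1 + L))) => x y hx hy.
  have [x1 _] := absn _ hx; have [y1 _] := absn _ hy.
  have -> : `|x - y| = `|s * x - s * y| by rewrite -mulrBr normrM s1 mul1r.
  by apply: maxline_lip; rewrite normrM s1 mul1r.
have mono (s : R) : `|s| = 1 -> forall x y, 0 <= x -> x < y -> y <= t' -> M (s * x) < M (s * y).
  move=> s1 x y x0 xy yt.
  have y0 : 0 < y by exact: le_lt_trans xy.
  have sn : s != 0 by rewrite -normr_eq0 s1 oner_eq0.
  have hy : `|s * y| <= t by rewrite normrM s1 mul1r; apply: (absn y _).1; rewrite yt ltW.
  have hx : `|s * x| <= t.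
    by rewrite normrM s1 mul1r; apply: (absn x _).1; rewrite x0 (le_trans (ltW xy)).
  have [->|xn] := eqVneq x 0.
    by rewrite mulr0 maxline0; apply: maxline_gt0 => //; rewrite mulf_neq0 // gt_eqF.
  apply: maxline_lt => //; rewrite -mulrBr mulrAC pmulr_lgt0 ?subr_gt0 //.
  have [g1 g2] := tangency_sign oO hF box Fx0 hx.
  have xp : 0 < x by rewrite lt_def xn.
  case: (ltgtP s 0) sn => // s0 _.
    by rewrite nmulr_rgt0 // g2 // nmulr_rlt0.
  by rewrite mulr_gt0 // g1 // mulr_gt0.
have n1 : `|-1 : R| = 1 by rewrite normrN normr1.
(* the positive slope and the negative one with a given level *)
have [hp [chp Hp]] := increasing_inverse (ltW t'0) (cont 1 (normr1 R)) (etrans (congr1 M (mulr0 1)) maxline0) (mono 1 (normr1 R)).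
have [hn [chn Hn]] := increasing_inverse (ltW t'0) (cont (-1) n1) (etrans (congr1 M (mulr0 (-1))) maxline0) (mono (-1) n1).
have M1 : 0 < M (1 * t') by rewrite mul1r; apply: maxline_gt0; [apply: (absn t' _).1; rewrite lexx ltW|rewrite gt_eqF].
have M2 : 0 < M (-1 * t') by rewrite mulN1r; apply: maxline_gt0; [apply: (absn t' _).2; rewrite lexx ltW|rewrite oppr_eq0 gt_eqF].
have [u1 [u10 u1a u1b]] : exists u1, [/\ 0 < u1, u1 <= M (1 * t') & u1 <= M (-1 * t')].
  exact: ex_min2.
have hpu u : 0 <= u <= u1 -> 0 <= hp u <= t' /\ M (hp u) = u.
  move=> /andP[u0 uu]; have [|h1 h2] := Hp u; first by rewrite u0 (le_trans uu).
  by rewrite mul1r in h2.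
have hnu u : 0 <= u <= u1 -> 0 <= hn u <= t' /\ M (- hn u) = u.
  move=> /andP[u0 uu]; have [|h1 h2] := Hn u; first by rewrite u0 (le_trans uu).
  by rewrite mulN1r in h2.
have u11 : 0 <= u1 <= u1 by rewrite lexx ltW.
have pos u : 0 < u <= u1 -> 0 < hp u /\ 0 < hn u.
  move=> /andP[u0 uu]; have uh : 0 <= u <= u1 by rewrite uu ltW.
  have [/andP[a1 a2] a3] := hpu u uh; have [/andP[b1 b2] b3] := hnu u uh.
  split; rewrite lt_def ?a1 ?b1 andbT; apply/negP => /eqP e.
    by move: a3; rewrite e maxline0 => e'; rewrite -e' ltxx in u0.
  by move: b3; rewrite e oppr0 maxline0 => e'; rewrite -e' ltxx in u0.
have inj x y : 0 <= x <= t' -> 0 <= y <= t' -> M x = M y -> x = y.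
  move=> /andP[x0 xt] /andP[y0 yt] e; have [xy|yx|//] := ltgtP x y.
    by have := mono 1 (normr1 R) x y x0 xy yt; rewrite !mul1r e ltxx.
  by have := mono 1 (normr1 R) y x y0 yx xt; rewrite !mul1r e ltxx.
exists (hp u1).
  by have [h1 _] := pos u1 (introT andP (conj u10 (lexx _))); have [/andP[_ h2] _] := hpu _ u11; rewrite h1 (le_trans h2).
move=> th /andP[th0 thu].
have [/andP[_ hpt] hpM] := hpu _ u11.
have tht' : 0 <= th <= t' by rewrite ltW //= (le_trans thu).
have [u uE] : exists u, u = M th by exists (M th).
have u0 : 0 < u by rewrite uE; apply: maxline_gt0; [exact: (absn _ tht').1|rewrite gt_eqF].
have uu : u <= u1.
  rewrite -hpM uE; have [->|tn] := eqVneq th (hp u1); first exact: lexx.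
  have := mono 1 (normr1 R) th (hp u1) (ltW th0) _ hpt; rewrite !mul1r => h; apply/ltW/h.
  by rewrite lt_def eq_sym tn.
have uh : 0 <= u <= u1 by rewrite uu ltW.
have hpth : hp u = th by have [h1 h2] := hpu u uh; apply: (inj _ _ h1 tht'); rewrite h2.
have su s : 0 <= s <= 1 -> 0 <= s * u <= u1.
  move=> /andP[s0 s1]; apply/andP; split; first exact: mulr_ge0 s0 (ltW u0).
  by apply: le_trans uu; rewrite ler_piMl // ltW.
have su' s : 0 < s <= 1 -> 0 < s * u <= u1.
  move=> /andP[s0 s1]; have hs : 0 <= s <= 1 by rewrite s1 ltW.
  by have /andP[_ h] := su _ hs; rewrite h andbT; exact: mulr_gt0.
have cs : {within `[0, 1], continuous (fun s : R => s * u)}.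
  by apply: (@lipschitz_within _ _ _ _ `|u|) => x y _ _; rewrite -mulrBl normrM mulrC.
have chp' : {within `[0, 1], continuous (fun s => hp (s * u))}.
  apply: (@within_comp (fun s => s * u) hp 0 1 0 (M (1 * t')) cs chp) => x /su /andP[-> h].
  exact: le_trans h u1a.
have chn' : {within `[0, 1], continuous (fun s => - hn (s * u))}.
  have : {within `[0, 1], continuous (fun s => hn (s * u))}.
    apply: (@within_comp (fun s => s * u) hn 0 1 0 (M (-1 * t')) cs chn) => x /su /andP[-> h].
    exact: le_trans h u1b.
  move=> /within_segmentP h; apply/within_segmentP => x hx e e0; have [dd dd0 hd] := h x hx e e0.
  exists dd => // y hy yx.
  by rewrite (_ : - hn (y * u) - - hn (x * u) = - (hn (y * u) - hn (x * u))) ?normrN; [exact: hd|ring].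
have tt : - t <= t by rewrite -subr_ge0 opprK addr_ge0 // ltW.
have ctang : {within `[- t, t], continuous tang}.
  by apply: (@lipschitz_within _ _ _ _ L) => x y hx hy; apply: tangency_lip; rewrite ler_norml.
have cheight : {within `[- t, t], continuous (fun th => th * tang th)}.
  by apply: (@lipschitz_within _ _ _ _ (1 + L)) => x y hx hy; apply: height_lip; rewrite ler_norml.
have cpath (k : R -> R) : {within `[0, 1], continuous k} -> (forall s, 0 <= s <= 1 -> - t <= k s <= t) ->
   {within `[0, 1], continuous (fun s => (tang (k s), k s * tang (k s)))}.
  move=> ck hk; apply: within_pair.
    exact: (within_comp ck ctang hk).
  exact: (within_comp ck cheight hk).
have kp s : 0 <= s <= 1 -> - t <= hp (s * u) <= t.
  move=> /su /hpu [/andP[h1 h2] _]; rewrite (le_trans _ h1) ?(le_trans h2) //.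
  by rewrite oppr_le0 ltW.
have kn s : 0 <= s <= 1 -> - t <= - hn (s * u) <= t.
  move=> /su /hnu [/andP[h1 h2] _]; rewrite lerN2 (le_trans h2) //=.
  by rewrite (le_trans _ (ltW t0)) // oppr_le0.
have small th' : `|th'| <= t' -> `|tang th'| <= d /\ `|th' * tang th'| <= d.
  move=> h; have ht : `|th'| <= t by exact: le_trans h t't.
  have := tangency_bound oO hF box Fx0 ht => hb.
  have h1 : `|tang th'| <= d.
    by apply: le_trans t'd; apply: le_trans hb _; apply: ler_wpM2l => //; exact: ltW.
  split => //; rewrite normrM; apply: le_trans h1; rewrite ler_piMl //; exact: le_trans t1.
have [/andP[hn0 hnt] hnM] := hnu u uh.
have [_ hnp] := pos u (introT andP (conj u0 uu)).
have := sym (fun s => (tang (hp (s * u)), hp (s * u) * tang (hp (s * u))))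
            (fun s => (tang (- hn (s * u)), - hn (s * u) * tang (- hn (s * u))))
            (cpath _ chp' kp) (cpath _ chn' kn).
have z0 : hp (0 * u) = 0.
  have [|h1 h2] := hpu (0 * u); first by rewrite mul0r lexx ltW.
  apply: (inj _ _ h1); first by rewrite lexx ltW.
  by rewrite h2 mul0r maxline0.
have z0' : hn (0 * u) = 0.
  have [|/andP[h1 h1'] h2] := hnu (0 * u); first by rewrite mul0r lexx ltW.
  have [//|hz] := eqVneq (hn (0 * u)) 0.
  have hp0 : 0 < hn (0 * u) by rewrite lt_def hz h1.
  have := mono (-1) n1 0 (hn (0 * u)) (lexx _) hp0 h1'.
  by rewrite mulr0 mulN1r h2 maxline0 mul0r ltxx.
rewrite /= z0 z0' oppr0 (tangency0 oO hF box Fx0) mulr0 => /(_ erefl erefl).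
rewrite !mul1r hpth.
have tth : `|th| <= t by exact: (absn _ tht').1.
have thn : `|- hn u| <= t by apply: (absn _ _).2; rewrite hn0.
have [sg1 _] := tangency_sign oO hF box Fx0 tth.
have [_ sg2] := tangency_sign oO hF box Fx0 thn.
have a0 := sg1 th0; have b0 : tang (- hn u) < 0 by apply: sg2; rewrite oppr_lt0.
have cross : tang th * (- hn u * tang (- hn u)) - th * tang th * tang (- hn u) != 0.
  have -> : tang th * (- hn u * tang (- hn u)) - th * tang th * tang (- hn u) =
    - (tang th * tang (- hn u) * (hn u + th)) by ring.
  by rewrite oppr_eq0 !mulf_neq0 // ?(gt_eqF a0) ?(lt_eqF b0) // gt_eqF // addr_gt0.
move=> H; have {H} := H _ cross => H.
have {H} : tang th * (- hn u * tang (- hn u)) + th * tang th * tang (- hn u) = 0.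
  apply: H => s hs; have hs' : 0 <= s <= 1 by case/andP: hs => h ->; rewrite ltW.
  have [/andP[p1 p2] pM] := hpu _ (su _ hs'); have [/andP[q1 q2] qM] := hnu _ (su _ hs').
  have [pp qq] := pos _ (su' _ hs).
  have pt : `|hp (s * u)| <= t' by rewrite ger0_norm.
  have qt : `|- hn (s * u)| <= t' by rewrite normrN ger0_norm.
  have ptt : `|hp (s * u)| <= t by exact: le_trans t't.
  have qtt : `|- hn (s * u)| <= t by exact: le_trans t't.
  have [_ c1] := tangP ptt; have [_ c2] := tangP qtt.
  have [g1 _] := tangency_sign oO hF box Fx0 ptt.
  have [_ g2] := tangency_sign oO hF box Fx0 qtt.
  rewrite /= -[F (tang (hp _), _)]/(M (hp (s * u))) -[F (tang (- hn _), _)]/(M (- hn (s * u))).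
  rewrite pM qM; split.
  - by split; exact: small.
  - by have /andP[] := su' _ hs.
  - split => //; apply/eqP => -[e _]; have := g1 pp; have : tang (- hn (s * u)) < 0 by apply: g2; rewrite oppr_lt0.
    by rewrite e => h1 /(lt_trans h1); rewrite ltxx.
  - have -> : forall x y z w : R, x * y + z * x * w = x * (y + z * w) by move=> *; ring.
    by rewrite -[_ + _]/(along F _ _) c1 mulr0.
  - have -> : forall x y z w : R, x * y + z * x * w = x * (y + z * w) by move=> *; ring.
    by rewrite -[_ + _]/(along F _ _) c2 mulr0.
have -> : tang th * (- hn u * tang (- hn u)) + th * tang th * tang (- hn u) =
    (tang th * tang (- hn u)) * (th - hn u) by ring.
move=> /eqP; rewrite !mulf_eq0 (gt_eqF a0) (lt_eqF b0) /= subr_eq0 => /eqP e.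
by rewrite -uE -{1}hnM -e.
Qed.

End OneFoliation.
End Even.

(** * Comparison of two even foliations *)

Section NoOrder.
Variable R : realType.
Local Notation plane := (plane R).
Implicit Types (F : plane -> R) (p q : plane) (O N : set plane) (th a b : R).

(** From [u <= K * a ^+ 2] the gain of a factor [u ^+ k] outweighs the loss of
    a factor [a]. *)
Lemma small_power (c C K u a : R) k : (0 < k)%N -> 0 < c -> 0 < K -> 0 <= C -> 0 < u -> u <= 1 ->
  0 < a -> u <= K * a ^+ 2 -> c * u ^+ k * a <= C * (u ^+ k) ^+ 2 -> c <= C * K * a.
Proof.
move=> k0 c0 K0 C0 u0 u1 a0 uK H.
have uk0 : 0 < u ^+ k by exact: exprn_gt0.
have h1 : c * a <= C * u ^+ k.
  by rewrite -(ler_pM2r uk0) mulrAC; apply: (le_trans H); rewrite expr2 mulrA.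
have h2 : u ^+ k <= u.
  by rewrite -(prednK k0) exprS ler_piMr ?exprn_ile1 // ltW.
have h3 : c * a <= C * (K * a ^+ 2).
  by apply: (le_trans h1); apply: ler_wpM2l => //; exact: le_trans uK.
by rewrite -(ler_pM2r a0); apply: (le_trans h3); rewrite expr2 !mulrA.
Qed.

(** The abscissa of a point of tangency is at least of order the square root
    of the level [u], so between the two points of tangency [F2] varies at
    least by a multiple of [u ^+ k * a]. But at these points the lines
    are tangent to leaves of the second foliation up to [u ^+ k], so
    [F2] is there within a multiple of [u ^+ k ^+ 2] of its maxima on the
    lines ([maxline_error]), and these maxima are equal. *)
Lemma no_order O F1 F2 r1 m1 K1 t1 r2 m2 K2 t2 s1 s2 (e c C : R) k :
  open O -> Cinf O F1 -> Cinf O F2 ->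
  line_box O F1 r1 m1 K1 t1 -> line_box O F2 r2 m2 K2 t2 ->
  F1 (0, 0) = 0 -> F2 (0, 0) = 0 -> pd false F1 (0, 0) = 0 -> pd false F2 (0, 0) = 0 ->
  0 < s1 <= t1 -> 0 < s2 <= t2 ->
  (forall th, 0 < th <= s1 -> maxline F1 r1 th = maxline F1 r1 (- th)) ->
  (forall th, 0 < th <= s2 -> maxline F2 r2 th = maxline F2 r2 (- th)) ->
  (0 < k)%N -> `|e| = 1 -> 0 < c ->
  (\forall q \near ((0, 0) : plane), 0 <= F1 q ->
     c * F1 q ^+ k <= e * djac F1 F2 q /\ `|djac F1 F2 q| <= C * F1 q ^+ k) -> False.
Proof.
move=> oO h1 h2 b1 b2 F10 F20 F1x F2x /andP[s10 s1t] /andP[s20 s2t] ev1 ev2 k0 e1 c0.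
move=> /near_square [d d0 H].
have m10 := lb_m b1; have m20 := lb_m b2; have K10 := lb_K b1; have K20 := lb_K b2.
have /andP[r10 r11] := lb_r b1; have /andP[r20 r21] := lb_r b2.
have d20 : 0 < d / 2 by rewrite divr_gt0.
have dd : d / 2 < d by move: d0; clear; lra.
have [be [be0 be1 be2]] := ex_min2 r10 d20.
have mb0 : 0 < m1 * be / (2 * K1) by rewrite divr_gt0 ?mulr_gt0.
have iK : 0 < K1^-1 by rewrite invr_gt0.
have [a1 [a10 a1a a1b]] := ex_min2 be0 mb0.
have [a2 [a20 a2a a2b]] := ex_min2 r20 iK.
have [al [al0 ala alb]] := ex_min2 a10 a20.
have albe : al <= be by exact: le_trans a1a.
have alr1 : al <= r1 by exact: le_trans be1.
have alr2 : al <= r2 by exact: le_trans a2a.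
have al1 : al <= 1 by exact: le_trans r11.
have Kal : K1 * al <= 1.
  by rewrite mulrC -ler_pdivlMr // mul1r; exact: le_trans a2b.
have K2al : 2 * (K1 * al) <= m1 * be.
  have h : al <= m1 * be / (2 * K1) by exact: le_trans a1b.
  rewrite (@ler_pdivlMr _ (2 * K1) al (m1 * be)) in h; last by rewrite mulr_gt0.
  by rewrite mulrA mulrC.
have [C2 C2E] : exists C2, C2 = `|C| ^+ 2 / m1 ^+ 2 / m2 * K1 by exists (`|C| ^+ 2 / m1 ^+ 2 / m2 * K1).
have C20 : 0 <= C2.
  by rewrite C2E mulr_ge0 ?divr_ge0 ?exprn_ge0 // ltW.
have Km0 : 0 < K1 / m1 by rewrite divr_gt0.
(* The slope [th] is chosen such that both points of tangency are inside the
   boxes and the abscissa of the right one contradicts [small_power]. *)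
have [w1 [w10 w1a w1b]] := ex_min2 s10 s20.
have x0 : 0 < al / 2 / (K1 / m1) by rewrite !divr_gt0.
have y0 : 0 < c / 2 / (C2 * K1 + 1) / (K1 / m1).
  by rewrite !divr_gt0 // ltr_wpDl // mulr_ge0 // ltW.
have [w2 [w20 w2a w2b]] := ex_min2 x0 y0.
have [th [th0 thw1 thw2]] := ex_min2 w10 w20.
have ths1 : 0 < th <= s1 by rewrite th0 (le_trans thw1).
have ths2 : 0 < th <= s2 by rewrite th0 (le_trans thw1).
have tht1 : `|th| <= t1 by rewrite (gtr0_norm th0); case/andP: ths1 => _ h; exact: le_trans h s1t.
have tht2 : `|th| <= t2 by rewrite (gtr0_norm th0); case/andP: ths2 => _ h; exact: le_trans h s2t.
have tht1n : `|- th| <= t1 by rewrite normrN.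
have tht2n : `|- th| <= t2 by rewrite normrN.
have Kth : K1 / m1 * th <= al / 2.
  by rewrite mulrC -(@ler_pdivlMr _ (K1 / m1) th (al / 2)) //; exact: (le_trans thw2 w2a).
have Kth2 : (C2 * K1 + 1) * (K1 / m1 * th) <= c / 2.
  have h : th <= c / 2 / (C2 * K1 + 1) / (K1 / m1) by exact: (le_trans thw2 w2b).
  rewrite (@ler_pdivlMr _ (K1 / m1) th _ Km0) in h.
  have z0 : 0 < C2 * K1 + 1 by rewrite ltr_wpDl // mulr_ge0 // ltW.
  rewrite (@ler_pdivlMr _ (C2 * K1 + 1) _ (c / 2) z0) in h.
  by rewrite mulrC (mulrC (K1 / m1)).
have [ap apE] : exists ap, ap = tangency F1 r1 th by exists (tangency F1 r1 th).
have [am amE] : exists am, am = tangency F1 r1 (- th) by exists (tangency F1 r1 (- th)).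
have [apr apc] : `|ap| <= r1 /\ along F1 th ap = 0 .
  by rewrite apE; exact: (tangencyP oO h1 b1 F1x tht1).
have [amr amc] : `|am| <= r1 /\ along F1 (- th) am = 0 .
  by rewrite amE; exact: (tangencyP oO h1 b1 F1x tht1n).
have apb : `|ap| <= al / 2.
  by rewrite apE; apply: le_trans Kth; apply: le_trans (tangency_bound oO h1 b1 F1x tht1) _; rewrite ger0_norm // ltW.
have amb : `|am| <= al / 2.
  by rewrite amE; apply: le_trans Kth; apply: le_trans (tangency_bound oO h1 b1 F1x tht1n) _; rewrite normrN ger0_norm // ltW.
have apK : ap <= K1 / m1 * th.
  by rewrite apE; apply: (le_trans (ler_norm _)); apply: le_trans (tangency_bound oO h1 b1 F1x tht1) _; rewrite ger0_norm // ltW.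
have ap0 : 0 < ap by rewrite apE; apply: (tangency_sign oO h1 b1 F1x tht1).1.
have am0 : am < 0 by rewrite amE; apply: (tangency_sign oO h1 b1 F1x tht1n).2; rewrite oppr_lt0.
have [u uE] : exists u, u = maxline F1 r1 th by exists (maxline F1 r1 th).
have up : F1 (ap, th * ap) = u by rewrite uE apE.
have um : F1 (am, - th * am) = u by rewrite uE (ev1 _ ths1) amE.
have u0 : 0 < u.
  by rewrite uE; apply: (maxline_gt0 oO h1 b1 F10 F1x) => //; rewrite gt_eqF.
have uK : u <= K1 * ap ^+ 2 by rewrite uE apE; apply: (maxline_le oO h1 b1 F10 F1x).
have al2 : al / 2 < al by move: al0; clear; lra.
have apal : ap <= al by apply: le_trans (ler_norm _) _; exact: le_trans apb (ltW al2).
have apr2 : `|ap| <= r2 by apply: le_trans alr2; exact: le_trans apb (ltW al2).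
have amr2 : `|am| <= r2 by apply: le_trans alr2; exact: le_trans amb (ltW al2).
have uKal : u <= K1 * al.
  apply: (le_trans uK); apply: ler_wpM2l; first exact: ltW.
  rewrite expr2; apply: (@le_trans _ _ (al * 1)); last by rewrite mulr1.
  by apply: ler_pM; [exact: ltW|exact: ltW|exact: apal|exact: le_trans apal al1].
have u1 : u <= 1 by exact: le_trans Kal.
have th1 : `|th| <= 1 by apply: le_trans tht1 _; case/andP: (lb_t b1).
have hb (x w : R) : `|x| <= al / 2 -> `|w| = `|th| -> `|w * x| <= be.
  move=> hx hw; rewrite normrM hw; apply: (@le_trans _ _ `|x|); first by rewrite ler_piMl.
  by apply: (le_trans hx); exact: le_trans (ltW al2) albe.
have [||rho [rh1 rh2 _ rh4]] := @leaf_graph R O F1 (0, 0) al be m1 K1 u (h1 1%N) (ltW al0) (ltW be0) m10.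
- move=> q; rewrite /= !subr0 => q1 q2.
  have q1' : `|q.1| <= r1 by exact: le_trans alr1.
  have q2' : `|q.2| <= r1 by exact: le_trans be1.
  split; [exact: (lb_O b1)| |exact: (lb_x b1)].
  by have /andP[] := lb_y b1 q1' q2'.
- move=> a; rewrite /= subr0 => ha.
  have r0' : `|(0 : R)| <= r1 by rewrite normr0 ltW.
  have ha' : `|a| <= r1 by exact: le_trans alr1.
  have := F_lip h1 b1 (p := (0, 0)) (q := (a, 0)) r0' r0' ha' r0'.
  rewrite /= F10 !subr0 normr0 mulr0 addr0 => fa.
  apply: (le_trans (ler_normB _ _)); rewrite (gtr0_norm u0).
  have : K1 * `|a| <= K1 * al by apply: ler_wpM2l => //; exact: ltW.
  by move: fa uKal K2al; clear; lra.
rewrite /= in rh1 rh2 rh4.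
have inal x : Num.min am ap <= x <= Num.max am ap -> `|x| < al.
  by move=> hx; apply: le_lt_trans al2; exact: between_le hx.
have inal' x : Num.min am ap <= x <= Num.max am ap -> `|x - 0| <= al.
  by move=> hx; rewrite subr0; exact/ltW/inal.
have rbox x : Num.min am ap <= x <= Num.max am ap -> `|x| <= r1 /\ `|rho x| <= r1.
  move=> hx; have [] := rh1 x (inal' _ hx); rewrite !subr0 => hr _; split; last exact: le_trans be1.
  by apply: le_trans alr1; exact/ltW/inal.
have mm : Num.min am ap = am by rewrite min_l // ltW // (lt_trans am0).
have MM : Num.max am ap = ap by rewrite max_r // ltW // (lt_trans am0).
have amap : am <= ap by rewrite ltW // (lt_trans am0).
have pin : Num.min am ap <= ap <= Num.max am ap by rewrite mm MM amap lexx.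
have min' : Num.min am ap <= am <= Num.max am ap by rewrite mm MM amap lexx.
have rp : th * ap = rho ap by apply: (rh2 _ _ (inal' _ pin)) => //; rewrite subr0; apply: hb.
have rm : - th * am = rho am by apply: (rh2 _ _ (inal' _ min')) => //; rewrite subr0; apply: hb; rewrite ?normrN.
have [x hx|x hx E] := @leaf_variation R O F1 F2 rho am ap oO (h1 1%N) (h2 1%N).
  have [q1 q2] := rbox _ hx; have /andP[y1 _] := lb_y b1 (q := (x, rho x)) q1 q2.
  split; [exact: (lb_O b1)|by rewrite gt_eqF // (lt_le_trans m10)|].
  by apply: rh4; rewrite subr0; exact: inal.
rewrite -rp -rm in E.
have [q1 q2] := rbox _ hx; have /andP[y1 y2] := lb_y b1 (q := (x, rho x)) q1 q2.
have [rb ru] := rh1 x (inal' _ hx); rewrite subr0 in rb.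
have [|||low _] := H (x, rho x); rewrite /= ?subr0.
- by apply: lt_le_trans (inal _ hx) _; apply: (le_trans albe); exact: le_trans be2 (ltW dd).
- by apply: (le_lt_trans rb); exact: le_lt_trans be2 dd.
- by rewrite ru ltW.
rewrite ru in low.
have lowD : c * u ^+ k <= `|djac F1 F2 (x, rho x)|.
  by apply: (le_trans low); apply: (le_trans (ler_norm _)); rewrite normrM e1 mul1r.
have lower : c / K1 * u ^+ k * ap <= `|F2 (ap, th * ap) - F2 (am, - th * am)|.
  rewrite E normrM normrN normrM normfV.
  have y10 : 0 < pd true F1 (x, rho x) by exact: lt_le_trans y1.
  apply: ler_pM; [by rewrite mulr_ge0 ?divr_ge0 ?exprn_ge0 ?ltW|exact: ltW| |].
    rewrite mulrAC; apply: ler_pM; [by rewrite mulr_ge0 ?exprn_ge0 ?ltW|by rewrite invr_ge0 ltW|exact: lowD|].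
    by rewrite gtr0_norm // lef_pV2.
  by rewrite ger0_norm; move: am0 ap0; clear; lra.
(* where the line is tangent to a leaf of [F1], its derivative of [F2] is
   proportional to the determinant *)
have err (w a : R) : `|w| = `|th| -> `|a| <= al / 2 -> along F1 w a = 0 -> F1 (a, w * a) = u ->
    `|along F2 w a| <= `|C| * u ^+ k / m1.
  move=> hw ha hal hu.
  have ha' : `|a| <= al by exact: le_trans ha (ltW al2).
  have ha1 : `|a| <= r1 by exact: le_trans alr1.
  have hwa : `|w * a| <= be by exact: hb.
  have hwa1 : `|w * a| <= r1 by exact: le_trans be1.
  have [|||_ hi] := H (a, w * a); rewrite /= ?subr0; [by apply: (le_lt_trans ha'); apply: (le_lt_trans albe); exact: le_lt_trans be2 dd|by apply: (le_lt_trans hwa); exact: le_lt_trans be2 dd|by rewrite hu ltW|].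
  rewrite hu in hi.
  have /andP[y1' _] := lb_y b1 (q := (a, w * a)) ha1 hwa1.
  have y10 : 0 < pd true F1 (a, w * a) by exact: lt_le_trans y1'.
  have E2 : pd true F1 (a, w * a) * along F2 w a = - djac F1 F2 (a, w * a).
    have e3 : pd false F1 (a, w * a) = - (w * pd true F1 (a, w * a)) by move: hal; rewrite /along => /eqP; rewrite addr_eq0 => /eqP.
    by rewrite /along /djac e3; ring.
  rewrite ler_pdivlMr //; apply: (@le_trans _ _ `|pd true F1 (a, w * a) * along F2 w a|).
    by rewrite normrM mulrC (gtr0_norm y10); apply: ler_wpM2r.
  rewrite E2 normrN; apply: (le_trans hi); apply: ler_wpM2r; first exact/exprn_ge0/ltW.
  exact: ler_norm.
have e_p := err th ap erefl apb apc up.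
have e_m := err (- th) am (normrN th) amb amc um.
have /andP[p1 p2] := maxline_error oO h2 b2 F2x tht2 apr2.
have /andP[n1 n2] := maxline_error oO h2 b2 F2x tht2n amr2.
rewrite -(ev2 _ ths2) in n1 n2.
have sq (x' : R) : `|x'| <= `|C| * u ^+ k / m1 -> `|x'| ^+ 2 / m2 <= C2 / K1 * (u ^+ k) ^+ 2.
  move=> hx'; have -> : C2 / K1 * (u ^+ k) ^+ 2 = (`|C| * u ^+ k / m1) ^+ 2 / m2.
    by rewrite C2E; field; rewrite !gt_eqF.
  apply: ler_wpM2r; first by rewrite invr_ge0 ltW.
  by apply: lerXn2r => //; rewrite nnegrE; exact: le_trans hx'.
have upper : `|F2 (ap, th * ap) - F2 (am, - th * am)| <= C2 / K1 * (u ^+ k) ^+ 2.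
  have := sq _ e_p; have := sq _ e_m; rewrite ler_norml; move: p1 p2 n1 n2; clear; lra.
have key : c / K1 * u ^+ k * ap <= C2 / K1 * (u ^+ k) ^+ 2 by exact: le_trans upper.
have fin : c / K1 <= C2 / K1 * K1 * ap.
  by apply: (small_power k0 _ K10 _ u0 u1 ap0 uK key); [rewrite divr_gt0|rewrite divr_ge0 // ltW].
have fin2 : c <= C2 * K1 * ap.
  by rewrite -(@ler_pM2r _ K1^-1) //; rewrite (_ : C2 * K1 * ap / K1 = C2 / K1 * K1 * ap) //; ring.
have fin3 : C2 * K1 * ap <= c / 2.
  apply: le_trans Kth2; apply: ler_pM; [by rewrite mulr_ge0 // ltW|exact: ltW|by rewrite lerDl|exact: apK].
by move: c0 fin2 fin3; clear; lra.
Qed.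

End NoOrder.

(** * Transversal parameters near the boundary *)

Section LocalParam.
Variable R : realType.
Local Notation plane := (plane R).
Implicit Types (f g : plane -> R) (p q : plane) (O N A U : set plane).

Lemma pd_comp O f (g1 g2 : plane -> R) p b d1 d2 : open O -> Cn 1 O f -> O (g1 p, g2 p) ->
  is_derive p (axis R b) g1 d1 -> is_derive p (axis R b) g2 d2 ->
  pd b (fun q => f (g1 q, g2 q)) p = d1 * pd false f (g1 p, g2 p) + d2 * pd true f (g1 p, g2 p).
Proof. by move=> oO hf Og h1 h2; have [_] := chain_plane oO hf Og h1 h2. Qed.

Lemma pd_is_derive O f p b : Cn 1 O f -> O p -> is_derive p (axis R b) f (pd b f p).
Proof. by move=> h Op; apply/derivableP/(Cn_derivable h). Qed.

Lemma djac_comp O O' f1 f2 (g1 g2 : plane -> R) p : open O -> Cn 1 O f1 -> Cn 1 O f2 ->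
  Cn 1 O' g1 -> Cn 1 O' g2 -> O' p -> O (g1 p, g2 p) ->
  djac (fun q => f1 (g1 q, g2 q)) (fun q => f2 (g1 q, g2 q)) p =
    djac f1 f2 (g1 p, g2 p) * djac g1 g2 p.
Proof.
move=> oO h1 h2 k1 k2 Op Og; rewrite {1}/djac.
rewrite !(pd_comp oO h1 Og (pd_is_derive _ k1 Op) (pd_is_derive _ k2 Op)).
rewrite !(pd_comp oO h2 Og (pd_is_derive _ k1 Op) (pd_is_derive _ k2 Op)).
rewrite /djac; move: (pd false f1 _) (pd true f1 _) (pd false f2 _) (pd true f2 _).
by move: (pd false g1 _) (pd true g1 _) (pd false g2 _) (pd true g2 _) => *; ring.
Qed.

Lemma cramer_zero (a b c d x y : R) : a * d - b * c != 0 ->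
  a * x + c * y = 0 -> b * x + d * y = 0 -> x = 0 /\ y = 0.
Proof.
move=> j0 e1 e2; split; apply: (mulfI j0); rewrite mulr0.
  have -> : (a * d - b * c) * x = d * (a * x + c * y) - c * (b * x + d * y) by ring.
  by rewrite e1 e2 !mulr0 subrr.
have -> : (a * d - b * c) * y = a * (b * x + d * y) - b * (a * x + c * y) by ring.
by rewrite e1 e2 !mulr0 subrr.
Qed.

Lemma preimage_open (Ox O : set plane) (x1 x2 : plane -> R) : open Ox -> open O -> Cinf Ox x1 -> Cinf Ox x2 ->
  open (Ox `&` (fun q => (x1 q, x2 q)) @^-1` O).
Proof.
move=> oOx oO h1 h2; rewrite openE => q [Oq OXq]; apply: filterI; first by apply: open_nbhs_nbhs.
have cX : {for q, continuous (fun q => (x1 q, x2 q))}.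
  apply: (@cvg_pair _ _ _ (nbhs q) (nbhs (x1 q)) (nbhs (x2 q))).
    exact: (Cn_cont (h1 0%N) Oq).
  exact: (Cn_cont (h2 0%N) Oq).
by apply: (cX O); apply: open_nbhs_nbhs.
Qed.

(** The bound is asked on the right only, since the functions to which it is
    applied are controlled inside the domain. *)
Lemma derive_ge0_right (g : R -> R) (x l d : R) : is_derive x 1 g l -> 0 < d ->
  (forall h, 0 < h < d -> g x <= g (h + x)) -> 0 <= l.
Proof.
move=> /is_derive_cvg /cvgrPdist_lt H d0 hg; rewrite leNgt; apply/negP => l0.
have l0' : 0 < - l by rewrite oppr_gt0.
have := H _ l0'; rewrite near_withinE => /near_interval [d1 d10 h1].
have [h [h0 hd1 hd]] := ex_min2 d10 d0.
have h20 : 0 < h / 2 by rewrite divr_gt0.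
have h2h : h / 2 < h by move: h0; clear; lra.
have := h1 (h / 2); rewrite subr0 (gtr0_norm h20) => /(_ (lt_le_trans h2h hd1)).
rewrite gt_eqF // => /(_ isT); rewrite /shift /= [h / 2 *: 1]mulr1.
have : 0 <= (h / 2)^-1 *: (g (h / 2 + x) - g x).
  rewrite /GRing.scale /= mulr_ge0 ?invr_ge0 ?(ltW h20) // subr_ge0; apply: hg.
  by rewrite h20 (lt_le_trans h2h).
move: (_ *: _) => w w0; rewrite ltr_norml => /andP[]; lra.
Qed.

(** A transversal parameter near the boundary point [X (t, 0)], normalized to
    vanish on the boundary; the chart [X] straightens the boundary, and
    [lf_domain] recovers the domain from the sign of the parameter. *)
Record leaf_function A (h : plane -> R) (T : plane -> set plane)
    (X : plane -> plane) (t : R) O f : Prop := LeafFunction {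
  lf_open : open O; lf_in : O (X (t, 0)); lf_smooth : Cinf O f;
  lf_kernel : forall q, O q -> A q -> T q = kernel_field f q;
  lf_level : forall p q, O p -> O q -> A p -> A q -> (h p <= h q) = (f p <= f q);
  lf_domain : \forall q \near X (t, 0), A q <-> 0 <= f q;
  lf_boundary : \forall s \near t, f (X (s, 0)) = 0;
  lf_transverse : 0 < pd true (f \o X) (t, 0) }.

Section Chart.
Variables (I : set R) (bd nu : R -> plane) (Ox : set plane) (x1 x2 : plane -> R).
Let X q : plane := (x1 q, x2 q).
Hypothesis (oI : open I) (oOx : open Ox) (OxI : forall s, I s -> Ox (s, 0)).
Hypothesis (hx1 : Cinf Ox x1) (hx2 : Cinf Ox x2).
Hypothesis (XE : forall s r, I s -> X (s, r) = bd s + r *: nu s).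
Hypothesis (XJ : forall s, I s -> djac x1 x2 (s, 0) != 0).

Lemma chart_bd s : I s -> X (s, 0) = bd s.
Proof. by move=> Is; rewrite XE // scale0r addr0. Qed.

Lemma chart_open s (W : set plane) : I s -> nbhs ((s, 0) : plane) W -> nbhs (X (s, 0)) (X @` W).
Proof. by move=> Is nW; apply: (local_homeo_open_map oOx (OxI Is) hx1 hx2 (XJ Is) nW). Qed.

Lemma kernel_fieldBC O f (k : R) q : open O -> Cinf O f -> O q ->
  kernel_field (fun q => f q - k) q = kernel_field f q.
Proof.
move=> oO hf Oq; apply/funext => v; apply/propext; rewrite /kernel_field /=.
have -> : 'D_v (fun q => f q - k) q = 'D_v f q; last by [].
have [df _] := C1_differentiable oO (hf 1%N) Oq.
have d1 : is_derive q v f ('D_v f q) by apply/derivableP/diff_derivable.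
by have [_ ->] := is_deriveB d1 (is_derive_cst k q v); rewrite subr0.
Qed.

Lemma near_fst (t : R) (P : set R) : nbhs t P -> \forall q \near ((t, 0) : plane), P q.1.
Proof. by move=> /near_interval [d d0 H]; apply/near_square; exists d => // q h _; apply: H. Qed.

Lemma near_axis (t : R) (P : set plane) : nbhs ((t, 0) : plane) P -> \forall s \near t, P (s, 0).
Proof.
move=> /near_square [d d0 H]; apply/near_interval; exists d => // s h; apply: H => //=.
by rewrite subrr normr0.
Qed.

Lemma chart_cont s : I s -> {for ((s, 0) : plane), continuous X}.
Proof.
move=> Is; apply: (@cvg_pair _ _ _ (nbhs ((s, 0) : plane)) (nbhs (x1 (s, 0))) (nbhs (x2 (s, 0)))).
  exact: (Cn_cont (hx1 0%N) (OxI Is)).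
exact: (Cn_cont (hx2 0%N) (OxI Is)).
Qed.

Lemma pd_chart O f b s : open O -> Cinf O f -> I s -> O (X (s, 0)) ->
  pd b (f \o X) (s, 0) = pd b x1 (s, 0) * pd false f (X (s, 0)) + pd b x2 (s, 0) * pd true f (X (s, 0)).
Proof.
move=> oO hf Is Os.
exact: (pd_comp oO (hf 1%N) Os (pd_is_derive b (hx1 1%N) (OxI Is)) (pd_is_derive b (hx2 1%N) (OxI Is))).
Qed.

Lemma pd_along_boundary (f : plane -> R) t : (\forall s \near t, f (s, 0) = 0) ->
  derivable f (t, 0) (axis R false) -> pd false f (t, 0) = 0.
Proof.
move=> nf df; have [_ <-] := is_derive_x df.
rewrite (@near_eq_derive _ _ _ _ (fun=> 0)); last by [].
by rewrite derive_cst.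
Qed.

(** Subtract from a given transversal parameter its value at the boundary point.
    It is constant along the boundary because [h] is, and its vertical
    derivative in the chart is nonnegative because [h] is positive inside. It
    cannot vanish, since the derivative along the boundary vanishes already
    and the parameter is a submersion. *)
Lemma local_param U (h : plane -> R) (T : plane -> set plane) (t : R) : Defs.adjacent I bd nu U -> level_foliation I bd U h T -> I t ->
  exists O f, leaf_function (with_boundary I bd U) h T X t O f.
Proof.
move=> [oU _ Ubd _ side] [_ h0 hU par] It; set A := with_boundary I bd U.
have Abd s : I s -> A (bd s) by move=> Is; right; exists s.
have [ O [f0 [oO Ot [[sf sub] lev ker]]]] := par (bd t) (Abd t It).
have hf0 : Cinf O f0 by apply/smooth_Cinf.
pose f q := f0 q - f0 (bd t).
have hf : Cinf O f by move=> n; apply: CnB => //; exact: Cn_cst.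
have OX : O (X (t, 0)) by rewrite chart_bd.
have pdf b q : O q -> pd b f q = pd b f0 q.
  by move=> Oq; rewrite /pd; have [_ ->] := is_deriveB (pd_is_derive b (hf0 1%N) Oq) (is_derive_cst (f0 (bd t)) q (axis R b)); rewrite subr0.
have [d1 d10 sd] := side t It.
have nI : \forall s \near t, I s by apply: open_nbhs_nbhs.
have nX : \forall q \near ((t, 0) : plane), O (X q) by apply: (chart_cont It); apply: open_nbhs_nbhs.
have lev' p q : O p -> O q -> A p -> A q -> (h p <= h q) = (f p <= f q).
  by move=> Op Oq Ap Aq; rewrite lev // /f lerD2r.
have fbd s : I s -> O (bd s) -> f (bd s) = 0.
  move=> Is Os; apply/eqP; rewrite eq_le -[0](subrr (f0 (bd t))) -!/(f _).
  have At := Abd t It; have As := Abd s Is; rewrite chart_bd // in OX.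
  by rewrite -!lev' // !h0 // lexx.
have fU q : U q -> O q -> 0 < f q.
  move=> Uq Oq; rewrite ltNge -[0](subrr (f0 (bd t))) -/(f _).
  rewrite chart_bd // in OX; rewrite -lev' //; last exact: Abd.
    by rewrite h0 // -ltNge; exact: hU.
  by left.
have nfb : \forall s \near t, f (X (s, 0)) = 0.
  have := near_and nI (near_axis nX); apply: filterS => s [Is Os].
  by rewrite chart_bd //; apply: fbd => //; rewrite -chart_bd.
have Oxt := OxI It.
have dX b : derivable (f \o X) (t, 0) (axis R b).
  by have [] := chain_plane oO (hf 1%N) OX (pd_is_derive b (hx1 1%N) Oxt) (pd_is_derive b (hx2 1%N) Oxt).
have pf0 : pd false (f \o X) (t, 0) = 0 by apply: pd_along_boundary.
have Ut r : 0 < r < d1 -> U (X (t, r)).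
  by move=> hr; apply: sd; exists t, r; split; rewrite ?subrr ?normr0 // XE.
have pt : 0 < pd true (f \o X) (t, 0).
  rewrite lt_def; apply/andP; split.
    apply/negP => /eqP pt0; rewrite (pd_chart _ oO hf It OX) in pf0; rewrite (pd_chart _ oO hf It OX) in pt0.
    have [v] := sub _ Ot; rewrite -chart_bd //.
    rewrite (C1_differentiable oO (hf0 1%N) OX).2 -!pdf // => /eqP; apply.
    have J0 := XJ It; rewrite /djac in J0.
    have [e1 e2] := cramer_zero J0 pf0 pt0.
    by rewrite e1 e2 !mulr0 addr0.
  have /near_square [d2 d20 HO] := nX.
  have [d [d0 da db]] := ex_min2 d10 d20.
  apply: (derive_ge0_right (is_derive_y (dX true)) d0) => r /andP[r0 rd].
  rewrite addr0 /= (nbhs_singleton nfb : f (X (t, 0)) = 0).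
  apply: ltW; apply: fU; first by apply: Ut; rewrite r0 (lt_le_trans rd).
  by apply: HO; rewrite /= ?subrr ?normr0 // subr0 gtr0_norm // (lt_le_trans rd).
exists O, f; split => //.
- by move=> q Oq Aq; rewrite ker // /f (kernel_fieldBC _ oO hf0 Oq).
pose Ox' := Ox `&` X @^-1` O.
have oOx' : open Ox' by exact: (preimage_open oOx oO hx1 hx2).
have sOx : Ox' `<=` Ox by move=> q [].
have hfX : Cinf Ox' (f \o X).
  move=> n; apply: (@Cn_comp R n O Ox' f x1 x2) => //.
  - by move=> //; exact: Cn_sub sOx (hx1 n).
  - exact: Cn_sub sOx (hx2 n).
  - by move=> q [].
have Oxt' : Ox' (t, 0) by split.
have [m [M [m0 M0 nm]]] := @comparable_height R Ox' (f \o X) t oOx' (hfX 1%N) Oxt' ((near_interval _ _).1 nfb) pt.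
have nd : \forall q \near ((t, 0) : plane), `|q.1 - t| < d1 /\ `|q.2| < d1.
  by apply/near_square; exists d1 => // q; rewrite subr0.
have := near_and (near_fst nI) (near_and nX (near_and nm nd)).
move=> /(chart_open It); apply: filterS => _ [[s r] [Is [Os [[h1 h2] [sd1 rd]]]] <-].
rewrite /= in Is h1 h2 sd1 rd.
split=> [[Uq|[s' Is' e]]|fq].
- by apply: ltW; apply: fU.
- by rewrite -e fbd // e.
- have [r0|r0|r0] := ltgtP r 0.
  + by have := h2 r0; rewrite ltNge fq.
  + left; apply: sd; exists s, r; split => //; last exact: XE.
    by rewrite r0 /=; move: rd; rewrite gtr0_norm.
  + by rewrite r0 chart_bd //; exact: Abd.
Qed.

(** Flatness at one point is proved from the behavior at the neighboring
    boundary points, with one and the same parameter. *)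
Lemma leaf_function_near A (h : plane -> R) (T : plane -> set plane) (t : R) O f : I t -> leaf_function A h T X t O f ->
  \forall s \near t, I s /\ leaf_function A h T X s O f.
Proof.
move=> It [oO Ot hf ker lev dom bdz tr].
have nI : \forall s \near t, I s by apply: open_nbhs_nbhs.
have nO : \forall s \near t, O (X (s, 0)).
  by apply: (near_axis (P := X @^-1` O)); apply: (chart_cont It); apply: open_nbhs_nbhs.
have ndom : \forall s \near t, \forall q \near X (s, 0), A q <-> 0 <= f q.
  apply: (near_axis (P := fun q => \forall q' \near X q, A q' <-> 0 <= f q')).
  exact: (chart_cont It (nbhs_interior dom)).
have nbdz : \forall s \near t, \forall s' \near s, f (X (s', 0)) = 0 by exact: nbhs_interior bdz.
have ntr : \forall s \near t, 0 < pd true x1 (s, 0) * pd false f (X (s, 0)) + pd true x2 (s, 0) * pd true f (X (s, 0)).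
  apply: (near_axis (P := fun q => 0 < pd true x1 q * pd false f (X q) + pd true x2 q * pd true f (X q))).
  have c : {for ((t, 0) : plane), continuous (fun q => pd true x1 q * pd false f (X q) + pd true x2 q * pd true f (X q))}.
    apply: cvgD; apply: cvgM.
    - exact: (Cn_cont (Cn_pd true (hx1 1%N)) (OxI It)).
    - by apply: (@continuous_comp _ _ _ X (pd false f)); [exact: chart_cont|exact: (Cn_cont (Cn_pd false (hf 1%N)) Ot)].
    - exact: (Cn_cont (Cn_pd true (hx2 1%N)) (OxI It)).
    - by apply: (@continuous_comp _ _ _ X (pd true f)); [exact: chart_cont|exact: (Cn_cont (Cn_pd true (hf 1%N)) Ot)].
  rewrite (pd_chart _ oO hf It Ot) in tr.
  by apply: (c (fun x => 0 < x)); apply: open_nbhs_nbhs; split => //; exact: open_gt.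
have := near_and (near_and nI nO) (near_and ndom (near_and nbdz ntr)).
apply: filterS => s [[Is Os] [ds [bs ts]]]; split => //; split => //.
by rewrite (pd_chart _ oO hf Is Os).
Qed.

End Chart.
End LocalParam.

(** * Normal coordinates at a point of a strictly convex curve *)

Section Normal.
Variable R : realType.
Local Notation plane := (plane R).
Implicit Types (f g : plane -> R) (p q : plane) (O N A U : set plane).

Definition proj (Psi : plane -> plane) (o w q : plane) : R := dot (Psi q - o) w.

Lemma proj_Cinf O Psi o w : open O -> Cinf O (fun q => (Psi q).1) -> Cinf O (fun q => (Psi q).2) ->
  Cinf O (proj Psi o w).
Proof.
move=> oO h1 h2 n.
have k1 : Cn n O (fun q => ((Psi q).1 - o.1) * w.1).
  by apply: CnM => //; [apply: CnB => //; exact: Cn_cst|exact: Cn_cst].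
have k2 : Cn n O (fun q => ((Psi q).2 - o.2) * w.2).
  by apply: CnM => //; [apply: CnB => //; exact: Cn_cst|exact: Cn_cst].
exact: CnD oO k1 k2.
Qed.

Lemma is_derive_proj (V : normedModType R) (G : V -> plane) (x v : V) (d o w : plane) :
  is_derive x v G d -> is_derive x v (fun y => dot (G y - o) w) (dot d w).
Proof.
move=> /is_derive_pair [h1 h2].
have k1 : is_derive x v (fun y => ((G y).1 - o.1) * w.1) (d.1 * w.1).
  have := is_deriveM (is_deriveB h1 (is_derive_cst o.1 x v)) (is_derive_cst w.1 x v).
  by rewrite subr0 scaler0 add0r [_ *: _]mulrC.
have k2 : is_derive x v (fun y => ((G y).2 - o.2) * w.2) (d.2 * w.2).
  have := is_deriveM (is_deriveB h2 (is_derive_cst o.2 x v)) (is_derive_cst w.2 x v).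
  by rewrite subr0 scaler0 add0r [_ *: _]mulrC.
exact: (is_deriveD k1 k2).
Qed.

(** What the settings have in common: to second order the image of the boundary
    is the strictly convex curve [c], and the domain lies on its convex side.
    It is formulated by test functions because for a covering it is not known
    beforehand that a neighborhood of [c s0] on the curve is covered by a
    neighborhood of [t] on the boundary. *)
Definition contact (Psi : plane -> plane) U (bd : R -> plane) (t : R) (c : R -> plane) (s0 : R) (n : plane) :=
  forall N (L : plane -> R), open N -> N (c s0) -> Cinf N L ->
    (\forall s \near t, L (Psi (bd s)) = 0) ->
    (\forall q \near bd t, U q -> 0 < L (Psi q)) ->
    [/\ is_derive s0 1 (L \o c) 0, is_derive s0 1 (derive1 (L \o c)) 0
      & 0 <= 'D_n L (c s0)].

(** The local inverse of the coordinates
    [q |-> (dot (Psi q - o) tau, dot (Psi q - o) n)], in which the tangent of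
    the curve is the horizontal axis and its convex side is above. *)
Record normal_chart O (Psi : plane -> plane) (o tau n p : plane) N (th1 th2 : plane -> R) : Prop :=
  NormalChart {
  nc_open : open N; nc_in : N (0, 0); nc_1 : Cinf N th1; nc_2 : Cinf N th2;
  nc_right : forall y, N y -> O (th1 y, th2 y) /\
    (proj Psi o tau (th1 y, th2 y), proj Psi o n (th1 y, th2 y)) = y;
  nc_left : \forall q \near p, N (proj Psi o tau q, proj Psi o n q) /\
    (th1 (proj Psi o tau q, proj Psi o n q), th2 (proj Psi o tau q, proj Psi o n q)) = q }.

Lemma ex_normal_chart O Psi tau n p : open O -> O p ->
  Cinf O (fun q => (Psi q).1) -> Cinf O (fun q => (Psi q).2) ->
  djac (fun q => (Psi q).1) (fun q => (Psi q).2) p != 0 -> det2 tau n != 0 ->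
  exists N th1 th2, normal_chart O Psi (Psi p) tau n p N th1 th2.
Proof.
move=> oO Op h1 h2 j0 d0.
have k1 := proj_Cinf (Psi p) tau oO h1 h2; have k2 := proj_Cinf (Psi p) n oO h1 h2.
have dp w b : pd b (proj Psi (Psi p) w) p = pd b (fun q => (Psi q).1) p * w.1 + pd b (fun q => (Psi q).2) p * w.2.
  have h : is_derive p (axis R b) Psi (pd b (fun q => (Psi q).1) p, pd b (fun q => (Psi q).2) p).
    by apply/is_derive_pair; split; [exact: pd_is_derive (h1 1%N) Op|exact: pd_is_derive (h2 1%N) Op].
  by have [_] := is_derive_proj (Psi p) w h.
have jE : djac (proj Psi (Psi p) tau) (proj Psi (Psi p) n) p =
   djac (fun q => (Psi q).1) (fun q => (Psi q).2) p * det2 tau n.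
  by rewrite /djac !dp /det2; move: (pd _ _ _) (pd _ _ _) (pd _ _ _) (pd _ _ _) => *; ring.
have j1 : djac (proj Psi (Psi p) tau) (proj Psi (Psi p) n) p != 0 by rewrite jE mulf_neq0.
have [N [t1 [t2 [[oN Np] c1 c2 H1 H2]]]] := inverse_function oO Op k1 k2 j1.
exists N, t1, t2; split => //.
by move: Np; rewrite /proj subrr /dot /= !mul0r addr0.
Qed.

Section AtPoint.
Variables (I : set R) (bd nu : R -> plane) (Ox : set plane) (x1 x2 : plane -> R).
Let X q : plane := (x1 q, x2 q).
Hypothesis (oI : open I) (oOx : open Ox) (OxI : forall s, I s -> Ox (s, 0)).
Hypothesis (hx1 : Cinf Ox x1) (hx2 : Cinf Ox x2).
Hypothesis (XE : forall s r, I s -> X (s, r) = bd s + r *: nu s).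
Hypothesis (XJ : forall s, I s -> djac x1 x2 (s, 0) != 0).

Variables (t : R) (Psi : plane -> plane) (O : set plane) (N : set plane) (th1 th2 : plane -> R).
Hypothesis (It : I t) (oO : open O) (Ot : O (bd t)).
Hypothesis (hP1 : Cinf O (fun q => (Psi q).1)) (hP2 : Cinf O (fun q => (Psi q).2)).

Variables (c dc : R -> plane) (s0 : R) (tau c2 n : plane) (kap : R).
Hypothesis (cs0 : c s0 = Psi (bd t)).
Hypothesis (c_der : \forall s \near s0, is_derive (s : R) 1 c (dc s)).
Hypothesis (c_tau : dc s0 = tau).
Hypothesis (c_der2 : is_derive s0 1 dc c2).
Hypothesis (kapE : kap = det2 tau c2) (kap0 : kap != 0).
Hypothesis (nE : n = kap *: (- tau.2, tau.1)).

Hypothesis (nc : normal_chart O Psi (Psi (bd t)) tau n (bd t) N th1 th2).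
Let o := Psi (bd t).
Let N1 := proj Psi o tau.
Let N2 := proj Psi o n.

Lemma tau_neq0 : 0 < dot tau tau.
Proof.
rewrite lt_def; apply/andP; split; last by rewrite /dot -!expr2 addr_ge0 // sqr_ge0.
apply/negP => /eqP; rewrite /dot -!expr2 => /eqP; rewrite paddr_eq0 ?sqr_ge0 // !sqrf_eq0 => /andP[/eqP e1 /eqP e2].
by move: kap0; rewrite kapE /det2 e1 e2 !mul0r subrr eqxx.
Qed.

Lemma dot_tau_n : dot tau n = 0.
Proof. by rewrite nE /dot /GRing.scale /= /GRing.scale /=; ring. Qed.

Lemma dot_c2_n : dot c2 n = kap ^+ 2.
Proof. by rewrite nE /dot kapE /det2 /GRing.scale /= /GRing.scale /=; ring. Qed.

Lemma dot_n u : dot u n = kap * det2 tau u.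
Proof. by rewrite nE /dot /det2 /GRing.scale /= /GRing.scale /=; ring. Qed.

Lemma dot_n_n : 0 < dot n n.
Proof.
rewrite dot_n nE; have -> : kap * det2 tau (kap *: (- tau.2, tau.1)) = kap ^+ 2 * dot tau tau.
  by rewrite /dot /det2 /GRing.scale /= /GRing.scale /=; ring.
by rewrite mulr_gt0 ?tau_neq0 // lt_def sqr_ge0 sqrf_eq0 kap0.
Qed.

Lemma N_bd : (N1 (bd t), N2 (bd t)) = (0, 0).
Proof. by rewrite /N1 /N2 /proj subrr /dot /= !mul0r addr0. Qed.

Lemma theta0 : (th1 (0, 0), th2 (0, 0)) = bd t.
Proof. by have [_] := nbhs_singleton (nc_left nc); rewrite -/N1 -/N2 N_bd. Qed.

Section OneLeafFunction.
Variables (A U : set plane) (h : plane -> R) (T : plane -> set plane) (Of : set plane) (f : plane -> R).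
Hypothesis (lf : leaf_function A h T X t Of f) (UA : U `<=` A) (OOf : O `<=` Of).
Hypothesis (Ubd : forall q, U q -> forall s, I s -> q <> bd s).
Hypothesis (AU : A `<=` U `|` bd @` I).

Let F y := f (th1 y, th2 y).

Let Xt : X (t, 0) = bd t. Proof. exact: (chart_bd XE It). Qed.

Lemma F_Cinf : Cinf N F.
Proof.
move=> k; apply: (@Cn_comp R k Of N f th1 th2).
- exact: lf_open lf.
- exact: nc_open nc.
- exact: lf_smooth lf k.
- exact: nc_1 nc k.
- exact: nc_2 nc k.
- by move=> y /(nc_right nc) [/OOf].
Qed.

Lemma f_bd : f (bd t) = 0.
Proof. by rewrite -Xt; exact: nbhs_singleton (lf_boundary lf). Qed.

Lemma F_origin : F (0, 0) = 0.
Proof. by rewrite /F theta0 f_bd. Qed.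

Lemma F_N : \forall q \near bd t, F (N1 q, N2 q) = f q.
Proof. by apply: filterS (nc_left nc) => q [_ e]; rewrite /F e. Qed.

(** In the chart the parameter is comparable with the height, so it vanishes at
    no point of the domain near the boundary. *)
Lemma near_U_pos : \forall q \near bd t, U q -> 0 < f q.
Proof.
have oX : nbhs (bd t) (X @` setT).
  by rewrite -Xt; apply: (chart_open oOx OxI hx1 hx2 XJ It); exact: filterT.
have nI : \forall s \near t, I s by apply: open_nbhs_nbhs.
have [d0 dp0 hd] := (near_interval t _).1 (near_and nI (lf_boundary lf)).
have ctr : {for ((t, 0) : plane), continuous X} := chart_cont OxI hx1 hx2 It.
have pt := lf_transverse lf.
pose Ox' := Ox `&` X @^-1` Of.
have Oft : Of (X (t, 0)) := lf_in lf.
have oOx' : open Ox' by exact: (preimage_open oOx (lf_open lf) hx1 hx2).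
have sOx : Ox' `<=` Ox by move=> q [].
have hfX : Cinf Ox' (f \o X).
  move=> k; apply: (@Cn_comp R k Of Ox' f x1 x2).
  - exact: lf_open lf.
  - exact: oOx'.
  - exact: lf_smooth lf k.
  - exact: Cn_sub sOx (hx1 k).
  - exact: Cn_sub sOx (hx2 k).
  - by move=> q [].
have Oxt' : Ox' (t, 0) by split => //; exact: OxI.
have [m [M [m0 M0 nm]]] := @comparable_height R Ox' (f \o X) t oOx' (hfX 1%N) Oxt' ((near_interval _ _).1 (lf_boundary lf)) pt.
have := near_and (near_fst nI) nm.
move=> /(chart_open oOx OxI hx1 hx2 XJ It); rewrite -/X -/(X (t, 0)) Xt => nX.
have dom := lf_domain lf; rewrite Xt in dom.
have := near_and nX dom; apply: filterS => _ [[[s r] [Is [h1 h2]] <-] dm] Uq.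
have fq : 0 <= f (X (s, r)) by apply/dm/UA.
rewrite /= in Is h1 h2.
have [r0|r0|r0] := ltgtP r 0.
- by have := h2 r0; rewrite ltNge fq.
- by have /andP[a _] := h1 (ltW r0); apply: lt_le_trans a; rewrite mulr_gt0.
- by case: (Ubd Uq Is); rewrite r0; exact: (chart_bd XE Is).
Qed.

Hypothesis (ct : contact Psi U bd t c s0 n).

Let L (y : plane) := F (dot (y - o) tau, dot (y - o) n).
Let NL := [set y : plane | N (dot (y - o) tau, dot (y - o) n)].

Lemma contact_L : [/\ is_derive s0 1 (L \o c) 0, is_derive s0 1 (derive1 (L \o c)) 0
      & 0 <= 'D_n L (c s0)].
Proof.
have caff w k : Cn k setT (fun y : plane => dot (y - o) w).
  have := @proj_Cinf setT id o w openT; rewrite /proj; apply.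
    by move=> j; exact: Cn_fst.
  by move=> j; exact: Cn_snd.
have oNL : open NL.
  rewrite openE => y Ny.
  have cc : {for y, continuous (fun y : plane => (dot (y - o) tau, dot (y - o) n))}.
    by apply: (@cvg_pair _ _ _ (nbhs y) (nbhs (dot (y - o) tau)) (nbhs (dot (y - o) n))); [exact: (Cn_cont (caff tau 0%N))|exact: (Cn_cont (caff n 0%N))].
  by apply: (cc N); apply: open_nbhs_nbhs; split => //; exact: nc_open nc.
apply: (ct (N := NL)) => //.
- by rewrite /NL /= cs0 subrr /dot /= !mul0r addr0; exact: nc_in nc.
- move=> k; apply: (@Cn_comp R k N NL F).
  + exact: nc_open nc.
  + exact: oNL.
  + exact: F_Cinf.
  + exact: Cn_sub (@subsetT _ _) (caff tau k).
  + exact: Cn_sub (@subsetT _ _) (caff n k).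
  + by [].
- have nI : \forall s \near t, I s by apply: open_nbhs_nbhs.
  have cb : \forall s \near t, F (N1 (X (s, 0)), N2 (X (s, 0))) = f (X (s, 0)).
    apply: (near_axis (P := fun q => F (N1 (X q), N2 (X q)) = f (X q))).
    have nF := F_N; rewrite -Xt in nF.
    exact: (chart_cont OxI hx1 hx2 It nF).
  have := near_and nI (near_and cb (lf_boundary lf)); apply: filterS => s [Is [e1 e2]].
  by rewrite -(chart_bd XE Is) -[LHS]/(F (N1 (X (s, 0)), N2 (X (s, 0)))) e1.
- have := near_and near_U_pos F_N; apply: filterS => q [e1 e2] /e1.
  by rewrite -e2.
Qed.

(** Test [contact] on the parameter written in the target plane. Its derivative
    along the curve vanishes, which gives the first equation; the vanishing
    of the second derivative compares the second horizontal derivative with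
    the vertical one, with the sign given by the curvature; and the vertical
    one is positive since the parameter is a submersion. *)
Lemma normal_form : [/\ pd false F (0, 0) = 0, 0 < pd true F (0, 0)
  & pd false (pd false F) (0, 0) < 0].
Proof.
have [d1 d2 d3] := contact_L.
have oN := nc_open nc; have N0 := nc_in nc; have hF := F_Cinf.
have tp := tau_neq0.
pose G1 s := dot (c s - o) tau; pose G2 s := dot (c s - o) n.
have G0 : (G1 s0, G2 s0) = (0, 0) by rewrite /G1 /G2 cs0 subrr /dot /= !mul0r addr0.
have nG : \forall s \near s0, is_derive (s : R) 1 G1 (dot (dc s) tau) /\ is_derive s 1 G2 (dot (dc s) n).
  by apply: filterS c_der => s hs; split; exact: is_derive_proj.
have [dG1 dG2] := nbhs_singleton nG.
have cG : {for s0, continuous (fun s => (G1 s, G2 s))}.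
  apply: (@cvg_pair _ _ _ (nbhs s0) (nbhs (G1 s0)) (nbhs (G2 s0))).
    by apply: differentiable_continuous; apply/derivable1_diffP; case: dG1.
  by apply: differentiable_continuous; apply/derivable1_diffP; case: dG2.
have nN : \forall s \near s0, N (G1 s, G2 s) by apply: (cG N); rewrite G0; apply: open_nbhs_nbhs.
have nD : \forall s \near s0, is_derive (s : R) 1 (L \o c)
    (dot (dc s) tau * pd false F (G1 s, G2 s) + dot (dc s) n * pd true F (G1 s, G2 s)).
  by have := near_and nG nN; apply: filterS => s [[e1 e2] Ns]; exact: (chain_curve oN (hF 1%N) Ns e1 e2).
have Fx : pd false F (0, 0) = 0.
  have [_ e1] := d1; have [_] := nbhs_singleton nD; rewrite e1 G0 c_tau dot_tau_n mul0r addr0.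
  by move=> /esym/eqP; rewrite mulf_eq0 gt_eqF //= => /eqP.
have k1 : is_derive s0 1 (fun s => dot (dc s - 0) tau) (dot c2 tau) by exact: is_derive_proj.
have k2 : is_derive s0 1 (fun s => dot (dc s - 0) n) (dot c2 n) by exact: is_derive_proj.
have N0' : N (G1 s0, G2 s0) by rewrite G0.
have m1 := chain_curve oN (Cinf_pd false hF 1%N) N0' dG1 dG2.
have m2 := chain_curve oN (Cinf_pd true hF 1%N) N0' dG1 dG2.
have d2' := is_deriveD (is_deriveM k1 m1) (is_deriveM k2 m2).
have e2 : dot tau tau * (dot tau tau * pd false (pd false F) (0, 0)) + kap ^+ 2 * pd true F (0, 0) = 0.
  have nE' : \forall s \near s0, derive1 (L \o c) s =
    dot (dc s - 0) tau * pd false F (G1 s, G2 s) + dot (dc s - 0) n * pd true F (G1 s, G2 s).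
    by apply: filterS nD => s [_ e]; rewrite derive1E e subr0.
  have [_ z] := d2; have [_] := d2'.
  rewrite -[X in 'D_1 X s0 = _]/(fun s => dot (dc s - 0) tau * pd false F (G1 s, G2 s) + dot (dc s - 0) n * pd true F (G1 s, G2 s)).
  rewrite -(near_eq_derive _ nE') z G0 c_tau subr0 dot_tau_n Fx dot_c2_n /GRing.scale /= => /esym.
  move: (pd true F (0, 0)) (pd false (pd false F) (0, 0)) (pd true (pd false F) (0, 0)) (pd false (pd true F) (0, 0)) (pd true (pd true F) (0, 0)) (dot tau tau) (dot c2 tau).
  move: (kap ^+ 2) => k a1 a2 a3 a4 a5 a6 a7 e.
  by rewrite -e; ring.
have d3' : 'D_n L (c s0) = dot n n * pd true F (0, 0).
  have a1 : is_derive (c s0) n (fun y : plane => dot (y - o) tau) (dot n tau).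
    by apply: is_derive_proj; exact: is_derive_id.
  have a2 : is_derive (c s0) n (fun y : plane => dot (y - o) n) (dot n n).
    by apply: is_derive_proj; exact: is_derive_id.
  have [_ ->] := @chain_plane R N F (fun y : plane => dot (y - o) tau) (fun y : plane => dot (y - o) n) (c s0) n _ _ oN (hF 1%N) N0' a1 a2.
  by rewrite -/(G1 s0) -/(G2 s0) G0 Fx mulr0 add0r.
have Fy0 : 0 <= pd true F (0, 0) by move: d3; rewrite d3' pmulr_rge0 // dot_n_n.
have Fy : 0 < pd true F (0, 0).
  rewrite lt_def Fy0 andbT; apply/negP => /eqP z.
  have k1' := proj_Cinf o tau oO hP1 hP2; have k2' := proj_Cinf o n oO hP1 hP2.
  have pf b : pd b f (bd t) = 0.
    rewrite /pd -(near_eq_derive _ F_N) -[LHS]/(pd b (fun q => F (N1 q, N2 q)) (bd t)).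
    have NN : N (N1 (bd t), N2 (bd t)) by rewrite N_bd.
    rewrite (pd_comp oN (hF 1%N) NN (pd_is_derive b (k1' 1%N) Ot) (pd_is_derive b (k2' 1%N) Ot)).
    by rewrite N_bd Fx z !mulr0 addr0.
  have := lf_transverse lf; rewrite (pd_chart OxI hx1 hx2 _ (lf_open lf) (lf_smooth lf) It (lf_in lf)).
  by rewrite /= (Xt : (x1 (t, 0), x2 (t, 0)) = bd t) !pf !mulr0 addr0 ltxx.
split => //.
have : 0 < kap ^+ 2 * pd true F (0, 0) by rewrite mulr_gt0 // lt_def sqr_ge0 sqrf_eq0 kap0.
move: e2; rewrite mulrA => /eqP; rewrite addrC addr_eq0 => /eqP -> .
by rewrite oppr_gt0 pmulr_rlt0 // mulr_gt0.
Qed.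

End OneLeafFunction.
End AtPoint.
End Normal.

(** * The reflection law in normal coordinates *)

Section Symmetric.
Variable R : realType.
Local Notation plane := (plane R).
Implicit Types (f g : plane -> R) (p q : plane) (O N A U : set plane).

(** [sigma] is parallel to [tau], and the reflection in [tau] changes the sign
    of the component along the normal. *)
Lemma symmetric_lines_normal (tau n sigma u w : plane) (kap : R) :
  n = kap *: (- tau.2, tau.1) -> 0 < dot tau tau -> sigma != 0 -> kap != 0 ->
  dot sigma n = 0 -> symmetric_lines sigma u w ->
  dot u tau * dot w n + dot u n * dot w tau = 0.
Proof.
case: tau n sigma u w => [t1 t2] n [s1 s2] [u1 u2] [w1 w2] -> /=.
rewrite /symmetric_lines /parallel /reflection /det2 /dot /GRing.scale /= /GRing.scale /=.
move=> D0 sn0 k0 e.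
have e' : t1 * s2 - t2 * s1 = 0 by apply: (mulfI k0); rewrite mulr0 -[RHS]e; ring.
pose l := (s1 * t1 + s2 * t2) / (t1 * t1 + t2 * t2).
have Dn : t1 * t1 + t2 * t2 != 0 by rewrite gt_eqF.
have s1E : s1 = l * t1.
  apply: (mulIf Dn); rewrite /l mulrAC divfK //.
  have -> : s1 * (t1 * t1 + t2 * t2) = (s1 * t1 + s2 * t2) * t1 - t2 * (t1 * s2 - t2 * s1) by ring.
  by rewrite e' mulr0 subr0.
have s2E : s2 = l * t2.
  apply: (mulIf Dn); rewrite /l mulrAC divfK //.
  have -> : s2 * (t1 * t1 + t2 * t2) = (s1 * t1 + s2 * t2) * t2 + t1 * (t1 * s2 - t2 * s1) by ring.
  by rewrite e' mulr0 addr0.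
have l0 : l != 0.
  by apply/negP => /eqP z; move: sn0; rewrite s1E s2E z !mul0r eqxx.
move: l s1E s2E l0 => l -> -> l0 S.
have S' : (2 * (u1 * t1 + u2 * t2) / (t1 * t1 + t2 * t2)) * (t1 * w2 - t2 * w1) - (u1 * w2 - u2 * w1) = 0.
  have S2 : (2 * (u1 * (l * t1) + u2 * (l * t2)) / ((l * t1) * (l * t1) + (l * t2) * (l * t2)) * (l * t1) - u1) * w2 -
     (2 * (u1 * (l * t1) + u2 * (l * t2)) / ((l * t1) * (l * t1) + (l * t2) * (l * t2)) * (l * t2) - u2) * w1 = 0 := S.
  rewrite -[RHS]S2; field.
  rewrite Dn /=; have -> : l * t1 * (l * t1) + l * t2 * (l * t2) = l * l * (t1 * t1 + t2 * t2) by ring.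
  by rewrite !mulf_neq0.
have {}S' : 2 * (u1 * t1 + u2 * t2) * (t1 * w2 - t2 * w1) - (u1 * w2 - u2 * w1) * (t1 * t1 + t2 * t2) = 0.
  by rewrite -[RHS](mul0r (t1 * t1 + t2 * t2)) -S'; field.
by rewrite -[RHS](mulr0 kap) -[X in _ = kap * X]S'; ring.
Qed.

(** The part of the reflection law which is used, common to both definitions of
    foliations by caustics: the pairs of points of tangency that can be deformed
    to the boundary point through pairs on common leaves. *)
Definition caustic_at A (h : plane -> R) (T : plane -> set plane) (Psi : plane -> plane) (bd : R -> plane) (t : R) :=
  forall y z : R -> plane,
    {within `[0, 1], continuous y} -> {within `[0, 1], continuous z} ->
    y 0 = bd t -> z 0 = bd t ->
    (forall s, 0 < s <= 1 -> [/\ A (y s), leaf A h (y s) (z s), y s != z s,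
       tangent_at Psi T (bd t) (y s) & tangent_at Psi T (bd t) (z s)]) ->
    ~ parallel (Psi (y 1) - Psi (bd t)) (Psi (z 1) - Psi (bd t)) ->
    symmetric_lines (derive1 (Psi \o bd) t)
      (Psi (y 1) - Psi (bd t)) (Psi (z 1) - Psi (bd t)).

Lemma within_comp_plane (T : topologicalType) (y : R -> plane) (G : plane -> T) (a b : R) :
  {within `[a, b], continuous y} -> (forall s, a <= s <= b -> {for y s, continuous G}) ->
  {within `[a, b], continuous (G \o y)}.
Proof.
move=> /subspace_continuousP cy cG; apply/subspace_continuousP => x xab.
apply: (cvg_comp y G (cy x xab)); apply: cG.
by move: xab; rewrite /= in_itv.
Qed.

Lemma dot_inj (tau n u w : plane) : det2 tau n != 0 -> dot u tau = dot w tau -> dot u n = dot w n -> u = w.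
Proof.
case: tau n u w => [t1 t2] [n1 n2] [u1 u2] [w1 w2]; rewrite /det2 /dot /= => d e1 e2.
rewrite [t2 * _]mulrC in d.
have [] := @cramer_zero R t1 n1 t2 n2 (u1 - w1) (u2 - w2) d.
- by rewrite !mulrBr ![t1 * _]mulrC ![t2 * _]mulrC; move: e1; lra.
- by rewrite !mulrBr ![n1 * _]mulrC ![n2 * _]mulrC; move: e2; lra.
by move=> /eqP; rewrite subr_eq0 => /eqP -> /eqP; rewrite subr_eq0 => /eqP ->.
Qed.

Section AtPoint.
Variables (I : set R) (bd nu : R -> plane) (Ox : set plane) (x1 x2 : plane -> R).
Let X q : plane := (x1 q, x2 q).
Hypothesis (oI : open I) (oOx : open Ox) (OxI : forall s, I s -> Ox (s, 0)).
Hypothesis (hx1 : Cinf Ox x1) (hx2 : Cinf Ox x2).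
Hypothesis (XE : forall s r, I s -> X (s, r) = bd s + r *: nu s).
Hypothesis (XJ : forall s, I s -> djac x1 x2 (s, 0) != 0).

Variables (t : R) (Psi : plane -> plane) (O : set plane) (N : set plane) (th1 th2 : plane -> R).
Hypothesis (It : I t) (oO : open O) (Ot : O (bd t)).
Hypothesis (hP1 : Cinf O (fun q => (Psi q).1)) (hP2 : Cinf O (fun q => (Psi q).2)).
Hypothesis PJ : djac (fun q => (Psi q).1) (fun q => (Psi q).2) (bd t) != 0.

Variables (tau n : plane) (kap : R).
Hypothesis (kap0 : kap != 0) (nE : n = kap *: (- tau.2, tau.1)) (tau0 : 0 < dot tau tau).
Let o := Psi (bd t).
Hypothesis (nc : normal_chart O Psi o tau n (bd t) N th1 th2).
Let N1 := proj Psi o tau.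
Let N2 := proj Psi o n.
Let th y : plane := (th1 y, th2 y).

Variables (A : set plane) (h : plane -> R) (T : plane -> set plane) (Of : set plane) (f : plane -> R).
Hypothesis (lf : leaf_function A h T X t Of f) (OOf : O `<=` Of).
Let F y := f (th1 y, th2 y).
Hypothesis (hF : Cinf N F) (F0 : F (0, 0) = 0) (Fx : pd false F (0, 0) = 0)
  (Fy : 0 < pd true F (0, 0)) (Fxx : pd false (pd false F) (0, 0) < 0).
Let oN := nc_open nc.
Let N0 := nc_in nc.
Let Xt : X (t, 0) = bd t. Proof. exact: (chart_bd XE It). Qed.

Lemma det_tau_n : det2 tau n = kap * dot tau tau.
Proof. by rewrite nE /det2 /dot /GRing.scale /= /GRing.scale /=; ring. Qed.

Lemma th_cont y : N y -> {for y, continuous th}.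
Proof.
move=> Ny; apply: (@cvg_pair _ _ _ (nbhs y) (nbhs (th1 y)) (nbhs (th2 y))).
  exact: (Cn_cont (nc_1 nc 0%N) Ny).
exact: (Cn_cont (nc_2 nc 0%N) Ny).
Qed.

Lemma th0 : th (0, 0) = bd t.
Proof.
by have [_] := nbhs_singleton (nc_left nc); rewrite /proj subrr /dot /= !mul0r addr0.
Qed.

Lemma is_derive_Psi q v : O q -> is_derive q v Psi ('D_v (fun q => (Psi q).1) q, 'D_v (fun q => (Psi q).2) q).
Proof.
move=> Oq; apply/is_derive_pair; split; apply/derivableP/diff_derivable.
  exact: (C1_differentiable oO (hP1 1%N) Oq).1.
exact: (C1_differentiable oO (hP2 1%N) Oq).1.
Qed.

(** In normal coordinates the image of the boundary is the zero level of [F],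
    whose differential at the origin is vertical. *)
Lemma boundary_tangent : exists2 sigma, is_derive t 1 (Psi \o bd) sigma & sigma != 0 /\ dot sigma n = 0.
Proof.
have OX : O (X (t, 0)) by rewrite Xt.
have nI : \forall s \near t, I s by apply: open_nbhs_nbhs.
pose s1 := pd false ((fun q => (Psi q).1) \o X) (t, 0).
pose s2 := pd false ((fun q => (Psi q).2) \o X) (t, 0).
have dX (g : plane -> R) b : Cinf O g -> derivable (g \o X) (t, 0) (axis R b).
  by move=> hg; have [] := chain_plane oO (hg 1%N) OX (pd_is_derive b (hx1 1%N) (OxI It)) (pd_is_derive b (hx2 1%N) (OxI It)).
have bdX : \forall s \near t, X (s, 0) = bd s.
  by apply: filterS nI => s Is; exact: (chart_bd XE Is).
have d : is_derive t 1 (Psi \o bd) (s1, s2).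
  apply: (near_eq_is_derive (f := fun s => Psi (X (s, 0)))).
    by apply: filterS bdX => s e; rewrite e.
  apply/is_derive_pair; split.
    exact: (is_derive_x (dX _ false hP1)).
  exact: (is_derive_x (dX _ false hP2)).
exists (s1, s2) => //; split.
  apply/negP => /eqP e; have [z1 z2] : s1 = 0 /\ s2 = 0 by case: e.
  rewrite /s1 (pd_chart OxI hx1 hx2 false oO hP1 It OX) in z1.
  rewrite /s2 (pd_chart OxI hx1 hx2 false oO hP2 It OX) in z2.
  rewrite /= (Xt : (x1 (t, 0), x2 (t, 0)) = bd t) in z1 z2.
  have [z3 z4] : pd false x1 (t, 0) = 0 /\ pd false x2 (t, 0) = 0.
    apply: (@cramer_zero R (pd false (fun q => (Psi q).1) (bd t)) (pd false (fun q => (Psi q).2) (bd t))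
      (pd true (fun q => (Psi q).1) (bd t)) (pd true (fun q => (Psi q).2) (bd t))).
    - by move: PJ; rewrite /djac [_ * pd false _ _]mulrC.
    - by rewrite mulrC [_ * pd false x2 _]mulrC.
    - by rewrite mulrC [_ * pd false x2 _]mulrC.
  by have := XJ It; rewrite /djac z3 z4 mul0r mulr0 subrr eqxx.
have a1 : is_derive t 1 (fun s => N1 (bd s)) (dot (s1, s2) tau) by apply: is_derive_proj.
have a2 : is_derive t 1 (fun s => N2 (bd s)) (dot (s1, s2) n) by apply: is_derive_proj.
have NE : (N1 (bd t), N2 (bd t)) = (0, 0).
  by rewrite /N1 /N2 /proj subrr /dot /= !mul0r addr0.
have NN : N (N1 (bd t), N2 (bd t)) by rewrite NE.
have [_ e] := @chain_curve R N F (fun s => N1 (bd s)) (fun s => N2 (bd s)) t _ _ oN (hF 1%N) NN a1 a2.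
have nF : \forall s \near t, F (N1 (bd s), N2 (bd s)) = 0.
  have nl := nc_left nc; rewrite -Xt in nl.
  have nl' := near_axis (chart_cont OxI hx1 hx2 It nl).
  have := near_and nl' (near_and bdX (lf_boundary lf)); apply: filterS => s [[_ e1] [e2 e3]].
  by move: e1; rewrite -/(X (s, 0)) e2 -/N1 -/N2 => e1; rewrite /F e1 -e2.
move: e; rewrite (near_eq_derive _ nF) derive_cst NE Fx mulr0 add0r => /esym/eqP.
by rewrite mulf_eq0 (gt_eqF Fy) orbF => /eqP.
Qed.

(** In normal coordinates tangency to a leaf means that the derivative of [F] at
    [w] in the direction [w] vanishes, and the coordinates are affine
    functions of the target plane. *)
Lemma tangent_at_th w : N w -> 0 < F w -> w.1 * pd false F w + w.2 * pd true F w = 0 ->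
  A (th w) -> tangent_at Psi T (bd t) (th w).
Proof.
move=> Nw Fw tg Aw; have [Ow ew] := nc_right nc Nw.
have Ofw := OOf Ow.
split.
  apply/negP => /eqP e; move: ew; rewrite /proj -/(th w) e subrr /dot /= !mul0r addr0 => ew.
  by move: Fw; rewrite -ew F0 ltxx.
have d1 : is_derive w w th1 ('D_w th1 w) by apply/derivableP/diff_derivable; exact: (C1_differentiable oN (nc_1 nc 1%N) Nw).1.
have d2 : is_derive w w th2 ('D_w th2 w) by apply/derivableP/diff_derivable; exact: (C1_differentiable oN (nc_2 nc 1%N) Nw).1.
exists ('D_w th1 w, 'D_w th2 w).
  rewrite (lf_kernel lf Ofw Aw) /kernel_field /= (C1_differentiable (lf_open lf) (lf_smooth lf 1%N) Ofw).2 /=.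
  have [_ <-] := chain_plane (lf_open lf) (lf_smooth lf 1%N) Ofw d1 d2.
  by rewrite -[LHS]/('D_w F w) (C1_differentiable oN (hF 1%N) Nw).2.
set v := ('D_w th1 w, 'D_w th2 w).
have dP := is_derive_Psi v Ow; have [_ ->] := dP.
set delta := ('D_v (fun q => (Psi q).1) (th1 w, th2 w), 'D_v (fun q => (Psi q).2) (th1 w, th2 w)) in dP *.
have pw e : forall c, (forall y, N y -> proj Psi o e (th y) = c y) -> is_derive w w c (dot delta e).
  move=> c hc; have h1 := proj_Cinf o e oO hP1 hP2.
  have ch := chain_plane oO (h1 1%N) Ow d1 d2.
  have [_ dd] := is_derive_proj o e dP.
  have E : 'D_w th1 w * pd false (proj Psi o e) (th1 w, th2 w) + 'D_w th2 w * pd true (proj Psi o e) (th1 w, th2 w) = dot delta e.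
    by rewrite -dd -[RHS]/('D_v (proj Psi o e) (th1 w, th2 w)) (C1_differentiable oO (h1 1%N) Ow).2.
  rewrite E in ch; apply: near_eq_is_derive ch.
  by apply: filterS (open_nbhs_nbhs (conj oN Nw)) => y /hc.
have /is_derive_pair [[_ a1] [_ a2]] := is_derive_id w w.
apply: (dot_inj (tau := tau) (n := n)).
- by rewrite det_tau_n mulf_neq0 // gt_eqF.
- have [_ <-] := pw tau (@fst R R) (fun y Ny => congr1 fst (nc_right nc Ny).2).
  by rewrite [LHS]a1; exact: (esym (congr1 fst ew)).
- have [_ <-] := pw n (@snd R R) (fun y Ny => congr1 snd (nc_right nc Ny).2).
  by rewrite [LHS]a2; exact: (esym (congr1 snd ew)).
Qed.

(** Small level curves of [F] are graphs over the tangent, hence connected, so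
    two nearby points with the same value of [F] are on one leaf. *)
Lemma same_leaf_near : exists2 d, 0 < d &
  forall y z : plane, `|y.1| <= d -> `|y.2| <= d -> `|z.1| <= d -> `|z.2| <= d ->
    N y /\ (0 < F y -> A (th y) /\ (F y = F z -> leaf A h (th y) (th z))).
Proof.
have [r [m [K [t1 [box _]]]]] := ex_line_box oN N0 hF Fy Fxx ltr01.
have dom : \forall y \near ((0, 0) : plane), A (th y) <-> 0 <= F y.
  have := lf_domain lf; rewrite Xt -th0; exact: (th_cont N0).
have [e0 e00 He] := (near_square _ _).1 dom.
have m0 := lb_m box; have K0 := lb_K box; have /andP[r0 r1] := lb_r box.
have e02 : 0 < e0 / 2 by rewrite divr_gt0.
have e0e : e0 / 2 < e0 by rewrite ltr_pdivrMr // ltr_pMr // ltr1n.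
have [be [be0 ber bee]] := ex_min2 r0 e02.
have q0 : 0 < m * be / (3 * K) by rewrite divr_gt0 ?mulr_gt0.
have [al [al0 albe alq]] := ex_min2 be0 q0.
have K30 : 0 < 3 * K by rewrite mulr_gt0.
have Kal : 3 * K * al <= m * be.
  by rewrite (@ler_pdivlMr _ (3 * K) al (m * be) K30) mulrC in alq.
have alr : al <= r by exact: le_trans albe ber.
have bee0 : be < e0 by exact: le_lt_trans bee e0e.
have ale0 : al < e0 by exact: le_lt_trans albe bee0.
have domq q : `|q.1| <= be -> `|q.2| <= be -> A (th q) <-> 0 <= F q.
  by move=> h1 h2; apply: He; rewrite subr0; apply: le_lt_trans bee0.
exists al => // y z y1 y2 z1 z2.
have Ny : N y by apply: (lb_O box); [exact: le_trans alr|exact: le_trans alr].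
split => // uF; split.
  by apply/domq; [exact: le_trans albe|exact: le_trans albe|exact: ltW].
move=> yz.
have le0 (x : R) : 0 <= x -> `|0 : R| <= x by rewrite normr0.
have [||rho [r1' r2' r3 _]] := @leaf_graph R N F (0, 0) al be m K (F y) (hF 1%N) (ltW al0) (ltW be0) m0.
- move=> q; rewrite !subr0 => q1 q2.
  have q1r : `|q.1| <= r by exact: le_trans alr.
  have q2r : `|q.2| <= r by exact: le_trans ber.
  split; first exact: (lb_O box).
    by have /andP[] := lb_y box q1r q2r.
  exact: (lb_x box).
- move=> a; rewrite subr0 /= => ha.
  have := F_lip hF box (p := y) (q := (a, 0)); rewrite /= => /(_ (le_trans y1 alr) (le_trans y2 alr) (le_trans ha alr) (le0 r (ltW r0))) Hl.
  apply: (le_trans Hl); apply: le_trans Kal.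
  have a1 : `|a - y.1| <= al + al by apply: le_trans (ler_normB _ _) _; exact: lerD.
  have a2 : `|0 - y.2| <= al by rewrite sub0r normrN.
  have -> : 3 * K * al = K * (al + al) + K * al by ring.
  by apply: lerD; apply: ler_wpM2l => //; exact: ltW.
rewrite /= in r1' r2' r3.
have Ha a : - al <= a <= al -> `|a - 0| <= al by move=> ha; rewrite subr0 ler_norml.
have rhoq a : - al <= a <= al -> [/\ `|a| <= be, `|rho a| <= be & F (a, rho a) = F y].
  move=> ha; have ha' := Ha a ha; have [b1 b2] := r1' _ ha'.
  by rewrite subr0 in b1; split => //; apply: le_trans albe; rewrite subr0 in ha'.
have conn : connected ((fun a => th (a, rho a)) @` `[- al, al]).
  apply: connected_continuous_connected; first exact: segment_connected.
  apply: (@within_comp_plane _ (fun a => (a, rho a)) th).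
    apply: within_pair.
      by apply: (@lipschitz_within _ _ _ _ 1) => a b _ _; rewrite mul1r.
    apply: (@lipschitz_within _ _ _ _ (K / m)) => a b ha hb.
    by apply: r3; exact: Ha.
  move=> a ha; apply: th_cont; apply: (lb_O box) => /=.
    by have [b1 _ _] := rhoq a ha; exact: le_trans ber.
  by have [_ b1 _] := rhoq a ha; exact: le_trans ber.
have inS q : `|q.1| <= al -> `|q.2| <= al -> F q = F y -> ((fun a => th (a, rho a)) @` `[- al, al]) (th q).
  move=> q1 q2 qy; exists q.1; first by rewrite /= in_itv /= -ler_norml.
  have -> : rho q.1 = q.2.
    by apply/esym/r2'; rewrite ?subr0 -?surjective_pairing //; exact: le_trans albe.
  by rewrite -surjective_pairing.
have OF q : N q -> Of (th q) by move=> Nq; apply: OOf; have [] := nc_right nc Nq.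
rewrite /leaf; apply: (connected_component_max _ _ conn).
- exact: inS.
- move=> _ [a /= ha <-]; rewrite in_itv /= in ha; have [b1 b2 b3] := rhoq a ha.
  have Na : N (a, rho a) by apply: (lb_O box); exact: le_trans ber.
  have Ay : A (th y) by apply/domq; [exact: le_trans albe|exact: le_trans albe|exact: ltW].
  have Aa : A (th (a, rho a)) by apply/domq => //; rewrite b3 ltW.
  split => //=; apply/le_anti.
  rewrite (lf_level lf (OF _ Na) (OF _ Ny) Aa Ay) (lf_level lf (OF _ Ny) (OF _ Na) Ay Aa).
  by rewrite -!/(F _) b3 lexx.
- exact: inS.
Qed.

Lemma sym_near : caustic_at A h T Psi bd t -> exists2 d, 0 < d & symmetric_near F d.
Proof.
move=> cau; have [d d0 H] := same_leaf_near.
exists d => // y z cy cz y0 z0 hyz cross.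
have thN (x : R -> plane) : x 0 = (0, 0) -> (forall s, 0 < s <= 1 -> N (x s)) ->
    forall s, 0 <= s <= 1 -> {for x s, continuous th}.
  move=> x0 hx s /andP[s0 s1]; apply: th_cont.
  have [->|sn] := eqVneq s 0; first by rewrite x0.
  by apply: hx; rewrite s1 andbT lt_def sn.
have Ny s : 0 < s <= 1 -> N (y s).
  by move=> /hyz [[[a1 a2] [a3 a4]] _ _ _ _]; have [] := H _ _ a1 a2 a3 a4.
have Nz s : 0 < s <= 1 -> N (z s).
  by move=> /hyz [[[a1 a2] [a3 a4]] _ _ _ _]; have [] := H _ _ a3 a4 a1 a2.
have one : 0 < (1 : R) <= 1 by rewrite ltr01 lexx.
have dots q : N q -> dot (Psi (th q) - o) tau = q.1 /\ dot (Psi (th q) - o) n = q.2.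
  by move=> /(nc_right nc) [_ e]; split; rewrite -[in RHS]e.
have [sig [sd1 sd2] [sg1 sg2]] := boundary_tangent.
have [u1 u2] := dots _ (Ny _ one); have [w1 w2] := dots _ (Nz _ one).
rewrite -u1 -u2 -w1 -w2; apply: (symmetric_lines_normal nE tau0 sg1 kap0 sg2).
rewrite -sd2 -derive1E; apply: (cau (th \o y) (th \o z)).
- by apply: within_comp_plane => // s hs; apply: thN => //; exact: Ny.
- by apply: within_comp_plane => // s hs; apply: thN => //; exact: Nz.
- by rewrite /= y0 th0.
- by rewrite /= z0 th0.
- move=> s hs; have [[[a1 a2] [a3 a4]] Fp [Fe yz] ty tz] := hyz s hs.
  have [_ /(_ Fp) [Ay /(_ Fe) lyz]] := H _ _ a1 a2 a3 a4.
  have Fp' : 0 < F (z s) by rewrite -Fe.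
  have [_ /(_ Fp') [Az _]] := H _ _ a3 a4 a1 a2.
  split => //=.
  + apply: contra_neq yz => e; have [_ e1] := nc_right nc (Ny s hs).
    have [_ e2] := nc_right nc (Nz s hs).
    by rewrite -e1 -[RHS]e2 -/(th (y s)) -/(th (z s)) e.
  + by apply: tangent_at_th => //; exact: Ny.
  + by apply: tangent_at_th => //; exact: Nz.
- rewrite /parallel -/o => p; move: cross; rewrite -u1 -u2 -w1 -w2 => /negP; apply; apply/eqP.
  move: p; rewrite -/(th (y 1)) -/(th (z 1)); move: (Psi (th (y 1)) - o) (Psi (th (z 1)) - o) => [a1 a2] [b1 b2].
  rewrite /det2 /= => p.
  have -> : dot (a1, a2) tau * dot (b1, b2) n - dot (a1, a2) n * dot (b1, b2) tau =
    det2 tau n * (a1 * b2 - a2 * b1) by rewrite /dot /det2 /=; ring.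
  by rewrite p mulr0.
Qed.

End AtPoint.
End Symmetric.

(** * Foliations by caustics *)

Section Caustic.
Variable R : realType.
Local Notation plane := (plane R).
Implicit Types (f g : plane -> R) (p q : plane) (O N A U : set plane).

(** A change of coordinates multiplies [djac] by a nonvanishing factor [J], which
    changes the constants and possibly the sign. *)
Lemma sign_transfer (c C F D J J0 e : R) : 0 < c -> 0 <= F -> `|J - J0| < `|J0| / 2 ->
  c * F <= e * D -> `|D| <= C * F ->
  c * (`|J0| / 2) * F <= e * Num.sg J0 * (D * J) /\ `|D * J| <= C * (2 * `|J0|) * F.
Proof.
move=> c0 F0 Jd h1 h2.
have J0p : 0 <= `|J0| by [].
have [sJ1 sJ2] : `|J0| / 2 <= Num.sg J0 * J /\ `|J| <= 2 * `|J0|.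
  split; last first.
    have := ler_normD (J - J0) J0; rewrite subrK => h; move: h Jd J0p; clear; lra.
  have := normrEsg J0; have := ler_norm (- (Num.sg J0 * (J - J0))).
  rewrite normrN normrM; have : `|Num.sg J0| <= 1 by rewrite normr_sg; case: (_ == _).
  move=> s1 h E; have h2' : `|Num.sg J0| * `|J - J0| <= `|J - J0| by rewrite ler_piMl.
  have -> : Num.sg J0 * J = Num.sg J0 * J0 + Num.sg J0 * (J - J0) by ring.
  by rewrite -E; move: h h2' Jd; clear; move: (Num.sg J0 * (J - J0)) => x; lra.
split.
  have -> : c * (`|J0| / 2) * F = (c * F) * (`|J0| / 2) by ring.
  have -> : e * Num.sg J0 * (D * J) = (e * D) * (Num.sg J0 * J) by ring.
  by apply: ler_pM => //; rewrite mulr_ge0 // ltW.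
have -> : C * (2 * `|J0|) * F = (C * F) * (2 * `|J0|) by ring.
by rewrite normrM; apply: ler_pM.
Qed.

Variables (I : set R) (bd nu : R -> plane) (Ox : set plane) (x1 x2 : plane -> R).
Let X q : plane := (x1 q, x2 q).
Hypothesis (oI : open I) (oOx : open Ox) (OxI : forall s, I s -> Ox (s, 0)).
Hypothesis (hx1 : Cinf Ox x1) (hx2 : Cinf Ox x2).
Hypothesis (XE : forall s r, I s -> X (s, r) = bd s + r *: nu s).
Hypothesis (XJ : forall s, I s -> djac x1 x2 (s, 0) != 0).

Variables (Psi : plane -> plane) (OP : set plane).
Hypothesis (oP : open OP) (Pbd : forall t, I t -> OP (bd t)).
Hypothesis (hP1 : Cinf OP (fun q => (Psi q).1)) (hP2 : Cinf OP (fun q => (Psi q).2)).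
Hypothesis PJ : forall t, I t -> djac (fun q => (Psi q).1) (fun q => (Psi q).2) (bd t) != 0.

Variables (U1 : set plane) (h1 : plane -> R) (T1 : plane -> set plane).
Variables (U2 : set plane) (h2 : plane -> R) (T2 : plane -> set plane).
Hypothesis (adj1 : Defs.adjacent I bd nu U1) (adj2 : Defs.adjacent I bd nu U2).
Hypothesis (lev1 : level_foliation I bd U1 h1 T1) (lev2 : level_foliation I bd U2 h2 T2).
Let A1 := with_boundary I bd U1.
Let A2 := with_boundary I bd U2.
Hypothesis cau1 : forall t, I t -> caustic_at A1 h1 T1 Psi bd t.
Hypothesis cau2 : forall t, I t -> caustic_at A2 h2 T2 Psi bd t.
Hypothesis target : forall t, I t -> exists (c : R -> plane) (s0 : R),
  [/\ c s0 = Psi (bd t), (\forall s \near s0, derivable c (s : R) 1) /\ derivable (derive1 c) s0 1,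
      det2 (derive1 c s0) (derive1n 2 c s0) != 0,
      contact Psi U1 bd t c s0 (inward c s0) & contact Psi U2 bd t c s0 (inward c s0)].

(** [no_order] in normal coordinates, common to the two foliations. *)
Lemma no_sign_at t O1 f1 O2 f2 k (e c C : R) : I t ->
  leaf_function A1 h1 T1 X t O1 f1 -> leaf_function A2 h2 T2 X t O2 f2 ->
  (0 < k)%N -> `|e| = 1 -> 0 < c ->
  ~ (\forall q \near X (t, 0), 0 <= f1 q ->
       c * f1 q ^+ k <= e * djac f1 f2 q /\ `|djac f1 f2 q| <= C * f1 q ^+ k).
Proof.
move=> It lf1 lf2 k0 e1 c0 bnd.
have Xt : X (t, 0) = bd t := chart_bd XE It.
have [cu [s0 [cs0 [dc1 dc2] kap0 ct1 ct2]]] := target It.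
pose O := OP `&` (O1 `&` O2).
have oO : open O by apply: openI => //; apply: openI; [exact: lf_open lf1|exact: lf_open lf2].
have Ot : O (bd t) by split; [exact: Pbd|rewrite -Xt; split; [exact: lf_in lf1|exact: lf_in lf2]].
have OOP : O `<=` OP by move=> q [].
have OO1 : O `<=` O1 by move=> q [_ []].
have OO2 : O `<=` O2 by move=> q [_ []].
have hQ1 : Cinf O (fun q => (Psi q).1) by move=> j; exact: Cn_sub OOP (hP1 j).
have hQ2 : Cinf O (fun q => (Psi q).2) by move=> j; exact: Cn_sub OOP (hP2 j).
have [tau tauE] : exists tau : plane, tau = derive1 cu s0 by exists (derive1 cu s0).
have [c2 c2E] : exists c2 : plane, c2 = derive1n 2 cu s0 by exists (derive1n 2 cu s0).
have [kap kapE] : exists kap, kap = det2 tau c2 by exists (det2 tau c2).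
have [n nE] : exists n : plane, n = kap *: (- tau.2, tau.1) by exists (kap *: (- tau.2, tau.1)).
have nI : inward cu s0 = n by rewrite nE kapE tauE c2E.
rewrite nI in ct1 ct2.
have kp0 : kap != 0 by rewrite kapE tauE c2E.
have tp := tau_neq0 kapE kp0.
have dn0 : det2 tau n != 0 by rewrite (det_tau_n nE) mulf_neq0 // gt_eqF.
have [N [th1 [th2 nc]]] := ex_normal_chart oO Ot hQ1 hQ2 (PJ It) dn0.
have cder : \forall s \near s0, is_derive (s : R) 1 cu (derive1 cu s).
  by apply: filterS dc1 => s ds; rewrite derive1E; exact/derivableP.
have cder2 : is_derive s0 1 (derive1 cu) c2 by rewrite c2E /= derive1E; exact/derivableP.
have Ubd U : Defs.adjacent I bd nu U -> forall q, U q -> forall s, I s -> q <> bd s.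
  move=> [_ _ e0 _ _] q Uq s Is qE.
  have : (U `&` bd @` I) q by split => //; exists s.
  by rewrite e0.
have UA1 : U1 `<=` A1 by move=> q; left.
have UA2 : U2 `<=` A2 by move=> q; left.
have NF1 := normal_form oI oOx OxI hx1 hx2 XE XJ It oO Ot hQ1 hQ2 cs0 cder (esym tauE) cder2 kapE kp0 nE nc lf1
  UA1 OO1 (Ubd _ adj1) ct1.
have NF2 := normal_form oI oOx OxI hx1 hx2 XE XJ It oO Ot hQ1 hQ2 cs0 cder (esym tauE) cder2 kapE kp0 nE nc lf2
  UA2 OO2 (Ubd _ adj2) ct2.
have F1C := F_Cinf nc lf1 OO1; have F2C := F_Cinf nc lf2 OO2.
have F10 := F_origin XE It nc lf1; have F20 := F_origin XE It nc lf2.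
have [F1x F1y F1xx] := NF1; have [F2x F2y F2xx] := NF2.
have [d1 d10 sy1] := sym_near oI OxI hx1 hx2 XE XJ It oO Ot hQ1 hQ2 (PJ It) kp0 nE tp nc lf1 OO1 F1C F10 F1x F1y F1xx (cau1 It).
have [d2 d20 sy2] := sym_near oI OxI hx1 hx2 XE XJ It oO Ot hQ1 hQ2 (PJ It) kp0 nE tp nc lf2 OO2 F2C F20 F2x F2y F2xx (cau2 It).
have oN := nc_open nc; have N0 := nc_in nc.
have [r1 [m1 [K1 [t1 [b1 _]]]]] := ex_line_box oN N0 F1C F1y F1xx ltr01.
have [r2 [m2 [K2 [t2 [b2 _]]]]] := ex_line_box oN N0 F2C F2y F2xx ltr01.
have [s1 s1p ev1] := maxline_even oN F1C b1 F10 F1x d10 sy1.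
have [s2 s2p ev2] := maxline_even oN F2C b2 F20 F2x d20 sy2.
pose J := djac th1 th2.
have thc := th_cont nc N0; have tht : (th1 (0, 0), th2 (0, 0)) = bd t by exact: th0 nc.
have J0 : J (0, 0) != 0.
  have k1 := proj_Cinf (Psi (bd t)) tau oO hQ1 hQ2; have k2 := proj_Cinf (Psi (bd t)) n oO hQ1 hQ2.
  have Oth : O (th1 (0, 0), th2 (0, 0)) by rewrite tht.
  have := djac_comp oO (k1 1%N) (k2 1%N) (nc_1 nc 1%N) (nc_2 nc 1%N) N0 Oth.
  have pdE b g g' : (forall y, N y -> g y = g' y) -> pd b g (0, 0) = pd b g' (0, 0).
    by move=> gg; apply: near_eq_derive; apply: filterS (open_nbhs_nbhs (conj oN N0)) => y /gg.
  have -> : djac (fun q => proj Psi (Psi (bd t)) tau (th1 q, th2 q)) (fun q => proj Psi (Psi (bd t)) n (th1 q, th2 q)) (0, 0) = 1.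
    rewrite /djac !(pdE _ _ (@fst R R) (fun y Ny => congr1 fst (nc_right nc Ny).2)).
    rewrite !(pdE _ _ (@snd R R) (fun y Ny => congr1 snd (nc_right nc Ny).2)).
    by rewrite !(pd_fst _ _).1 !(pd_snd _ _).1 /= mulr1 mulr0 subr0.
  by move=> /esym jj; apply/negP => /eqP z; move: jj; rewrite -/J z mulr0 => /eqP; rewrite eq_sym oner_eq0.
have Jc : {for ((0, 0) : plane), continuous J}.
  have c1 b := Cn_pd b (nc_1 nc 1%N); have c2' b := Cn_pd b (nc_2 nc 1%N).
  exact: (Cn_cont (CnB oN (CnM oN (c1 false) (c2' true)) (CnM oN (c1 true) (c2' false))) N0).
have nJ : \forall y \near ((0, 0) : plane), `|J y - J (0, 0)| < `|J (0, 0)| / 2.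
  have J2 : 0 < `|J (0, 0)| / 2 by rewrite divr_gt0 // normr_gt0.
  by move/cvgrPdist_lt : Jc => /(_ _ J2); apply: filterS => y; rewrite distrC.
have bnd' : \forall y \near ((0, 0) : plane), 0 <= f1 (th1 y, th2 y) ->
    c * f1 (th1 y, th2 y) ^+ k <= e * djac f1 f2 (th1 y, th2 y) /\ `|djac f1 f2 (th1 y, th2 y)| <= C * f1 (th1 y, th2 y) ^+ k.
  by move: bnd; rewrite Xt -tht => /thc.
have nN : \forall y \near ((0, 0) : plane), N y by apply: open_nbhs_nbhs.
apply: (no_order oN F1C F2C b1 b2 F10 F20 F1x F2x s1p s2p ev1 ev2 (e := e * Num.sg (J (0, 0))) (c := c * (`|J (0, 0)| / 2)) (C := C * (2 * `|J (0, 0)|)) k0).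
- by rewrite normrM e1 mul1r normr_sg J0.
- by rewrite mulr_gt0 // divr_gt0 // normr_gt0.
have := near_and nN (near_and nJ bnd'); apply: filterS => y [Ny [Jy by']] Fy0.
have [q1 q2] := by' Fy0; have [Oy _] := nc_right nc Ny.
rewrite (djac_comp (O := O) oO (Cn_sub OO1 (lf_smooth lf1 1%N)) (Cn_sub OO2 (lf_smooth lf2 1%N)) (nc_1 nc 1%N) (nc_2 nc 1%N) Ny Oy).
by apply: sign_transfer => //; exact: exprn_ge0.
Qed.

End Caustic.


Section SameJet.
Variable R : realType.
Local Notation plane := (plane R).
Implicit Types (f g : plane -> R) (p q : plane) (O N A U : set plane).

Variables (I : set R) (bd nu : R -> plane) (Ox : set plane) (x1 x2 : plane -> R).
Let X q : plane := (x1 q, x2 q).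
Hypothesis (oI : open I) (oOx : open Ox) (OxI : forall s, I s -> Ox (s, 0)).
Hypothesis (hx1 : Cinf Ox x1) (hx2 : Cinf Ox x2).
Hypothesis (XE : forall s r, I s -> X (s, r) = bd s + r *: nu s).
Hypothesis (XJ : forall s, I s -> djac x1 x2 (s, 0) != 0).

Variables (A1 : set plane) (h1 : plane -> R) (T1 : plane -> set plane).
Variables (A2 : set plane) (h2 : plane -> R) (T2 : plane -> set plane).

(** The determinant vanishes on the boundary, which is a leaf of both
    foliations, so that only its sign near the boundary has to be excluded. *)
Lemma same_jet_at n t O1 f1 O2 f2 : I t ->
  leaf_function A1 h1 T1 X t O1 f1 -> leaf_function A2 h2 T2 X t O2 f2 ->
  (forall s k (e c C : R), I s ->
     leaf_function A1 h1 T1 X s O1 f1 -> leaf_function A2 h2 T2 X s O2 f2 ->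
     (0 < k)%N -> `|e| = 1 -> 0 < c ->
     ~ (\forall q \near X (s, 0), 0 <= f1 q ->
       c * f1 q ^+ k <= e * djac f1 f2 q /\ `|djac f1 f2 q| <= C * f1 q ^+ k)) ->
  same_jet n A1 T1 A2 T2 (bd t).
Proof.
move=> It lf1 lf2 ns.
have n1 := leaf_function_near oI OxI hx1 hx2 It lf1.
have n2 := leaf_function_near oI OxI hx1 hx2 It lf2.
have [d d0 Hd] := (near_interval t _).1 (near_and n1 n2).
pose O := O1 `&` O2.
have oO : open O by apply: openI; [exact: lf_open lf1|exact: lf_open lf2].
have OO1 : O `<=` O1 by move=> q [].
have OO2 : O `<=` O2 by move=> q [].
have hf1 : Cinf O f1 by move=> j; exact: Cn_sub OO1 (lf_smooth lf1 j).
have hf2 : Cinf O f2 by move=> j; exact: Cn_sub OO2 (lf_smooth lf2 j).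
pose Ox' := Ox `&` X @^-1` O.
have oOx' : open Ox' by exact: (preimage_open oOx oO hx1 hx2).
have sOx : Ox' `<=` Ox by move=> q [].
have hx1' : Cinf Ox' x1 by move=> j; exact: Cn_sub sOx (hx1 j).
have hx2' : Cinf Ox' x2 by move=> j; exact: Cn_sub sOx (hx2 j).
have Ox's s : I s -> leaf_function A1 h1 T1 X s O1 f1 -> leaf_function A2 h2 T2 X s O2 f2 -> Ox' (s, 0).
  by move=> Is l1 l2; split; [exact: OxI|split; [exact: lf_in l1|exact: lf_in l2]].
have Ot := Ox's t It lf1 lf2.
have fX (f : plane -> R) : Cinf O f -> Cinf Ox' (f \o X).
  by move=> hf j; apply: (@Cn_comp R j O Ox' f x1 x2) => // q [].
have XfB (h : plane -> R) A T Of f s : I s -> Ox' (s, 0) -> Cinf O f -> leaf_function A h T X s Of f -> pd false (f \o X) (s, 0) = 0.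
  move=> Is Os hf lf; apply: pd_along_boundary; first exact: lf_boundary lf.
  exact: (Cn_derivable (fX f hf 1%N) Os).
have fl : flat_at (X (t, 0)) f1 (djac f1 f2).
  apply: (chart_flat (d := d) (Ox := Ox') (O := O)) => //.
  - by move=> q [].
  - by move=> s /Hd [[Is l1] [_ l2]]; exact: Ox's.
  - by move=> s /Hd [[Is l1] _]; exact: nbhs_singleton (lf_boundary l1).
  - by move=> s /Hd [[Is l1] _]; exact: (lf_transverse l1).
  - move=> s /Hd [[Is l1] [_ l2]]; have Os := Ox's s Is l1 l2.
    have OX : O (x1 (s, 0), x2 (s, 0)) by case: Os.
    have := djac_comp oO (hf1 1%N) (hf2 1%N) (hx1' 1%N) (hx2' 1%N) Os OX.
    rewrite {1}/djac -[X in X * _]/(pd false (f1 \o X) (s, 0)) -[X in _ - _ * X]/(pd false (f2 \o X) (s, 0)).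
    rewrite (XfB _ _ _ _ _ _ Is Os hf1 l1) (XfB _ _ _ _ _ _ Is Os hf2 l2) mul0r mulr0 subrr.
    by move=> /esym/eqP; rewrite mulf_eq0 (negPf (XJ Is)) orbF => /eqP.
  - by move=> s W /Hd [[Is _] _]; exact: (chart_open oOx OxI hx1 hx2 XJ Is).
  - by move=> s k e c C /Hd [[Is l1] [_ l2]]; exact: ns.
have Xt : X (t, 0) = bd t := chart_bd XE It.
have f10 : f1 (X (t, 0)) = 0 := nbhs_singleton (lf_boundary lf1).
have OX : O (X (t, 0)) by case: Ot.
rewrite -Xt.
have cl : closure [set q | 0 < f1 q] (X (t, 0)).
  have [m [M [m0 _ nm]]] := @comparable_height R Ox' (f1 \o X) t oOx' (fX _ hf1 1%N) Ot ((near_interval _ _).1 (lf_boundary lf1)) (lf_transverse lf1).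
  move=> B nB; have nB' := chart_cont OxI hx1 hx2 It nB.
  have [d1 d10 H1] := (near_square _ _).1 (near_and nm nB').
  have dd : d1 / 2 < d1 by rewrite ltr_pdivrMr // ltr_pMr // ltr1n.
  have d2 : 0 < d1 / 2 by rewrite divr_gt0.
  have [] := H1 (t, d1 / 2); rewrite /= ?subrr ?normr0 ?subr0 ?gtr0_norm //.
  move=> [/(_ (ltW d2)) /andP[a _] _] Bq; exists (X (t, d1 / 2)); split => //=.
  by apply: lt_le_trans a; rewrite mulr_gt0.
have tr1 := lf_transverse lf1; have tr2 := lf_transverse lf2.
rewrite (pd_chart OxI hx1 hx2 true oO hf1 It OX) in tr1.
rewrite (pd_chart OxI hx1 hx2 true oO hf2 It OX) in tr2.
rewrite /= -/(X (t, 0)) in tr1 tr2.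
have [b n1b n2b] : exists2 b, pd b f1 (X (t, 0)) != 0 & pd b f2 (X (t, 0)) != 0.
  have e : djac f1 f2 (X (t, 0)) = 0.
    have [C HC] := fl 1%N.
    have cD : {for X (t, 0), continuous (djac f1 f2)}.
      exact: (Cn_cont (CnB oO (CnM oO (Cn_pd false (hf1 1%N)) (Cn_pd true (hf2 1%N))) (CnM oO (Cn_pd true (hf1 1%N)) (Cn_pd false (hf2 1%N)))) OX).
    exact: flat_at0 (Cn_cont (hf1 0%N) OX) cD f10 cl fl.
  move: e tr1 tr2; rewrite /djac; clear.
  have [z1 e t1 t2|nz e t1 t2] := eqVneq (pd true f1 (X (t, 0))) 0.
    have nf : pd false f1 (X (t, 0)) != 0.
      by apply: contraTneq t1 => ->; rewrite z1 !mulr0 addr0 ltxx.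
    exists false => //; move/eqP: e; rewrite z1 mul0r subr0 mulf_eq0 (negPf nf) /= => /eqP z2.
    by apply: contraTneq t2 => ->; rewrite z2 !mulr0 addr0 ltxx.
  exists true => //; apply/negP => /eqP z2; move/eqP: e; rewrite z2 mulr0 sub0r oppr_eq0 mulf_eq0 (negPf nz) /= => /eqP z3.
  by move: t2; rewrite z2 z3 !mulr0 addr0 ltxx.
apply: (same_jet_flat n oO OX hf1 hf2 f10 cl n1b n2b) => //.
- by move=> q [Oq _] Aq; exact: (lf_kernel lf1).
- by move=> q [_ Oq] Aq; exact: (lf_kernel lf2).
Qed.

End SameJet.

Section CausticFlat.
Variable R : realType.
Local Notation plane := (plane R).

Theorem caustics_flatly_close (I : set R) (bd nu : R -> plane) (Ox : set plane) (x1 x2 : plane -> R)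
    (Psi : plane -> plane) (OP : set plane)
    U1 (h1 : plane -> R) T1 U2 (h2 : plane -> R) T2 :
  open I -> open Ox -> (forall s, I s -> Ox (s, 0)) -> Cinf Ox x1 -> Cinf Ox x2 ->
  (forall s r, I s -> (x1 (s, r), x2 (s, r)) = bd s + r *: nu s) ->
  (forall s, I s -> djac x1 x2 (s, 0) != 0) ->
  open OP -> (forall t, I t -> OP (bd t)) ->
  Cinf OP (fun q => (Psi q).1) -> Cinf OP (fun q => (Psi q).2) ->
  (forall t, I t -> djac (fun q => (Psi q).1) (fun q => (Psi q).2) (bd t) != 0) ->
  Defs.adjacent I bd nu U1 -> Defs.adjacent I bd nu U2 ->
  level_foliation I bd U1 h1 T1 -> level_foliation I bd U2 h2 T2 ->
  (forall t, I t -> caustic_at (with_boundary I bd U1) h1 T1 Psi bd t) ->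
  (forall t, I t -> caustic_at (with_boundary I bd U2) h2 T2 Psi bd t) ->
  (forall t, I t -> exists (c : R -> plane) (s0 : R),
    [/\ c s0 = Psi (bd t), (\forall s \near s0, derivable c (s : R) 1) /\ derivable (derive1 c) s0 1,
      det2 (derive1 c s0) (derive1n 2 c s0) != 0,
      contact Psi U1 bd t c s0 (inward c s0) & contact Psi U2 bd t c s0 (inward c s0)]) ->
  flatly_close I bd U1 T1 U2 T2.
Proof.
move=> oI oOx OxI hx1 hx2 XE XJ oP Pbd hP1 hP2 PJ ad1 ad2 le1 le2 ca1 ca2 tg n t It.
have [ O1 [f1 lf1]] := local_param oI oOx OxI hx1 hx2 XE XJ ad1 le1 It.
have [ O2 [f2 lf2]] := local_param oI oOx OxI hx1 hx2 XE XJ ad2 le2 It.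
apply: (same_jet_at oI oOx OxI hx1 hx2 XE XJ n It lf1 lf2) => s k e c C Is l1 l2 k0 e1 c0.
exact: (no_sign_at oI oOx OxI hx1 hx2 XE XJ oP Pbd hP1 hP2 PJ ad1 ad2 ca1 ca2 tg Is l1 l2 k0 e1 c0).
Qed.
End CausticFlat.

(** * Caustics of planar curves *)

Section PlanarCurve.
Variable R : realType.
Local Notation plane := (plane R).
Implicit Types (f g : plane -> R) (p q : plane) (O N A U : set plane) (I : set R).

Lemma smooth_curve_derive I (c : R -> plane) : smooth_curve I c -> smooth_curve I (derive1 c).
Proof. by move=> h n t It; have := h n.+1 t It; rewrite /derive1n iterSr. Qed.

Lemma curve_components (c : R -> plane) t : derivable c t 1 ->
  is_derive t 1 (fun s => (c s).1) (derive1 c t).1 /\ is_derive t 1 (fun s => (c s).2) (derive1 c t).2.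
Proof. by move=> /derivableP; rewrite -derive1E => /is_derive_pair. Qed.

Lemma pd_lift (g : R -> R) q d : is_derive q.1 1 g d ->
  is_derive q (axis R false) (fun p => g p.1) d /\ is_derive q (axis R true) (fun p => g p.1) 0.
Proof.
move=> [d1 d2]; split; first by split; [exact: d1|exact: d2].
apply/is_derive_line; have -> : (fun h : R => g (h *: axis R true + q).1) = cst (g q.1).
  by apply/funext => h /=; rewrite scaler0 add0r.
exact: is_derive_cst.
Qed.

(** [g k] is the derivative of order [k]. *)
Lemma Cn_lift I n (g : nat -> R -> R) : open I ->
  (forall k t, I t -> is_derive t 1 (g k) (g k.+1 t)) ->
  Cn n [set q : plane | I q.1] (fun q => g 0%N q.1).
Proof.
move=> oI; have oO : open [set q : plane | I q.1].
  rewrite openE => q Iq; have nI : nbhs q.1 I by apply: open_nbhs_nbhs.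
  exact: (cvg_fst nI).
have cg (k : nat -> R -> R) q : (forall t, I t -> is_derive t 1 (k 0%N) (k 1%N t)) -> I q.1 ->
    {for q, continuous (fun p : plane => k 0%N p.1)}.
  move=> hk Iq; have c0 : {for q.1, continuous (k 0%N)}.
    by apply: differentiable_continuous; apply/derivable1_diffP; case: (hk _ Iq).
  by apply: (continuous_comp _ c0); exact: cvg_fst.
elim: n g => [|n IH] g hg.
  by apply: Cn_intro => // q; apply: cg; exact: hg.
apply: Cn_intro.
- by move=> q; apply: cg; exact: hg.
- move=> b q _ Iq; have [[e1 _] [e2 _]] := pd_lift (hg 0%N _ Iq).
  by case: b; [exact: e2|exact: e1].
move=> b _ /=; case: b.
  apply: (Cn_ext (f := fun=> 0) oO); last exact: Cn_cst.
  by move=> q Iq; have [_ [_]] := pd_lift (hg 0%N _ Iq).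
apply: (Cn_ext (f := fun q => g 1%N q.1) oO); first by move=> q Iq; have [[_]] := pd_lift (hg 0%N _ Iq).
exact: (IH (fun k => g k.+1) (fun k t It => hg k.+1 t It)).
Qed.

Lemma smooth_curve_Cinf I (c : R -> plane) : open I -> smooth_curve I c ->
  Cinf [set q | I q.1] (fun q => (c q.1).1) /\ Cinf [set q | I q.1] (fun q => (c q.1).2).
Proof.
move=> oI hc; split=> n.
  apply: (@Cn_lift I n (fun k s => (derive1n k c s).1) oI) => k t It.
  exact: (curve_components (hc k t It)).1.
apply: (@Cn_lift I n (fun k s => (derive1n k c s).2) oI) => k t It.
exact: (curve_components (hc k t It)).2.
Qed.

Lemma det_inward (c : R -> plane) s : det2 (derive1 c s) (derive1n 2 c s) != 0 ->
  det2 (derive1 c s) (inward c s) != 0.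
Proof.
move=> k0; have [k kE] : exists k, k = det2 (derive1 c s) (derive1n 2 c s) by exists (det2 (derive1 c s) (derive1n 2 c s)).
rewrite -kE in k0; rewrite /inward -kE (det_tau_n (erefl _)) mulf_neq0 // gt_eqF //.
by apply: (tau_neq0 kE).
Qed.

Section Strip.
Variables (I : set R) (gam : R -> plane).
Hypothesis (oI : open I) (sc : strictly_convex I gam).
Let Ox : set plane := [set q | I q.1].
Let x1 q := (gam q.1).1 + q.2 * (inward gam q.1).1.
Let x2 q := (gam q.1).2 + q.2 * (inward gam q.1).2.

Lemma strip_open : open Ox.
Proof.
rewrite openE => q Iq; have nI : nbhs q.1 I by apply: open_nbhs_nbhs.
exact: (cvg_fst nI).
Qed.

Lemma strip_Cinf : Cinf Ox x1 /\ Cinf Ox x2.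
Proof.
have [[sm _] _] := sc; have oO := strip_open.
have [a1 a2] := smooth_curve_Cinf oI sm.
have [b1 b2] := smooth_curve_Cinf oI (smooth_curve_derive sm).
have [c1 c2] := smooth_curve_Cinf oI (smooth_curve_derive (smooth_curve_derive sm)).
have k n : Cn n Ox (fun q => det2 (derive1 gam q.1) (derive1n 2 gam q.1)).
  exact: (CnB oO (CnM oO (b1 n) (c2 n)) (CnM oO (b2 n) (c1 n))).
split=> n.
  exact: (CnD oO (a1 n) (CnM oO (Cn_snd n Ox) (CnM oO (k n) (CnN oO (b2 n))))).
exact: (CnD oO (a2 n) (CnM oO (Cn_snd n Ox) (CnM oO (k n) (b1 n)))).
Qed.

Lemma strip_djac s : I s -> djac x1 x2 (s, 0) != 0.
Proof.
move=> Is; have [s1 s2] := strip_Cinf; have [[sm _] k0] := sc.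
have [a1 a2] := curve_components (sm 0%N s Is).
have pf (x : plane -> R) (g m : R -> R) d : Cinf Ox x -> (forall q, x q = g q.1 + q.2 * m q.1) -> is_derive s 1 g d ->
    pd false x (s, 0) = d /\ pd true x (s, 0) = m s.
  move=> hx xE [_ gd]; split.
    have [_ <-] := is_derive_x (Cn_derivable (b := false) (hx 1%N) (Is : Ox (s, 0))).
    by rewrite -gd; congr ('D_1 _ s); apply/funext => y; rewrite xE /= mul0r addr0.
  have [_ <-] := is_derive_y (Cn_derivable (b := true) (hx 1%N) (Is : Ox (s, 0))).
  have -> : (fun y => x (s, y)) = (fun y => g s + m s * y).
    by apply/funext => y; rewrite xE /= mulrC.
  have [_ ->] // : is_derive (0 : R) 1 (fun y : R => g s + m s * y) (m s).
  by apply: is_derive_eq; rewrite /GRing.scale /=; ring.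
have [e1 e2] := pf x1 _ (fun s => (inward gam s).1) _ s1 (fun q => erefl _) a1.
have [e3 e4] := pf x2 _ (fun s => (inward gam s).2) _ s2 (fun q => erefl _) a2.
by rewrite /djac e1 e2 e3 e4 [X in _ - X]mulrC; exact: (det_inward (k0 s Is)).
Qed.
End Strip.

(** The two paths of tangency points make up a path of triples which joins
    the diagonal to the pair of endpoints. *)
Lemma caustic_at_triples I bd U h T Psi t : I t -> symmetric_triples I bd U h T Psi ->
  caustic_at (with_boundary I bd U) h T Psi bd t.
Proof.
move=> It sy y z cy cz y0 z0 H _.
have one : 0 < (1 : R) <= 1 by rewrite ltr01 lexx.
have dg : Defs.diagonal I bd (bd t, bd t, bd t) by exists (bd t) => //; exists t.
apply: sy => //; split; last first.
  by case=> x _ [_ e1 e2]; have [_ _ /eqP] := H 1 one; rewrite -e1 -e2.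
exists (bd t, bd t, bd t) => //; exists (fun s => (bd t, y s, z s)); split.
- move: cy cz => /subspace_continuousP cy /subspace_continuousP cz; apply/subspace_continuousP => s hs.
  have c1 : (fun s => (bd t, y s)) @ within `[0, 1] (nbhs s) --> (bd t, y s).
    exact: (@cvg_pair _ _ _ _ (nbhs (bd t)) (nbhs (y s)) _ _ _ (fun=> bd t) y (cvg_cst _) (cy s hs)).
  exact: (@cvg_pair _ _ _ _ (nbhs (bd t, y s)) (nbhs (z s)) _ _ _ (fun s => (bd t, y s)) z c1 (cz s hs)).
- by rewrite y0 z0.
- by [].
move=> s /andP[s0 s1]; have [->|sn] := eqVneq s 0; first by right; rewrite y0 z0.
left; have hs : 0 < s <= 1 by rewrite s1 andbT lt_def sn.
have [a1 a2 a3 a4 a5] := H s hs.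
by split => //; exists t.
Qed.

(** The lines from the boundary point through the two endpoints are tangent to
    one leaf, and there the law holds for all pairs of tangent lines. *)
Lemma caustic_at_global I c U h T t : I t -> caustics_global I c U h T ->
  caustic_at (with_boundary I c U) h T idfun c t.
Proof.
move=> It [_ _ _ sy] y z cy cz y0 z0 H np.
have one : 0 < (1 : R) <= 1 by rewrite ltr01 lexx.
have [Ay lf _ [ny [v Tv vE]] [nz [w Tw wE]]] := H 1 one.
have did (q u : plane) : 'D_u (idfun : plane -> plane) q = u by have [_] := is_derive_id q u.
rewrite did /= in vE; rewrite did /= in wE.
have tl x d : leaf (with_boundary I c U) h (y 1) x -> x != c t -> T x d -> d = x - c t ->
    tangent_line (with_boundary I c U) h T (y 1) (c t) d.
  move=> lx xn Td dE; split; first by rewrite dE subr_eq0.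
  by exists x; split => //; rewrite /parallel /det2 dE mulrC subrr.
apply: (sy t (y 1)) => //.
- apply: (tl (y 1)) => //; last by rewrite -vE.
  by apply: connected_component_refl; split.
- by apply: (tl (z 1)) => //; rewrite -wE.
Qed.

Lemma zero_on_curve (c : R -> plane) t (L : plane -> R) : (\forall s \near t, L (c s) = 0) ->
  is_derive t 1 (L \o c) 0 /\ is_derive t 1 (derive1 (L \o c)) 0.
Proof.
have cst0 (g : R -> R) : (\forall s \near t, g s = 0) -> is_derive t 1 g 0.
  move=> hg; apply: (near_eq_is_derive (f := cst (0 : R))).
  by apply: filterS hg => s ->.
move=> L0; split; first exact: cst0.
apply: cst0; have := nbhs_interior L0; apply: filterS => s hs.
by rewrite derive1E (near_eq_derive _ (hs : \forall x \near s, (L \o c) x = cst 0 x)) derive_cst.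
Qed.

(** If the derivative were negative, the function would by [comparable_height] be
    negative on the whole convex side near the point, in the coordinates given
    by the curve and its normals. *)
Lemma side_derivative I (c : R -> plane) t N (L : plane -> R) : open I -> strictly_convex I c -> I t ->
  open N -> N (c t) -> Cinf N L -> (\forall s \near t, L (c s) = 0) ->
  (forall d, 0 < d -> exists2 p, side I c (inward c) t d p & 0 <= L p) ->
  0 <= 'D_(inward c t) L (c t).
Proof.
move=> oI sc It oN Nt hL L0 sd; rewrite leNgt; apply/negP => neg.
pose x1 (q : plane) := (c q.1).1 + q.2 * (inward c q.1).1.
pose x2 (q : plane) := (c q.1).2 + q.2 * (inward c q.1).2.
have [s1 s2] := strip_Cinf oI sc; have oO := strip_open oI.
pose Ox := [set q : plane | I q.1] `&` (fun q => (x1 q, x2 q)) @^-1` N.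
have oOx : open Ox by exact: (preimage_open oO oN s1 s2).
pose G q := - L (x1 q, x2 q).
have XE s r : (x1 (s, r), x2 (s, r)) = c s + r *: inward c s by [].
have X0 s : (x1 (s, 0), x2 (s, 0)) = c s by rewrite XE scale0r addr0.
have sO : Ox `<=` [set q | I q.1] by move=> q [].
have hLX : Cinf Ox (fun q => L (x1 q, x2 q)).
  move=> n; apply: (@Cn_comp R n N Ox L x1 x2) => //.
  - exact: Cn_sub sO (s1 n).
  - exact: Cn_sub sO (s2 n).
  - by move=> q [].
have hG : Cinf Ox G by move=> n; apply: CnN.
have Ot : Ox (t, 0) by split => //=; rewrite X0.
have G0 : exists2 d, 0 < d & forall s, `|s - t| < d -> G (s, 0) = 0.
  by apply/near_interval; apply: filterS L0 => s e; rewrite /G X0 e oppr0.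
have Gy : 0 < pd true G (t, 0).
  have [_ <-] := is_derive_y (Cn_derivable (b := true) (hG 1%N) Ot).
  have dL : is_derive (c t) (inward c t) L ('D_(inward c t) L (c t)).
    by apply/derivableP/diff_derivable; exact: (C1_differentiable oN (hL 1%N) Nt).1.
  move/is_derive_line : dL => dL; have [_ dN] := is_deriveN dL.
  have -> : (fun y => G (t, y)) = - (fun h : R => L (h *: inward c t + c t)).
    by apply/funext => y; rewrite /G XE addrC.
  by rewrite dN oppr_gt0.
have [m [M [m0 M0 nm]]] := comparable_height oOx (hG 1%N) Ot G0 Gy.
have [d d0 H] := (near_square _ _).1 nm.
have [p [s [r [Is sd' /andP[r0 rd] ->]]] Lp] := sd d d0.
have [||/(_ (ltW r0)) /andP[a _] _] := H (s, r) => //=; first by rewrite subr0 gtr0_norm.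
move: a; rewrite /G XE => a; have := lt_le_trans (mulr_gt0 m0 r0) a.
by rewrite oppr_gt0 ltNge Lp.
Qed.

(** The boundary curve is its own image. *)
Lemma contact_self I c U t : open I -> strictly_convex I c -> I t -> adjacent_convex I c U ->
  contact idfun U c t c t (inward c t).
Proof.
move=> oI sc It [_ _ _ _ side] N L oN Nt hL L0 LU.
have [z1 z2] := zero_on_curve L0; split => //.
apply: (side_derivative oI sc It oN Nt hL L0) => e e0.
have [d d0 hd] := side t It.
have ctn : (fun h : R => c t + h *: inward c t) @ (0 : R) --> c t.
  have : (fun h : R => c t + h *: inward c t) @ (0 : R) --> c t + (0 : R) *: inward c t.
    by apply: cvgD; [exact: cvg_cst|apply: cvgZ; [exact: cvg_id|exact: cvg_cst]].
  by rewrite scale0r addr0.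
have [d1 d10 h1] := (near_interval _ _).1 (ctn _ LU).
have [r0 [r00 r0d r01]] := ex_min2 d0 d10.
have [r1 [r10 r1r r1e]] := ex_min2 r00 e0.
have r2 : 0 < r1 / 2 by rewrite divr_gt0.
have r21 : r1 / 2 < r1 by rewrite ltr_pdivrMr // ltr_pMr // ltr1n.
exists (c t + r1 / 2 *: inward c t).
  by exists t, (r1 / 2); rewrite subrr normr0 r2 (lt_le_trans r21).
apply/ltW/h1; first by rewrite subr0 gtr0_norm // (lt_le_trans r21) // (le_trans r1r).
apply: hd; exists t, (r1 / 2); rewrite subrr normr0 r2 (lt_le_trans r21) //.
exact: le_trans r1r r0d.
Qed.

Theorem planar_arc_flatly_close I (gam : R -> plane) U1 h1 T1 U2 h2 T2 : planar_arc I gam ->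
  adjacent_convex I gam U1 -> adjacent_convex I gam U2 ->
  level_foliation I gam U1 h1 T1 -> level_foliation I gam U2 h2 T2 ->
  (forall t, I t -> caustic_at (with_boundary I gam U1) h1 T1 idfun gam t) ->
  (forall t, I t -> caustic_at (with_boundary I gam U2) h2 T2 idfun gam t) ->
  flatly_close I gam U1 T1 U2 T2.
Proof.
move=> [[oI _ _] sc _ _] ad1 ad2 le1 le2 ca1 ca2.
have [s1 s2] := strip_Cinf oI sc.
apply: (@caustics_flatly_close R I gam (inward gam) [set q | I q.1]
  (fun q => (gam q.1).1 + q.2 * (inward gam q.1).1) (fun q => (gam q.1).2 + q.2 * (inward gam q.1).2)
  idfun setT U1 h1 T1 U2 h2 T2 oI (strip_open oI)) => //.
- by move=> s Is; exact: (strip_djac oI sc Is).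
- exact: openT.
- by move=> n; exact: Cn_fst.
- by move=> n; exact: Cn_snd.
- by move=> t _; rewrite /djac !(pd_fst _ _).1 !(pd_snd _ _).1 /= mulr1 mulr0 subr0 oner_eq0.
move=> t It; exists gam, t; have [[sm _] k0] := sc; split => //.
- split; last exact: (sm 1%N t It).
  have nI : \forall s \near t, I s by apply: open_nbhs_nbhs.
  by apply: filterS nI => s Is; exact: (sm 0%N s Is).
- exact: k0.
- exact: (contact_self oI sc It ad1).
- exact: (contact_self oI sc It ad2).
Qed.
End PlanarCurve.

(** * Invariant foliations of billiard-like maps *)

Section BoundaryMap.
Variable R : realType.
Local Notation plane := (plane R).
Implicit Types (f g h : plane -> R) (p q : plane) (O N A U V W : set plane) (I : set R).

Lemma hor_point (s r : R) : ((s, r) : plane) = hor s + r *: (0, 1).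
Proof. by apply/eqP; rewrite /hor xpair_eqE /= /GRing.scale /= mulr0 addr0 mulr1 add0r !eqxx. Qed.

Lemma hor_djac (q : plane) : djac (@fst R R) (@snd R R) q = 1.
Proof. by rewrite /djac !(pd_fst _ _).1 !(pd_snd _ _).1 /= mulr1 mulr0 subr0. Qed.

Lemma hor_djac_neq0 (q : plane) : djac (@fst R R) (@snd R R) q != 0.
Proof. by rewrite hor_djac oner_eq0. Qed.

Lemma fst_Cinf : Cinf [set: plane] fst. Proof. by move=> n; exact: Cn_fst. Qed.
Lemma snd_Cinf : Cinf [set: plane] snd. Proof. by move=> n; exact: Cn_snd. Qed.

(** Near a boundary point the domain is the upper half plane. *)
Lemma adjacent_hor_near I U t : open I -> adjacent_hor I U -> I t ->
  \forall q \near ((t, 0) : plane), [/\ I q.1, (0 <= q.2 -> with_J I U q),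
    (0 < q.2 -> U q) & (with_J I U q -> 0 <= q.2)].
Proof.
move=> oI [Up [_ _ _ _ side]] It; have [d d0 hd] := side t It.
have nI : nbhs t I by apply: open_nbhs_nbhs.
have nd : \forall q \near ((t, 0) : plane), `|q.1 - t| < d /\ `|q.2 - 0| < d by apply/near_square; exists d.
have := near_and (near_fst nI) nd; apply: filterS => q [Iq [q1 q2]].
have Uq : 0 < q.2 -> U q.
  move=> q0; apply: hd; exists q.1, q.2; split => //; last by rewrite -hor_point -surjective_pairing.
  by rewrite q0 /=; move: q2; rewrite subr0 gtr0_norm.
split => //.
  rewrite le_eqVlt => /orP[/eqP e|/Uq]; last by left.
  by right; exists q.1 => //; rewrite /hor {1}e -surjective_pairing.
by case=> [/Up /ltW //|[s _ <-]]; rewrite lexx.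
Qed.

(** The invariant function is a transversal parameter of its own foliation. *)
Lemma invariant_leaf_function I V F U h t : open I -> I t -> invariant_foliation I V F U h ->
  exists O, leaf_function (with_J I U) h (kernel_field h) (fun q => (q.1, q.2)) t O h.
Proof.
move=> oI It [ad [ O [oO sO /smooth_Cinf hO]] _ h0 hy]; exists O.
have At : with_J I U (t, 0) by right; exists t.
have nI : \forall s \near t, I s by apply: open_nbhs_nbhs.
have bd0 : \forall s \near t, h (s, 0) = 0 by apply: filterS nI => s /h0.
split => //=.
- exact: sO.
- have [m [M [m0 M0 nm]]] := comparable_height oO (hO 1%N) (sO _ At) ((near_interval _ _).1 bd0) (hy _ At).
  have := near_and nm (adjacent_hor_near oI ad It); apply: filterS => q [[c1 c2] [a1 a2 a3 a4]].
  split => [/a4 q0|h0'].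
    by have /andP[a _] := c1 q0; apply: le_trans a; rewrite mulr_ge0 // ltW.
  by apply: a2; rewrite leNgt; apply/negP => /c2; rewrite ltNge h0'.
- exact: (hy _ At).
Qed.

(** Estimates for one step of the map from the point [(s, z ^+ 2)]: the move
    [u1] along the boundary is positive of order [z], and both the new height
    [u2] and the level of the leaf are of order [z ^+ 2]. *)
Lemma billiard_step (z w C al be m M v u1 u2 : R) : 0 < z -> z <= 1 -> 0 < w -> 0 <= C -> 0 <= M ->
  z + C * z + w * z + M * z <= v -> v <= w / 2 -> v <= al / 2 -> v <= be -> v <= m * be -> 0 < al ->
  `|u1 - w * z| <= C * z ^+ 2 -> `|u2 - z ^+ 2| <= C * (z ^+ 2 * z) ->
  [/\ 0 < u1, u1 < al, u2 <= be & M * z ^+ 2 <= m * be].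
Proof.
move=> z0 z1 w0 C0 M0 hv vw va vb vm al0.
have zz : z ^+ 2 <= z by rewrite expr2 ler_piMr // ltW.
have z20 : 0 <= z ^+ 2 by exact: sqr_ge0.
have z3 : z ^+ 2 * z <= z by rewrite -[leRHS]mul1r; apply: ler_pM => //; [exact: ltW|exact: le_trans zz z1].
have b1 : C * z ^+ 2 <= C * z by exact: ler_wpM2l.
have b2 : C * (z ^+ 2 * z) <= C * z by exact: ler_wpM2l.
have b3 : M * z ^+ 2 <= M * z by exact: ler_wpM2l.
have b4 : C * z ^+ 2 < w * z.
  rewrite expr2 mulrA ltr_pM2r //; apply: (@le_lt_trans _ _ v); last by apply: (le_lt_trans vw); move: w0; clear; lra.
  apply: le_trans hv; have := mulr_ge0 M0 (ltW z0); have := mulr_ge0 (ltW w0) (ltW z0).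
  by move: z0; clear; move: (C * z) (M * z) (w * z) => *; lra.
have c1 : 0 <= C * z by rewrite mulr_ge0 // ltW.
have c2 : 0 <= w * z by rewrite mulr_ge0 // ltW.
have c3 : 0 <= M * z by rewrite mulr_ge0 // ltW.
rewrite !ler_distl => /andP[d1 d2] /andP[d3 d4].
move: z0 zz b1 b2 b3 b4 c1 c2 c3 hv va vb vm al0 d1 d2 d3 d4; clear.
move: (C * z) (w * z) (M * z) (C * z ^+ 2) (C * (z ^+ 2 * z)) (M * z ^+ 2) (m * be) (z ^+ 2) => *.
by split; lra.
Qed.

(** A point [(s, y)] and its image are on one level curve of [h1], the image
    being to the right, and [h2] takes the same value at both. So the
    determinant vanishes at a point between them, where [h1] is positive. *)
Lemma billiard_no_sign I V F U1 h1 U2 h2 s O1 O2 k (e c C : R) : open I -> I s -> adjacent_hor I V ->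
  lifted_strongly_billiard_like I V F ->
  invariant_foliation I V F U1 h1 -> invariant_foliation I V F U2 h2 ->
  leaf_function (with_J I U1) h1 (kernel_field h1) (fun q => (q.1, q.2)) s O1 h1 ->
  leaf_function (with_J I U2) h2 (kernel_field h2) (fun q => (q.1, q.2)) s O2 h2 ->
  0 < c ->
  ~ (\forall q \near ((s, 0) : plane), 0 <= h1 q ->
       c * h1 q ^+ k <= e * djac h1 h2 q /\ `|djac h1 h2 q| <= C * h1 q ^+ k).
Proof.
move=> oI Is adV [Fpos _ _ [w [w0 expd _]]] [ad1 _ inv1 b1 y1] [ad2 _ inv2 b2 y2] lf1 lf2 c0 bnd.
pose O := O1 `&` O2.
have oO : open O by apply: openI; [exact: lf_open lf1|exact: lf_open lf2].
have Os : O (s, 0) by split; [exact: lf_in lf1|exact: lf_in lf2].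
have hh1 : Cinf O h1 by move=> j; apply: Cn_sub (lf_smooth lf1 j) => q [].
have hh2 : Cinf O h2 by move=> j; apply: Cn_sub (lf_smooth lf2 j) => q [].
have As : with_J I U1 (s, 0) by right; exists s.
have v0 : 0 < pd true h1 (s, 0) := y1 _ As.
have [m [M [m0 M0 nm]]] := comparable_height oO (hh1 1%N) Os ((near_interval _ _).1 (lf_boundary lf1)) v0.
have nO : \forall q \near ((s, 0) : plane), O q by apply: open_nbhs_nbhs.
have [K nK] := ex_intro (fun K => \forall q \near ((s, 0) : plane), `|pd false h1 q| <= K) _ (near_bounded (Cn_cont (Cn_pd false (hh1 1%N)) Os)).
have [mu [mu0 nmu]] : exists mu, 0 < mu /\ \forall q \near ((s, 0) : plane), mu <= pd true h1 q.
  have vv : 0 < pd true h1 (s, 0) / 2 by rewrite divr_gt0.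
  exists (pd true h1 (s, 0) / 2); split => //.
  move/cvgrPdist_lt : (Cn_cont (Cn_pd true (hh1 1%N)) Os) => /(_ _ vv); apply: filterS => q.
  by rewrite ltr_norml => /andP[_]; move: vv; clear; lra.
have [d d0 H] := (near_square _ _).1 (near_and (near_and nO (near_and nm bnd)) (near_and (near_and nK nmu)
  (near_and (adjacent_hor_near oI adV Is) (near_and (adjacent_hor_near oI ad1 Is) (adjacent_hor_near oI ad2 Is))))).
have d2 : 0 < d / 2 by rewrite divr_gt0.
have dd : d / 2 < d by rewrite ltr_pdivrMr // ltr_pMr // ltr1n.
have sub1 : [set s] `<=` I by move=> _ ->.
have [C1 [dl [dl0 hF]]] := expd [set s] (@compact_set1 _ s) sub1.
have w0s := w0 s Is.
have [v [v0' [va [vm [vw vl]]]]] : exists v, 0 < v /\ v <= d / 2 / 2 /\ v <= mu * (d / 2) /\ v <= w s / 2 /\ v <= dl / 2.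
  have p1 : 0 < d / 2 / 2 by rewrite divr_gt0.
  have p2 : 0 < mu * (d / 2) by rewrite mulr_gt0.
  have p3 : 0 < w s / 2 by rewrite divr_gt0.
  have p4 : 0 < dl / 2 by rewrite divr_gt0.
  have [z1 [a1 a2 a3]] := ex_min2 p1 p2; have [z2 [a4 a5 a6]] := ex_min2 p3 p4.
  have [z3 [a7 a8 a9]] := ex_min2 a1 a4; exists z3; split => //.
  by split; [exact: le_trans a2|split; [exact: le_trans a3|split; [exact: le_trans a5|exact: le_trans a6]]].
have B0 : 0 < 1 + `|C1| + w s + M by apply: (ltr_wpDr (ltW M0)); apply: (ltr_wpDr (ltW w0s)); apply: ltr_wpDr.
have vB : 0 < v / (1 + `|C1| + w s + M) by rewrite divr_gt0.
have [z [z0 z1 zB]] := ex_min2 ltr01 vB.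
have {}zB : z + `|C1| * z + w s * z + M * z <= v.
  rewrite (@ler_pdivlMr _ _ z v B0) in zB; apply: le_trans zB.
  by rewrite le_eqVlt; apply/orP; left; apply/eqP; ring.
pose y := z ^+ 2.
have y0 : 0 < y by rewrite exprn_gt0.
have yz : y <= z by rewrite /y expr2 ler_piMr // ltW.
have zv : z <= v.
  apply: le_trans zB; rewrite -!addrA lerDl !addr_ge0 // mulr_ge0 //; exact: ltW.
have vdl : v < dl by apply: (le_lt_trans vl); rewrite ltr_pdivrMr // ltr_pMr // ltr1n.
have vd : v < d / 2 by apply: (le_lt_trans va); rewrite ltr_pdivrMr // ltr_pMr // ltr1n.
have ydl : 0 < y < dl by rewrite y0 (le_lt_trans yz) // (le_lt_trans zv).
have yd2 : y < d / 2 by rewrite (le_lt_trans yz) // (le_lt_trans zv).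
have box q : `|q.1 - s| <= d / 2 -> `|q.2| <= d / 2 -> `|q.1 - s| < d /\ `|q.2 - 0| < d.
  by move=> q1 q2; rewrite subr0 (le_lt_trans q1 dd) (le_lt_trans q2 dd).
have Bq := fun q (q1 : `|q.1 - s| <= d / 2) (q2 : `|q.2| <= d / 2) => H q (box q q1 q2).1 (box q q1 q2).2.
have q1b : `|(s, y).1 - s| <= d / 2 by rewrite subrr normr0 ltW.
have q2b : `|(s, y).2| <= d / 2 by rewrite gtr0_norm // ltW.
have [[Oq [nq bq]] [[Kq muq] [[_ _ Vq _] [[_ Aq1 _ _] [_ Aq2 _ _]]]]] := Bq (s, y) q1b q2b.
have Vy : V (s, y) := Vq y0.
have [F1 F2] := hF s y erefl ydl Vy.
have sz : Num.sqrt y = z by rewrite sqrtr_sqr gtr0_norm.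
rewrite sz in F1 F2.
have F1' : `|((F (s, y)).1 - s) - w s * z| <= `|C1| * z ^+ 2.
  have -> : (F (s, y)).1 - s - w s * z = (F (s, y)).1 - (s + w s * z) by ring.
  by apply: (le_trans F1); apply: ler_wpM2r; [exact: ltW|exact: ler_norm].
have F2' : `|(F (s, y)).2 - z ^+ 2| <= `|C1| * (z ^+ 2 * z).
  by apply: (le_trans F2); apply: ler_wpM2r; [apply: mulr_ge0; exact: ltW|exact: ler_norm].
have vd' : v <= d / 2 by exact: ltW.
have [g1 g2 g3 g4] := billiard_step z0 z1 w0s (normr_ge0 C1) (ltW M0) zB vw va vd' vm d2 F1' F2'.
have Vwq : with_J I V (s, y) by left.
have F20 : 0 <= (F (s, y)).2 := Fpos _ Vwq.
have [s' s'E] : exists s', s' = (F (s, y)).1 by exists (F (s, y)).1.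
have [y' y'E] : exists y', y' = (F (s, y)).2 by exists (F (s, y)).2.
have FE : F (s, y) = (s', y') by rewrite s'E y'E -surjective_pairing.
rewrite -s'E in g1 g2; rewrite -y'E in g3 F20.
have ss' : s < s' by rewrite -subr_gt0.
have p1b : `|(s', y').1 - s| <= d / 2 by rewrite /= gtr0_norm // ltW.
have p2b : `|(s', y').2| <= d / 2 by rewrite /= ger0_norm.
have [_ [_ [_ [[_ Ap1 _ _] [_ Ap2 _ _]]]]] := Bq (s', y') p1b p2b.
have e1 : h1 (s', y') = h1 (s, y).
  by rewrite -FE; apply: inv1 => //; [apply: Aq1; exact: ltW|rewrite FE; exact: Ap1].
have e2 : h2 (s', y') = h2 (s, y).
  by rewrite -FE; apply: inv2 => //; [apply: Aq2; exact: ltW|rewrite FE; exact: Ap2].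
have /andP[uy1 uy2] := nq.1 (ltW y0).
have u0 : 0 < h1 (s, y) by apply: lt_le_trans uy1; rewrite mulr_gt0.
have [||rho [r1 r2 _ r4]] := @leaf_graph R O h1 (s, 0) (d / 2) (d / 2) mu K (h1 (s, y)) (hh1 1%N) (ltW d2) (ltW d2) mu0.
- move=> q /= q1 q2; rewrite subr0 in q2; have [[Oq' _] [[Kq' muq'] _]] := Bq q q1 q2; split => //.
- move=> a /= ha.
  have a2 : `|(a, 0 : R).2| <= d / 2 by rewrite /= normr0 ltW.
  have [_ [_ [_ [[Ia _ _ _] _]]]] := Bq (a, 0) ha a2.
  by rewrite b1 // sub0r normrN gtr0_norm //; apply: le_trans g4.
rewrite /= in r1 r2 r4.
have rs : rho s = y.
  by apply/esym/r2; rewrite ?subr0 ?subrr ?normr0 ?gtr0_norm //; exact: ltW.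
have rs' : rho s' = y'.
  by apply/esym/r2 => //; rewrite subr0.
have [x|x hx] := @leaf_variation R O h1 h2 rho s s' oO (hh1 1%N) (hh2 1%N).
  rewrite (min_idPl (ltW ss')) (max_idPr (ltW ss')) => /andP[x1 x2].
  have xs : `|x - s| < d / 2 by rewrite ger0_norm ?subr_ge0 //; apply: le_lt_trans g2; rewrite lerD2r.
  have [rx1 rx2] := r1 x (ltW xs); rewrite subr0 in rx1.
  have [[Ox _] [[_ mux] _]] := Bq (x, rho x) (ltW xs) rx1.
  by split => //; [rewrite gt_eqF // (lt_le_trans mu0)|exact: r4].
rewrite rs rs' e2 subrr => /esym/eqP.
rewrite (min_idPl (ltW ss')) (max_idPr (ltW ss')) in hx; have /andP[x1 x2] := hx.
have xs : `|x - s| <= d / 2 by rewrite ger0_norm ?subr_ge0 //; apply/ltW; apply: le_lt_trans g2; rewrite lerD2r.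
have [rx1 rx2] := r1 x xs; rewrite subr0 in rx1.
have [[_ [_ bx]] [[_ mux] _]] := Bq (x, rho x) xs rx1.
have hx0 : 0 <= h1 (x, rho x) by rewrite rx2 ltW.
have [b1' _] := bx hx0.
have vx : pd true h1 (x, rho x) != 0 by rewrite gt_eqF // (lt_le_trans mu0).
rewrite mulf_eq0 oppr_eq0 mulf_eq0 invr_eq0 (negPf vx) orbF [s' - s == 0]subr_eq0 (gt_eqF ss') orbF => /eqP z'.
by move: b1'; rewrite z' mulr0 rx2 leNgt mulr_gt0 // exprn_gt0.
Qed.

Theorem billiard_flatly_close I V F U1 h1 U2 h2 : open_interval I -> adjacent_hor I V ->
  lifted_strongly_billiard_like I V F ->
  invariant_foliation I V F U1 h1 -> invariant_foliation I V F U2 h2 ->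
  flatly_close I (@hor R) U1 (kernel_field h1) U2 (kernel_field h2).
Proof.
move=> [oI _ _] adV bF iF1 iF2 n t It.
have [ O1 lf1] := invariant_leaf_function oI It iF1.
have [ O2 lf2] := invariant_leaf_function oI It iF2.
apply: (@same_jet_at R I (@hor R) (fun=> (0, 1)) setT fst snd oI openT (fun _ _ => Logic.I) fst_Cinf snd_Cinf
  (fun s r _ => hor_point s r) (fun s _ => hor_djac_neq0 (s, 0)) _ h1 _ _ h2 _ n t O1 h1 O2 h2 It lf1 lf2).
move=> s k e c C Is l1 l2 _ _ c0.
exact: (billiard_no_sign oI Is adV bF iF1 iF2 l1 l2 c0).
Qed.
End BoundaryMap.

(** * Invariant foliations of flat twists *)

Section FlatTwist.
Variable R : realType.
Local Notation plane := (plane R).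
Implicit Types (f g h : plane -> R) (p q : plane) (O N A U V W : set plane) (I : set R).

Lemma iter_pderivs j b g : iter j (pd true) (pd b g) = pderivs (nseq j true ++ [:: b]) g.
Proof. by elim: j => //= j ->. Qed.

(** The derivatives on the boundary are limits of derivatives inside, where [k]
    coincides with the flat function. *)
Lemma flat_derivatives I W f k O w s : open I -> I s -> adjacent_hor I W -> flat I W f ->
  open O -> O (s, 0) -> Cinf O k -> (forall q, W q -> k q = f q) ->
  pderivs w k (s, 0) = 0.
Proof.
move=> oI Is ad [_ _ fl] oO Os hk kE; have [Wp [oW _ _ _ _]] := ad.
apply/eqP; rewrite -normr_eq0 eq_le normr_ge0 andbT; apply/ler_addgt0Pr => e e0; rewrite add0r.
have e2 : 0 < e / 2 by rewrite divr_gt0.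
have sub1 : [set s] `<=` I by move=> _ ->.
have [d1 d10 H1] := fl w [set s] (e / 2) (@compact_set1 _ s) sub1 e2.
move/cvgrPdist_lt : (Cn_cont (Cinf_pderivs w hk 0%N) Os) => /(_ _ e2) nk.
have [d2 d20 H2] := (near_square _ _).1 (near_and nk (adjacent_hor_near oI ad Is)).
have [d [d0 dd1 dd2]] := ex_min2 d10 d20.
have y0 : 0 < d / 2 by rewrite divr_gt0.
have yd : d / 2 < d by rewrite ltr_pdivrMr // ltr_pMr // ltr1n.
have yd1 : 0 < d / 2 < d1 by rewrite y0 (lt_le_trans yd).
have c1 : `|(s, d / 2).1 - s| < d2 by rewrite subrr normr0.
have c2 : `|(s, d / 2).2 - 0| < d2 by rewrite /= subr0 gtr0_norm // (lt_le_trans yd).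
have [q1 [_ _ Wq _]] := H2 (s, d / 2) c1 c2.
have {}Wq := Wq y0.
have q2 := H1 s (d / 2) erefl yd1 Wq.
rewrite -(pderivs_ext w oW kE Wq) in q2.
rewrite -[pderivs w k (s, 0)](subrK (pderivs w k (s, d / 2))).
apply: (le_trans (ler_normD _ _)); rewrite (splitr e); apply: lerD; exact: ltW.
Qed.

(** The height does not contribute to the horizontal derivative, and that of the
    flat correction vanishes on the boundary with all its derivatives. *)
Lemma flat_foliation_horizontal I V F W h t n O : open I -> I t -> flat_invariant_foliation I V F W h ->
  open O -> with_J I W `<=` O -> Cinf O h ->
  exists C, \forall q \near ((t, 0) : plane), 0 <= q.2 -> `|pd false h q| <= C * q.2 ^+ n.
Proof.
move=> oI It [[ad _] _ _ [f fl hE] _] oO sO hh.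
pose k q := h q - q.2.
have hk : Cinf O k by move=> j; apply: CnB => //; exact: Cn_snd.
have kE q : W q -> k q = f q by move=> Wq; rewrite /k (hE q (or_introl Wq)) addrC addKr.
have Os s : I s -> O (s, 0) by move=> Is; apply: sO; right; exists s.
have [d d0 Hd] := (near_interval t I).1 (open_nbhs_nbhs (conj oI It)).
have [|C HC] := @order_upper R O (pd false k) n t oO (Cinf_pd false hk) (Os t It).
  exists d => // j s _ /Hd Is; rewrite iter_pderivs.
  exact: (flat_derivatives _ oI Is ad fl oO (Os s Is) hk kE).
exists C; have nO : \forall q \near ((t, 0) : plane), O q by apply: open_nbhs_nbhs; split => //; exact: Os.
have := near_and nO HC; apply: filterS => q [Oq Hq] /Hq.
have [_ kd] := is_deriveB (pd_is_derive false (hh 1%N) Oq) (pd_is_derive false (Cn_snd 1 O) Oq).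
by rewrite -[pd false k q]/('D_(axis R false) (h \- snd) q) kd (pd_snd _ _).1 subr0.
Qed.

Theorem twist_flatly_close I V F W1 h1 W2 h2 : open_interval I ->
  flat_invariant_foliation I V F W1 h1 -> flat_invariant_foliation I V F W2 h2 ->
  flatly_close I (@hor R) W1 (kernel_field h1) W2 (kernel_field h2).
Proof.
move=> [oI _ _] F1 F2 n t It.
have [[ad1 _] [ O1 [oO1 sO1 /smooth_Cinf hO1]] _ [f1 fl1 hE1] y1] := F1.
have [[ad2 _] [ O2 [oO2 sO2 /smooth_Cinf hO2]] _ [f2 fl2 hE2] y2] := F2.
pose O := O1 `&` O2.
have oO : open O by exact: openI.
have hh1 : Cinf O h1 by move=> j; apply: Cn_sub (hO1 j) => q [].
have hh2 : Cinf O h2 by move=> j; apply: Cn_sub (hO2 j) => q [].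
have A1 s : I s -> with_J I W1 (s, 0) by move=> Is; right; exists s.
have A2 s : I s -> with_J I W2 (s, 0) by move=> Is; right; exists s.
have Ot : O (t, 0) by split; [exact: sO1 (A1 t It)|exact: sO2 (A2 t It)].
have h10 s : I s -> h1 (s, 0) = 0.
  by move=> Is; rewrite (hE1 _ (A1 s Is)) add0r; have [_ -> //] := fl1.
have nI : \forall s \near t, I s by apply: open_nbhs_nbhs.
have bd0 : \forall s \near t, h1 (s, 0) = 0 by apply: filterS nI => s /h10.
have v1 := y1 _ (A1 t It); have v2 := y2 _ (A2 t It).
have [m [M [m0 M0 nm]]] := comparable_height oO (hh1 1%N) Ot ((near_interval _ _).1 bd0) v1.
have cl : closure [set q | 0 < h1 q] ((t, 0) : plane).
  move=> B nB; have [d d0 H] := (near_square _ _).1 (near_and nm nB).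
  have dd : d / 2 < d by rewrite ltr_pdivrMr // ltr_pMr // ltr1n.
  have d2 : 0 < d / 2 by rewrite divr_gt0.
  have [] := H (t, d / 2); rewrite /= ?subrr ?normr0 ?subr0 ?gtr0_norm //.
  move=> [/(_ (ltW d2)) /andP[a _] _] Bq; exists (t, d / 2); split => //=.
  by apply: lt_le_trans a; rewrite mulr_gt0.
apply: (same_jet_flat n oO Ot hh1 hh2 (h10 t It) cl (b := true)) => //.
- by rewrite gt_eqF.
- by rewrite gt_eqF.
move=> k.
have [C1 H1] := flat_foliation_horizontal k oI It F1 oO1 sO1 hO1.
have [C2 H2] := flat_foliation_horizontal k oI It F2 oO2 sO2 hO2.
have n1 := near_bounded (Cn_cont (Cn_pd true (hh1 1%N)) Ot).
have n2 := near_bounded (Cn_cont (Cn_pd true (hh2 1%N)) Ot).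
move: (`|pd true h1 (t, 0)| + 1) (`|pd true h2 (t, 0)| + 1) n1 n2 => K1 K2 n1 n2.
exists ((`|C1| * K2 + K1 * `|C2|) * m^-1 ^+ k).
have := near_and nm (near_and (near_and H1 H2) (near_and n1 n2)).
apply: filterS => q [[c1 c2] [[/= a1 a2] [k1 k2]]] hq.
have q0 : 0 <= q.2 by rewrite leNgt; apply/negP => /c2; rewrite ltNge ltW.
have /andP[mq _] := c1 q0.
have qk : q.2 ^+ k <= m^-1 ^+ k * h1 q ^+ k.
  rewrite -exprMn; apply: lerXn2r.
  - by rewrite nnegrE.
  - by rewrite nnegrE mulr_ge0 // ?invr_ge0; exact: ltW.
  by rewrite -(ler_pM2l m0) mulrA divff ?gt_eqF // mul1r.
have b (C P : R) : `|P| <= C * q.2 ^+ k -> `|P| <= `|C| * (m^-1 ^+ k * h1 q ^+ k).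
  move=> /le_trans; apply; apply: (@le_trans _ _ (`|C| * q.2 ^+ k)).
    by apply: ler_wpM2r; [exact: exprn_ge0|exact: ler_norm].
  by apply: ler_wpM2l.
have {}a1 := b C1 _ (a1 q0); have {}a2 := b C2 _ (a2 q0).
rewrite /djac; apply: (le_trans (ler_normB _ _)); rewrite !normrM.
have -> : (`|C1| * K2 + K1 * `|C2|) * m^-1 ^+ k * h1 q ^+ k =
  `|C1| * (m^-1 ^+ k * h1 q ^+ k) * K2 + K1 * (`|C2| * (m^-1 ^+ k * h1 q ^+ k)) by ring.
by apply: lerD; apply: ler_pM.
Qed.
End FlatTwist.

(** * Lifted caustics of immersed curves *)

Section Lifted.
Variable R : realType.
Local Notation plane := (plane R).
Implicit Types (f g h : plane -> R) (p q : plane) (O N A U V W : set plane) (I : set R).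

Lemma smooth_components O (Psi : plane -> plane) : open O -> smooth O Psi ->
  [/\ Cinf O (fun q => (Psi q).1), Cinf O (fun q => (Psi q).2) &
      forall q, O q -> djac (fun q => (Psi q).1) (fun q => (Psi q).2) q = jac Psi q].
Proof.
move=> oO sP; have [h1 e1] := smooth_fst oO sP; have [h2 e2] := smooth_snd oO sP.
by split => // q Oq; rewrite /jac /det2 /djac !e1 // !e2 // [X in _ - X]mulrC.
Qed.

(** The image of the boundary is the given curve, and points of the domain are
    sent to its convex side, so that [side_derivative] applies. *)
Theorem lifted_flatly_close I (psi : R -> plane) V (Psi : plane -> plane) U1 h1 T1 U2 h2 T2 :
  open I -> strictly_convex I psi -> adjacent_hor I V ->
  smooth_on (with_J I V) Psi -> (forall p, with_J I V p -> jac Psi p != 0) ->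
  (forall t, I t -> Psi (hor t) = psi t) -> sends_to_convex_side I psi V Psi ->
  adjacent_hor I U1 -> lifted_caustics I Psi U1 h1 T1 -> U1 `<=` V ->
  adjacent_hor I U2 -> lifted_caustics I Psi U2 h2 T2 -> U2 `<=` V ->
  flatly_close I (@hor R) U1 T1 U2 T2.
Proof.
move=> oI sc adV [ O [oO sO sP]] J0 PE sd ad1 [le1 _ sy1] UV1 ad2 [le2 _ sy2] UV2.
have [hP1 hP2 PJ] := smooth_components oO sP.
have Abd t : I t -> with_J I V (hor t) by move=> It; right; exists t.
have ct U t : I t -> adjacent_hor I U -> U `<=` V -> contact Psi U (@hor R) t psi t (inward psi t).
  move=> It ad UV N L oN Nt hL L0 LU.
  have nI : \forall s \near t, I s by apply: open_nbhs_nbhs.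
  have L0' : \forall s \near t, L (psi s) = 0.
    by have := near_and nI L0; apply: filterS => s [/PE <-].
  have [z1 z2] := zero_on_curve L0'; split => //.
  apply: (side_derivative oI sc It oN Nt hL L0') => d d0.
  have [d1 d10 H] := (near_square _ _).1 (near_and LU (near_and (sd t d It d0) (adjacent_hor_near oI ad It))).
  have dd : d1 / 2 < d1 by rewrite ltr_pdivrMr // ltr_pMr // ltr1n.
  have d2 : 0 < d1 / 2 by rewrite divr_gt0.
  have [||l1 [l2 [_ _ l3 _]]] := H (t, d1 / 2); rewrite /= ?subrr ?normr0 ?subr0 ?gtr0_norm //.
  exists (Psi (t, d1 / 2)); first by apply: l2; apply: UV; exact: l3.
  by apply/ltW/l1; exact: l3.
refine (@caustics_flatly_close R I (@hor R) (fun=> (0, 1)) setT fst snd Psi O U1 h1 T1 U2 h2 T2 oI openT (fun _ _ => Logic.I) (fst_Cinf R) (snd_Cinf R)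
  (fun s r _ => hor_point s r) (fun s _ => hor_djac_neq0 (s, 0)) oO (fun t It => sO _ (Abd t It)) hP1 hP2 _ _ _ _ _ _ _ _).
- by move=> t It; rewrite PJ; [exact: J0 (Abd t It)|exact: sO (Abd t It)].
- by case: ad1.
- by case: ad2.
- exact: le1.
- exact: le2.
- by move=> t It; exact: caustic_at_triples.
- by move=> t It; exact: caustic_at_triples.
move=> t It; exists psi, t; have [[sm _] k0] := sc; split.
- by rewrite PE.
- split; last exact: (sm 1%N t It).
  have nI : \forall s \near t, I s by apply: open_nbhs_nbhs.
  by apply: filterS nI => s Is; exact: (sm 0%N s Is).
- exact: k0.
- exact: ct.
- exact: ct.
Qed.
End Lifted.

(** * Lifted caustics of closed curves *)

Section ClosedCurve.
Variable R : realType.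
Local Notation plane := (plane R).
Implicit Types (f g h : plane -> R) (p q : plane) (O N A U V W : set plane) (I : set R).

(** Extend the composition to the plane by a function of the first coordinate
    only. *)
Lemma curve_twice_derivable I (c : R -> plane) t N (L : plane -> R) : open I -> smooth_curve I c -> I t ->
  open N -> N (c t) -> Cinf N L -> exists dG ddG,
    (\forall s \near t, is_derive (s : R) 1 (L \o c) (dG s)) /\ is_derive t 1 dG ddG.
Proof.
move=> oI sm It oN Nt hL; have [h1 h2] := smooth_curve_Cinf oI sm; have oO := strip_open oI.
pose Ox := [set q : plane | I q.1] `&` (fun q => ((c q.1).1, (c q.1).2)) @^-1` N.
have oOx : open Ox by exact: (preimage_open oO oN h1 h2).
have sO : Ox `<=` [set q | I q.1] by move=> q [].
pose k (q : plane) := L ((c q.1).1, (c q.1).2).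
have hk : Cinf Ox k.
  move=> n; apply: (@Cn_comp R n N Ox L (fun q => (c q.1).1) (fun q => (c q.1).2)) => //.
  - exact: Cn_sub sO (h1 n).
  - exact: Cn_sub sO (h2 n).
  - by move=> q [].
have Ot : Ox (t, 0) by split => //=; rewrite -surjective_pairing.
exists (fun s => pd false k (s, 0)), (pd false (pd false k) (t, 0)); split; last first.
  exact: (is_derive_x (Cn_derivable (b := false) (Cinf_pd false hk 1%N) Ot)).
have nO : \forall s \near t, Ox (s, 0) by apply: near_axis; apply: open_nbhs_nbhs.
apply: filterS nO => s Os; have := is_derive_x (Cn_derivable (b := false) (hk 1%N) Os).
by have -> : (fun s => k (s, 0)) = L \o c by apply/funext => x; rewrite /k /= -surjective_pairing.
Qed.

Lemma accumulating_zeros (g : R -> R) (s0 l : R) : is_derive s0 1 g l -> g s0 = 0 ->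
  (forall d, 0 < d -> exists s, 0 < `|s - s0| < d /\ g s = 0) -> l = 0.
Proof.
move=> /is_derive_cvg /cvgrPdist_lt H g0 acc; apply/eqP; rewrite -normr_eq0.
rewrite eq_le normr_ge0 andbT leNgt; apply/negP => l0.
have := H _ l0; rewrite near_withinE => /near_interval [d d0 hd].
have [s [/andP[s1 s2] gs]] := acc d d0.
have := hd (s - s0); rewrite subr0 => /(_ s2) /(_ _).
have ss : s - s0 != 0 by rewrite -normr_gt0.
move=> /(_ ss); rewrite /shift /= [(s - s0) *: 1]mulr1 subrK gs g0 subrr scaler0 subr0.
by rewrite ltxx.
Qed.

(** By the Rolle theorem the zeros of the derivative accumulate as well. *)
Lemma accumulating_zeros2 (g dg : R -> R) (s0 dd : R) :
  (\forall s \near s0, is_derive (s : R) 1 g (dg s)) -> is_derive s0 1 dg dd -> g s0 = 0 ->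
  (forall d, 0 < d -> exists s, 0 < `|s - s0| < d /\ g s = 0) ->
  is_derive s0 1 g 0 /\ is_derive s0 1 (derive1 g) 0.
Proof.
move=> ng ddg g0 acc.
have dg0 : dg s0 = 0 by exact: (accumulating_zeros (nbhs_singleton ng) g0 acc).
have dd0 : dd = 0.
  apply: (accumulating_zeros ddg dg0) => d d0.
  have [d1 d10 H] := (near_interval _ _).1 ng.
  have [e [e0 ed ed1]] := ex_min2 d0 d10.
  have [s [/andP[s1 s2] gs]] := acc e e0.
  have cont (a b : R) : a < b -> (forall x, a <= x <= b -> `|x - s0| < d1) -> g a = 0 -> g b = 0 ->
      exists2 x, a < x < b & dg x = 0.
    move=> ab hx ga gb; have [||x] := @MVT R g dg a b ab.
    - by move=> x; rewrite in_itv /= => /andP[/ltW x1 /ltW x2]; apply: H; apply: hx; rewrite x1.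
    - apply: derivable_within_continuous => x; rewrite in_itv /= => hx'.
      by have [] := H x (hx x hx').
    rewrite in_itv /= => xab; rewrite ga gb subrr => /esym/eqP; rewrite mulf_eq0 => /orP[/eqP e'|].
      by exists x.
    by rewrite subr_eq0 => /eqP ba; move: ab; rewrite ba ltxx.
  have sn : s != s0 by apply: contraTneq s1 => ->; rewrite subrr normr0 ltxx.
  have [lt|gt] : s < s0 \/ s0 < s by apply/orP; rewrite -neq_lt.
    have [x|x /andP[x1 x2] gx] := cont s s0 lt _ gs g0.
      move=> /andP[x1 x2]; rewrite distrC ger0_norm ?subr_ge0 //; apply: le_lt_trans (lt_le_trans s2 ed1).
      by rewrite distrC ger0_norm ?subr_ge0 ?lerD2l ?lerN2 // ltW.
    exists x; split => //; rewrite normr_gt0 subr_eq0 (lt_eqF x2) /=.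
    rewrite distrC gtr0_norm ?subr_gt0 //; apply: lt_trans (lt_le_trans s2 ed).
    by rewrite distrC gtr0_norm ?subr_gt0 // ltrD2l ltrN2.
  have [x|x /andP[x1 x2] gx] := cont s0 s gt _ g0 gs.
    move=> /andP[x1 x2]; rewrite ger0_norm ?subr_ge0 //; apply: le_lt_trans (lt_le_trans s2 ed1).
    by rewrite ger0_norm ?subr_ge0 ?lerD2r // ltW.
  exists x; split => //; rewrite normr_gt0 subr_eq0 (gt_eqF x1) /=.
  rewrite gtr0_norm ?subr_gt0 //; apply: lt_trans (lt_le_trans s2 ed).
  by rewrite gtr0_norm ?subr_gt0 // ltrD2r.
split; first by have := nbhs_singleton ng; rewrite dg0.
rewrite -dd0; apply: near_eq_is_derive ddg.
by apply: filterS ng => s [_ e]; rewrite derive1E e.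
Qed.

Section Periodic.
Variables (P : R) (gam : R -> plane).
Hypothesis cc : closed_curve P gam.
Let P0 : 0 < P. Proof. by case: cc. Qed.

Lemma periodZ s (k : int) : gam (s + k%:~R * P) = gam s.
Proof.
have [_ _ per _] := cc.
have pn (n : nat) x : gam (x + n%:R * P) = gam x.
  by elim: n => [|n IH]; rewrite ?mul0r ?addr0 // mulrSr mulrDl mul1r addrA per.
case: k => n; first exact: pn.
have e := pn n.+1 (s - n.+1%:R * P); rewrite subrK in e.
by rewrite NegzE mulrNz mulNr; exact: (esym e).
Qed.

(** Parameters near [s0] suffice for the points of the curve near [gam s0]:
    the remaining part of a period is compact and avoids [gam s0]. *)
Lemma near_parameter (s0 d : R) : 0 < d -> exists2 e, 0 < e &
  forall s, `|gam s - gam s0| < e -> exists2 s', gam s' = gam s & `|s' - s0| < d.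
Proof.
move=> d0; have [_ [[sm _] _] _ inj] := cc.
have P20 : 0 < P / 2 by rewrite divr_gt0.
have [b [b0 bd bP]] := ex_min2 d0 P20.
have b2 : 0 < b / 2 by rewrite divr_gt0.
have b2b : b / 2 < b by rewrite ltr_pdivrMr // ltr_pMr // ltr1n.
have ab : s0 + b / 2 <= s0 + P - b / 2 by move: bP b2b; clear; lra.
have cg s : {for s, continuous gam}.
  by apply: differentiable_continuous; apply/derivable1_diffP; exact: (sm 0%N s Logic.I).
have cf : {within `[s0 + b / 2, s0 + P - b / 2], continuous (fun s => `|gam s - gam s0|)}.
  apply: continuous_subspaceT => s; apply: (continuous_comp (f := fun s => gam s - gam s0)).
    by apply: cvgB; [exact: cg|exact: cvg_cst].
  exact: norm_continuous.
have [c cin cmin] := EVT_min ab cf.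
have e0 : 0 < `|gam c - gam s0|.
  rewrite normr_gt0 subr_eq0; apply/negP => /eqP /inj [k ck].
  move: cin; rewrite in_itv /= ck => /andP[c1 c2].
  have k0 : 0 < k%:~R * P by move: c1 b2; clear; lra.
  have k1 : k%:~R * P < 1 * P by move: c2 b2; clear; lra.
  rewrite pmulr_lgt0 // ltr0z in k0; rewrite ltr_pM2r // ltrz1 in k1.
  by move: k0 k1; clear; case: k => [[|n]|n].
exists `|gam c - gam s0| => // s hs.
pose k := Num.floor ((s - s0) / P).
have /andP[f1 f2] := floor_itv ((s - s0) / P); rewrite -/k in f1 f2.
have [x xE] : exists x, x = s + (- k)%:~R * P by exists (s + (- k)%:~R * P).
have gx : gam x = gam s by rewrite xE periodZ.
have x1 : s0 <= x.
  by rewrite ler_pdivlMr // in f1; rewrite xE mulrNz mulNr; move: f1; clear; move: (k%:~R * P) => *; lra.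
have x2 : x < s0 + P.
  rewrite ltr_pdivrMr // intrD mulrDl mul1r in f2.
  by rewrite xE mulrNz mulNr; move: f2; clear; move: (k%:~R * P) => *; lra.
have [xs|xs] := ltP x (s0 + b / 2).
  exists x => //; rewrite ger0_norm ?subr_ge0 //; move: xs b2b bd; clear; lra.
have [xe|xe] := ltP (s0 + P - b / 2) x.
  exists (x + (-1)%:~R * P); first by rewrite periodZ.
  rewrite mulrN1z mulN1r ltr_norml; move: xe x2 b2b bd b2; clear; lra.
by have := cmin x; rewrite in_itv /= xs xe gx leNgt hs => /(_ isT).
Qed.

End Periodic.
End ClosedCurve.


Section Annulus.
Variable R : realType.
Local Notation plane := (plane R).
Implicit Types (f g h : plane -> R) (p q : plane) (O N A U V W : set plane) (I : set R).

Variables (P : R) (gam : R -> plane) (A : set plane) (eps : R) (cov : plane -> plane).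
Hypothesis (cc : closed_curve P gam) (aa : adjacent_annulus gam A) (uc : universal_covering gam A eps cov).

Let eps0 : 0 < eps. Proof. by case: uc. Qed.

Lemma hor_strip t : strip eps (hor t).
Proof. by rewrite /strip /= lexx. Qed.

(** The differential of the covering is injective, so its restriction to the
    boundary is not locally constant. *)
Lemma boundary_moves t (e : R) (W : set R) : 0 < e -> nbhs t W ->
  exists t', [/\ W t', cov (hor t') != cov (hor t) & `|cov (hor t') - cov (hor t)| < e].
Proof.
move=> e0 nW; have [_ [ O [oO sO sP]] J0 _ _] := uc.
have [h1 h2 PJ] := smooth_components oO sP.
have Ot : O (t, 0) := sO _ (hor_strip t).
have d1 := is_derive_x (Cn_derivable (b := false) (h1 1%N) Ot).
have d2 := is_derive_x (Cn_derivable (b := false) (h2 1%N) Ot).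
have dc : is_derive t 1 (cov \o @hor R) (pd false (fun q => (cov q).1) (t, 0), pd false (fun q => (cov q).2) (t, 0)).
  exact/is_derive_pair.
have cw : {for t, continuous (cov \o @hor R)}.
  by apply: differentiable_continuous; apply/derivable1_diffP; case: dc.
have nc : \forall s \near t, `|cov (hor s) - cov (hor t)| < e.
  by move/cvgrPdist_lt : cw => /(_ e e0); apply: filterS => s; rewrite /= distrC.
apply: contrapT => no.
have cst : \forall s \near t, cov (hor s) = cov (hor t).
  have := near_and nW nc; apply: filterS => s [Ws sn].
  by apply/eqP/negPn/negP => ns; apply: no; exists s.
have [_ z] := dc; move: z; rewrite (near_eq_derive _ (cst : \forall s \near t, (cov \o @hor R) s = (fun=> cov (hor t)) s)).
rewrite derive_cst => -[z1 z2].
have := J0 _ (hor_strip t); rewrite -PJ // /djac -[X in X * _ - _]z1 -[X in _ - _ * X]z2 mul0r mulr0 subrr.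
by rewrite eqxx.
Qed.

(** Lift the points on the normal to the curve to the covering sheet through
    [hor t]. The lifts tend to [hor t] and are not on the boundary of the
    strip, which is mapped to the curve; hence they are in [U]. *)
Lemma side_lifts U t s0 (W : set plane) : adjacent_hor setT U -> gam s0 = cov (hor t) ->
  nbhs ((t, 0) : plane) W -> exists2 d, 0 < d & forall r, 0 < r < d ->
    exists q, [/\ W q, U q & cov q = gam s0 + r *: inward gam s0].
Proof.
move=> ad cs nW; have [rA [oU _ U0 _ sd] _] := aa.
have [_ _ _ [_ cv] rb] := uc.
have [ O [sheets [[oO Ob] _ _ un hm]]] := cv (gam s0) (rA _ (ex_intro2 _ _ s0 Logic.I erefl)).
have [S sS St] : (\bigcup_(S in sheets) S) (hor t).
  rewrite un; split; first exact: hor_strip.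
  by rewrite /preimage /mkset -cs.
have [g [_ /subspace_continuousP gc gA gB]] := hm S sS.
have [AOb gb] := gA _ St; rewrite -cs in AOb gb.
have nZ := near_and nW (adjacent_hor_near openT ad (Logic.I : [set: R] t)).
rewrite -[X in nbhs X]gb in nZ.
have nZ' : \forall p \near gam s0, (A `&` O) p -> _ (g p) := gc _ AOb _ nZ.
have nO : \forall p \near gam s0, O p by apply: open_nbhs_nbhs.
have cl : (fun r : R => gam s0 + r *: inward gam s0) @ (0 : R) --> gam s0.
  have : (fun r : R => gam s0 + r *: inward gam s0) @ (0 : R) --> gam s0 + (0 : R) *: inward gam s0.
    by apply: cvgD; [exact: cvg_cst|apply: cvgZ; [exact: cvg_id|exact: cvg_cst]].
  by rewrite scale0r addr0.
have [d1 d10 H] := (near_interval _ _).1 (cl _ (near_and nO nZ')).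
have [d2 d20 Hs] := sd s0 Logic.I.
have [d [d0 dd1 dd2]] := ex_min2 d10 d20.
exists d => // r /andP[r0 rd].
have [|Op Zp] := H r; first by rewrite subr0 gtr0_norm // (lt_le_trans rd).
have [Ap ngp] : (A `\` range gam) (gam s0 + r *: inward gam s0).
  apply: Hs; exists s0, r; split => //; first by rewrite subrr normr0.
  by rewrite r0 (lt_le_trans rd).
have AOp : (A `&` O) (gam s0 + r *: inward gam s0) by [].
have [Wg [_ _ Ug _]] := Zp AOp; have [Sg cg] := gB _ AOp.
exists (g (gam s0 + r *: inward gam s0)); split => //; apply: Ug.
have [/andP[g0 _] _] : (strip eps `&` cov @^-1` O) (g (gam s0 + r *: inward gam s0)).
  by rewrite -un; exists S.
rewrite lt_def g0 andbT; apply/negP => /eqP gz; apply: ngp.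
by rewrite -cg [g _]surjective_pairing gz; exact: rb.
Qed.

(** Points of the curve covered by the boundary near [t] are zeros of [L]; they
    are different from [gam s0] and accumulate there. On the normal [L] is
    positive by [side_lifts]. *)
Lemma contact_covering U t s0 : adjacent_hor setT U -> gam s0 = cov (hor t) ->
  contact cov U (@hor R) t gam s0 (inward gam s0).
Proof.
move=> ad cs N L oN Nt hL L0 LU.
have [_ _ _ _ rb] := uc; have [_ [[sm _] _] _ _] := cc.
have L00 : L (gam s0) = 0 by rewrite cs; exact: nbhs_singleton L0.
have [dG [ddG [ng dd]]] := curve_twice_derivable openT sm (Logic.I : [set: R] s0) oN Nt hL.
have [|z1 z2] := accumulating_zeros2 ng dd L00.
  move=> d d0; have [e e0 H] := near_parameter cc s0 d0.
  have [t' [Lt' tn te]] := boundary_moves e0 L0.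
  have [s1 _ s1E] := rb t'.
  have [|s' s'E s'd] := H s1; first by rewrite s1E cs.
  exists s'; split; last by rewrite /= s'E s1E.
  rewrite s'd andbT normr_gt0 subr_eq0; apply: contra_neq tn => e'.
  by rewrite -s1E -s'E e' cs.
split => //.
have dL : is_derive (gam s0) (inward gam s0) L ('D_(inward gam s0) L (gam s0)).
  by apply/derivableP/diff_derivable; exact: (C1_differentiable oN (hL 1%N) Nt).1.
move/is_derive_line : dL => dL.
have [d d0 Hd] := side_lifts ad cs LU.
apply: (derive_ge0_right dL d0) => r rd.
have [q [Lq Uq qE]] := Hd r rd.
by rewrite addr0 scale0r add0r L00 addrC -qE; apply/ltW/Lq.
Qed.

Theorem annulus_flatly_close U1 h1 T1 U2 h2 T2 :
  adjacent_hor setT U1 -> lifted_caustics setT cov U1 h1 T1 ->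
  adjacent_hor setT U2 -> lifted_caustics setT cov U2 h2 T2 ->
  flatly_close setT (@hor R) U1 T1 U2 T2.
Proof.
move=> ad1 [le1 _ sy1] ad2 [le2 _ sy2].
have [_ [ O [oO sO sP]] J0 _ rb] := uc.
have [hP1 hP2 PJ] := smooth_components oO sP.
refine (@caustics_flatly_close R setT (@hor R) (fun=> (0, 1)) setT fst snd cov O U1 h1 T1 U2 h2 T2 openT openT (fun _ _ => Logic.I) (fst_Cinf R) (snd_Cinf R)
  (fun s r _ => hor_point s r) (fun s _ => hor_djac_neq0 (s, 0)) oO (fun t _ => sO _ (hor_strip t)) hP1 hP2 _ _ _ _ _ _ _ _).
- by move=> t _; rewrite PJ; [exact: J0 (hor_strip t)|exact: sO (hor_strip t)].
- by case: ad1.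
- by case: ad2.
- exact: le1.
- exact: le2.
- by move=> t It; exact: caustic_at_triples.
- by move=> t It; exact: caustic_at_triples.
move=> t _; have [s0 _ cs] := rb t; exists gam, s0; have [_ [[sm _] k0] _ _] := cc; split.
- by [].
- split; last exact: (sm 1%N s0 Logic.I).
  by apply: filterE => s; exact: (sm 0%N s Logic.I).
- exact: k0.
- exact: contact_covering.
- exact: contact_covering.
Qed.

End Annulus.

Theorem theorem1p28 (R : realType) :
  [/\ (* (A) *)
    (forall (I : set R) (gam : R -> plane R), planar_arc I gam ->
      (goes_to_infinity I gam -> bounds_convex_domain I gam ->
       forall U1 h1 T1 U2 h2 T2,
         adjacent_convex I gam U1 -> caustics_global I gam U1 h1 T1 ->
         adjacent_convex I gam U2 -> caustics_global I gam U2 h2 T2 ->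
         flatly_close I gam U1 T1 U2 T2) /\
      (forall U1 h1 T1 U2 h2 T2,
         adjacent_convex I gam U1 -> caustics_arc I gam U1 h1 T1 ->
         adjacent_convex I gam U2 -> caustics_arc I gam U2 h2 T2 ->
         flatly_close I gam U1 T1 U2 T2)),
    (* (B) *)
    (forall (psi : R -> plane R) (V : set (plane R)) (Psi : plane R -> plane R),
      let I := [set t : R | 0 < t < 1] in
      strictly_convex I psi ->
      adjacent_hor I V -> V `<=` [set p | I p.1] ->
      smooth_on (with_J I V) Psi ->
      (forall p, with_J I V p -> jac Psi p != 0) ->
      (forall t, I t -> Psi (hor t) = psi t) ->
      sends_to_convex_side I psi V Psi ->
      forall U1 h1 T1 U2 h2 T2,
        U1 `<=` V -> adjacent_hor I U1 -> lifted_caustics I Psi U1 h1 T1 ->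
        U2 `<=` V -> adjacent_hor I U2 -> lifted_caustics I Psi U2 h2 T2 ->
        flatly_close I (@hor R) U1 T1 U2 T2),
    (* (C) *)
    (forall (P : R) (gam : R -> plane R) (A : set (plane R)) (eps : R)
        (cov : plane R -> plane R),
      closed_curve P gam -> adjacent_annulus gam A ->
      universal_covering gam A eps cov ->
      forall U1 h1 T1 U2 h2 T2,
        U1 `<=` strip eps -> adjacent_hor setT U1 ->
        lifted_caustics setT cov U1 h1 T1 ->
        U2 `<=` strip eps -> adjacent_hor setT U2 ->
        lifted_caustics setT cov U2 h2 T2 ->
        flatly_close setT (@hor R) U1 T1 U2 T2),
    (* (D) *)
    (forall (I : set R) (V : set (plane R)) (F : plane R -> plane R),
      open_interval I -> adjacent_hor I V ->
      lifted_strongly_billiard_like I V F ->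
      forall U1 h1 U2 h2,
        invariant_foliation I V F U1 h1 -> invariant_foliation I V F U2 h2 ->
        flatly_close I (@hor R) U1 (kernel_field h1) U2 (kernel_field h2))
  & (* (E) *)
    (forall (I : set R) (V : set (plane R)) (F : plane R -> plane R),
      open_interval I -> adjacent_hor I V -> flat_twist I V F ->
      forall W1 h1 W2 h2,
        flat_invariant_foliation I V F W1 h1 ->
        flat_invariant_foliation I V F W2 h2 ->
        flatly_close I (@hor R) W1 (kernel_field h1) W2 (kernel_field h2))].
Proof.
split.
- move=> I gam pa; split=> [_ _|] U1 h1 T1 U2 h2 T2 ad1 ca1 ad2 ca2.
    have [le1 _ _ _] := ca1; have [le2 _ _ _] := ca2.
    by apply: (planar_arc_flatly_close pa ad1 ad2 le1 le2) => t It; exact: caustic_at_global.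
  have [le1 _ sy1] := ca1; have [le2 _ sy2] := ca2.
  by apply: (planar_arc_flatly_close pa ad1 ad2 le1 le2) => t It; exact: caustic_at_triples.
- move=> psi V Psi I sc adV _ sm J0 PE sd U1 h1 T1 U2 h2 T2 UV1 ad1 lc1 UV2 ad2 lc2.
  have oI : open I.
    have -> : I = `]0, 1[%classic by apply/seteqP; split=> x; rewrite /= in_itv.
    exact: interval_open.
  exact: (lifted_flatly_close oI sc adV sm J0 PE sd ad1 lc1 UV1 ad2 lc2 UV2).
- move=> P gam A eps cov cc aa uc U1 h1 T1 U2 h2 T2 _ ad1 lc1 _ ad2 lc2.
  exact: (annulus_flatly_close cc aa uc ad1 lc1 ad2 lc2).
- move=> I V F oI adV bF U1 h1 U2 h2.
  exact: (billiard_flatly_close oI adV bF).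
- move=> I V F oI _ _ W1 h1 W2 h2.
  exact: (twist_flatly_close oI).
Qed.
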